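(* Let $U\subset\mathbb{R}^n$ be an open subset, and let $\psi(U)$ be the set of proper $d$-dimensional submanifolds of $U$. The space $\widetilde{\Psi}(U)$ (the set $\psi(U)$ with neighbourhood bases given by the sets $(K,\epsilon)^{\mathrm{ls}}$) has the differential Fell topology. The differential Fell topology on $\psi(U)$ is therefore strictly coarser than the ($C^1$-)Galatius--Randal-Williams topology on $\psi(U)$.
   Context: Submanifolds are smooth, without boundary, possibly empty and possibly non-compact; $\psi(U)$ is the set of all $d$-dimensional submanifolds of $U$ that are proper, i.e. closed subsets of $U$. For $W\in\psi(U)$ let $p\colon NW\to W$ be the normal bundle and $\exp_W\colon NW\dashrightarrow U$ the exponential map, a partially defined function, defined in a neighbourhood of the zero section. Let $\tau\colon T(NW)\to NW$ be the composite of the canonical bundle map $T(NW)\to TW\oplus NW$ covering $p$ with the projection to $NW$; for a (local) section $f$ of $NW$, $\tau\circ(Df)(x)$ is a linear map $T_xW\to N_xW$, and $\|\tau\circ (Df)(x)\|$ is its operator norm. Galatius--Randal-Williams topology: a neighbourhood basis of $W$ is given by the sets $(K,\epsilon)^{\mathrm{gs}}$, for $K\subset U$ compact and $\epsilon>0$, where $W'\in(K,\epsilon)^{\mathrm{gs}}$ if there is a section $f$ of $NW\to W$ such that (1) $\exp_W(f(W))\cap K=W'\cap K$ and (2) $\|f(x)\|+\|\tau\circ(Df)(x)\|<\epsilon$ for all $x\in W$ such that $\exp_W(f(x))\in W'\cap K$. The space $\widetilde{\Psi}(U)$ is the set $\psi(U)$ with neighbourhood basis of $W$ given by the sets $(K,\epsilon)^{\mathrm{ls}}$,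 for $K\subset U$ compact and $\epsilon>0$, where $W'\in(K,\epsilon)^{\mathrm{ls}}$ if there is a subset $Q\subset NW$ such that the composite $q\colon Q\subset NW\to W$ (1) hits every point of $W\cap K$; (2) is a local diffeomorphism, i.e., a covering map; (3) satisfies $\exp_W(Q)\cap K=W'\cap K$; (4) satisfies $\|f(x)\|+\|\tau\circ(Df)(x)\|<\epsilon$ for each local section $f$ of the local diffeomorphism $q$. For a space $X$, $\mathrm{CL}(X)$ is the set of closed subsets of $X$. For $O\subset X$ put $O^-=\{A\in \mathrm{CL}(X): A\cap O\ne\emptyset\}$ and $O^+=\{A\in\mathrm{CL}(X): A\subset O\}$. The Fell topology on $\mathrm{CL}(X)$ has as subbasis all $O^-$ with $O$ open in $X$ and all $O^+$ with $O$ the complement of a compact subset of $X$. With $\mathrm{Gr}_d(\mathbb{R}^n)$ the Grassmannian of linear $d$-planes in $\mathbb{R}^n$, the differential Fell topology on $\psi(U)$ is the restriction of the Fell topology on $\mathrm{CL}(U\times\mathrm{Gr}_d(\mathbb{R}^n))$ along the inclusion $\mathrm{Gauss}\colon\psi(U)\to\mathrm{CL}(U\times\mathrm{Gr}_d(\mathbb{R}^n))$, $\mathrm{Gauss}(W)=\{(x,T_xW): x\in W\}$.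
   Formalization: Strictness is stated for U nonempty and d < n (otherwise both topologies coincide); the domain of exp_W is any neighbourhood of the zero section whose fibres map into compact subsets of U, since with the maximal domain the comparison with the Galatius–Randal-Williams topology fails. *)

(* Defs.v *)
From HB Require Import structures.
From mathcomp Require Import all_boot all_order all_algebra.
From mathcomp Require Import all_classical all_reals all_analysis.
From mathcomp Require Import lra.

Set Implicit Arguments.
Unset Strict Implicit.
Unset Printing Implicit Defensive.

Import Order.TTheory GRing.Theory Num.Theory.
Import numFieldNormedType.Exports.
Local Open Scope classical_set_scope.
Local Open Scope ring_scope.

Section Smooth.
Context {R : realType}.

Fixpoint Ck (E F : normedModType R) (k : nat) (V : set E) (f : E -> F) : Prop :=
  match k with
  | 0 => forall x, V x -> {for x, continuous f}
  | k'.+1 => (forall x, V x -> differentiable f x) /\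
             forall v, Ck k' V (fun x => 'D_v f x)
  end.

Definition smooth_open (E F : normedModType R) (V : set E) (f : E -> F) : Prop :=
  forall k, Ck k V f.

(* (V, F) is a smooth local extension around x of the restriction of f to A. *)
Definition local_extension (E E' : normedModType R) (A : set E) (f : E -> E')
    (x : E) (V : set E) (F : E -> E') : Prop :=
  [/\ open V, V x, smooth_open V F & forall y, A y -> V y -> F y = f y].

(* Smoothness on an arbitrary subset A of a normed space, in the sense of
   Milnor; only the values of f on A matter. *)
Definition smooth_on (E E' : normedModType R) (A : set E) (f : E -> E') : Prop :=
  forall x, A x -> exists V F, local_extension A f x V F.

Definition diffeo (E E' : normedModType R) (A : set E) (B : set E')
    (f : E -> E') (g : E' -> E) : Prop :=
  [/\ smooth_on A f, smooth_on B g,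
      forall x, A x -> B (f x) /\ g (f x) = x &
      forall y, B y -> A (g y) /\ f (g y) = y].

Definition local_diffeo (E E' : normedModType R) (A : set E) (B : set E')
    (f : E -> E') : Prop :=
  forall x, A x -> exists O V g,
    [/\ open O, O x, open V & diffeo (A `&` O) (B `&` V) f g].

End Smooth.

Section Submanifold.
Context {R : realType} {n : nat}.
Local Notation E := 'rV[R]_n.

Definition dot (u v : E) : R := \sum_(i < n) u 0 i * v 0 i.

(* The library's norm on 'rV_n is the sup norm. *)
Definition enorm (v : E) : R := Num.sqrt (dot v v).

(* phi, with inverse g, parametrizes a neighbourhood of x = phi u in W. *)
Definition parametrization (d : nat) (W : set E) (x : E) (O : set 'rV[R]_d)
    (V : set E) (phi : 'rV[R]_d -> E) (g : E -> 'rV[R]_d) (u : 'rV[R]_d) : Prop :=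
  [/\ open O, open V, diffeo O (W `&` V) phi g, O u & phi u = x].

Definition submanifold (d : nat) (W : set E) : Prop :=
  forall x, W x -> exists O V (phi : 'rV[R]_d -> E) g u,
    parametrization W x O V phi g u.

Definition tangent (d : nat) (W : set E) (x : E) : set E :=
  [set xi | exists O V (phi : 'rV[R]_d -> E) g u w,
    parametrization W x O V phi g u /\ xi = 'd phi u w].

Definition normal (d : nat) (W : set E) (x : E) : set E :=
  [set v | forall xi, tangent d W x xi -> dot xi v = 0].

Definition normal_bundle (d : nat) (W : set E) : set (E * E) :=
  [set z | W z.1 /\ normal d W z.1 z.2].

(* W is closed in the subspace U, which is not the same as closed in R^n. *)
Definition proper_submanifold (d : nat) (U W : set E) : Prop :=
  [/\ W `<=` U, closed (set_val @^-1` W : set U) & submanifold d W].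

(* nu is the image of xi under tau \o Df(x), where f is a section of the normal
   bundle over an open subset A of W.  Viewing f as a map to R^n, the vector
   D(x |-> (x, f x))(xi) of T(NW) is (xi, eta) in R^n x R^n, with eta the
   derivative of f along xi; its component in the second summand of TW (+) NW
   is the orthogonal projection of eta to the normal space. *)
Definition tauD (d : nat) (W A : set E) (f : E -> E) (x xi nu : E) : Prop :=
  exists V F, [/\ local_extension A f x V F, normal d W x nu &
                  tangent d W x ('d F x xi - nu)].

Definition tauD_opnorm (d : nat) (W A : set E) (f : E -> E) (x : E) : R :=
  sup [set r | exists xi nu, [/\ tangent d W x xi, enorm xi <= 1,
                                 tauD d W A f x xi nu & r = enorm nu]].

Definition C1_size (d : nat) (W A : set E) (f : E -> E) (x : E) : R :=
  enorm (f x) + tauD_opnorm d W A f x.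

(* f is (the fibre component of) a section of the normal bundle over A. *)
Definition normal_section (d : nat) (W A : set E) (f : E -> E) : Prop :=
  smooth_on A f /\ forall x, A x -> normal d W x (f x).

(* The flat exponential map. *)
Definition expW (z : E * E) : E := z.1 + z.2.

(* A domain of definition for the exponential map of W, i.e. a neighbourhood D
   of the zero section in the normal bundle from which all geodesics
   t |-> x + t v stay in U up to time 1.  The tube D is thin: the image of each
   of its fibres is contained in a compact subset of U.  Thinness is needed for
   gs below, whose smallness condition only concerns points that the section
   sends into K: for U = R^2, W = R x 0 and D = NW, large constant sections
   miss K and the empty manifold would be in every gs-neighbourhood of W. *)
Definition exp_domain (d : nat) (U W : set E) (D : set (E * E)) : Prop :=
  [/\ D `<=` normal_bundle d W,
      forall x, W x -> \forall z \near ((x, 0) : E * E),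
        normal_bundle d W z -> D z,
      forall z, D z -> forall t : R, 0 <= t <= 1 -> U (z.1 + t *: z.2) &
      forall x, W x -> exists C, [/\ compact C, C `<=` U &
        forall v, D (x, v) -> C (expW (x, v))]].

End Submanifold.

Lemma exp_domain_exists (R : realType) (n d : nat) (U W : set 'rV[R]_n) :
  open U -> W `<=` U -> exists D, exp_domain d U W D.
Proof.
move=> oU WU.
pose S (x v : 'rV[R]_n) := `|v| <= 1 /\ ball x (2 * `|v|) `<=` U.
have SU x v (t : R) : U x -> 0 <= t <= 1 -> S x v -> U (x + t *: v).
  move=> Ux /andP[t0 t1] [_ xvU]; have [->|v0] := eqVneq v 0.
    by rewrite scaler0 addr0.
  apply: xvU; rewrite -ball_normE /= opprD addNKr normrN normrZ ger0_norm//.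
  rewrite (@le_lt_trans _ _ `|v|)//; first by rewrite ler_piMl.
  by rewrite ltr_pMl ?normr_gt0// ltr1n.
exists [set z | normal_bundle d W z /\ S z.1 z.2]; split.
- by move=> z [].
- move=> x Wx; have /nbhs_ballP[e /= e0 eU] : nbhs x U.
    by apply: open_nbhs_nbhs; split=> //; exact: WU.
  have e40 : 0 < e / 4 by rewrite divr_gt0.
  have m0 : 0 < Num.min 1 (e / 4) by rewrite lt_min ltr01 e40.
  exists (ball x (e / 4), ball (0 : 'rV[R]_n) (Num.min 1 (e / 4))) => /=.
    by split; exact: nbhsx_ballx.
  move=> [y v] /= [xy]; rewrite -ball_normE /= sub0r normrN lt_min => /andP[v1 ve].
  move=> NW; split=> //; split; first exact: ltW.
  move=> z /=; rewrite -ball_normE /= => yz; apply: eU.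
  move: xy; rewrite -!ball_normE /= => xy.
  rewrite -(subrKA y) (le_lt_trans (ler_normD _ _))//.
  lra.
- by move=> z [[Wz _] Sz] t t01; apply: SU => //; exact: WU.
- move=> x Wx; exists [set y | S x (y - x)]; split.
  + apply: bounded_closed_compact.
      exists (`|x| + 1); split; first by rewrite num_real.
      move=> M xM y [yx _] /=; rewrite (le_trans _ (ltW xM))//.
      by rewrite -(subrK x y) addrC (le_trans (ler_normD _ _))// lerD2l.
    move=> y cy; split.
      rewrite leNgt; apply/negP => yx.
      have e0 : 0 < `|y - x| - 1 by rewrite subr_gt0.
      have [z [[zx _]]] := cy _ (nbhsx_ballx y _ e0).
      rewrite -ball_normE /= => yz.
      have : `|y - x| <= `|y - z| + `|z - x| by rewrite -(subrKA z) ler_normD.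
      by rewrite leNgt => /negP; apply; lra.
    move=> p; rewrite -ball_normE /= => xp.
    have e0 : 0 < `|y - x| - `|x - p| / 2 by lra.
    have [z [[_ zx]]] := cy _ (nbhsx_ballx y _ e0).
    rewrite -ball_normE /= => yz; apply: zx; rewrite -ball_normE /=.
    have : `|y - x| <= `|y - z| + `|z - x| by rewrite -(subrKA z) ler_normD.
    lra.
  + move=> y Sy; have := SU x (y - x) 1 (WU _ Wx) _ Sy.
    by rewrite scale1r addrC subrK lexx ler01; exact.
  + by move=> v [_ Sv] /=; rewrite /expW /= addrC addKr.
Qed.

Section Grassmannian.
Context {R : realType}.
Variables (d n : nat).

Definition frames : set 'M[R]_(d, n) := [set M | row_free M].

Definition rowspace (M : 'M[R]_(d, n)) : {vspace 'rV[R]_n} :=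
  limg (linfun (mulmxr M : 'rV[R]_d -> 'rV[R]_n)).

Lemma memv_rowspace (M : 'M[R]_(d, n)) v : (v \in rowspace M) = (v <= M)%MS.
Proof.
apply/idP/idP.
- move=> /memv_imgP[u _ ->]; rewrite lfunE /=; exact: submxMl.
- move=> /submxP[u ->]; apply/memv_imgP; exists u; rewrite ?memvf//.
  by rewrite lfunE.
Qed.

Lemma dim_rowspace (M : frames) : \dim (rowspace (set_val M)) == d.
Proof.
case: M => M MF; rewrite set_valE /=; have fM : row_free M := set_mem MF.
suff k0 : lker (linfun (mulmxr M : 'rV[R]_d -> 'rV[R]_n)) = 0%VS.
  by rewrite limg_dim_eq ?k0 ?capv0// dimvf /dim /= mul1n.
by apply/eqP/lker0P => u v; rewrite !lfunE /=; exact: row_free_inj.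
Qed.

Definition Gr : Type := {V : {vspace 'rV[R]_n} | \dim V == d}.
HB.instance Definition _ := Choice.on Gr.

Definition span_frame (M : frames) : Gr :=
  exist (fun V => \dim V == d) _ (dim_rowspace M).

(* The quotient topology from the space of d-frames in R^n. *)
Definition Gr_open : set (set Gr) := [set O | open (span_frame @^-1` O)].

Lemma Gr_openT : Gr_open setT. Proof. exact: openT. Qed.

Lemma Gr_openI : setI_closed Gr_open.
Proof. move=> A B oA oB; exact: openI. Qed.

Lemma Gr_open_bigU (I : Type) (F : I -> set Gr) :
  (forall i, Gr_open (F i)) -> Gr_open (\bigcup_i F i).
Proof.
by move=> oF; rewrite /Gr_open /= preimage_bigcup; apply: bigcup_open => i _; exact: oF.
Qed.

HB.instance Definition _ :=
  isOpenTopological.Build Gr Gr_openT Gr_openI Gr_open_bigU.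

End Grassmannian.

Section Fell.
Variable X : topologicalType.

Record CL := MkCL { CL_set :> set X; CL_closed : closed CL_set }.

HB.instance Definition _ := gen_eqMixin CL.
HB.instance Definition _ := gen_choiceMixin CL.

Definition fell_hit (O : set X) : set CL := [set A | A `&` O !=set0].
Definition fell_miss (O : set X) : set CL := [set A | A `<=` O].

Definition fell_subbase : set (set CL) :=
  [set fell_hit O | O in open] `|` [set fell_miss (~` K) | K in compact].

HB.instance Definition _ :=
  isSubBaseTopological.Build CL fell_subbase id.

End Fell.

Section GaussSet.
Context {R : realType} {n : nat}.
Variables (d : nat) (U : set 'rV[R]_n).

Definition gauss_set (W : set 'rV[R]_n) : set (set_type U * @Gr R d n) :=
  [set p : set_type U * @Gr R d n | W (set_val p.1) /\
     [set v | v \in sval p.2] = tangent d W (set_val p.1)].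

End GaussSet.

Section TangentSpace.
Context {R : realType}.

Lemma near_eq_diff (E F : normedModType R) (f g : E -> F) (a : E) :
  (\forall x \near a, f x = g x) -> differentiable f a ->
  differentiable g a /\ 'd g a = 'd f a :> (E -> F).
Proof.
move=> fg /diff_locallyP[cf df].
suff dg : g \o shift a = cst (g a) + 'd f a +o_ 0 id.
  have e : 'd g a = 'd f a :> (E -> F) by apply: diff_unique.
  split; last exact: e.
  by apply/diff_locallyP; rewrite e; split.
apply/eqaddoP => e e0.
have /eqaddoP/(_ e e0) df' := df.
have fg0 : \forall h \near (0 : E), f (h + a) = g (h + a).
  have := fg; rewrite (near_shift 0 a) /=.
  by apply: filterS => z /=; rewrite subr0.
near=> h.
have <- : (f \o shift a - (cst (f a) + 'd f a)) h =
          (g \o shift a - (cst (g a) + 'd f a)) h.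
  rewrite !fctE /= (nbhs_singleton fg); congr (_ - _).
  by near: h.
by near: h.
Unshelve. all: by end_near. Qed.

Lemma local_extension_near (E F : normedModType R) (A : set E) (f : E -> F)
    (x : E) V G : open A -> A x -> local_extension A f x V G ->
  \forall y \near x, G y = f y.
Proof.
move=> oA Ax [oV Vx _ GE]; near=> y; apply: GE; near: y.
  exact: open_nbhs_nbhs.
exact: open_nbhs_nbhs.
Unshelve. all: by end_near. Qed.

Lemma local_extension_diff (E F : normedModType R) (A : set E) (f : E -> F)
    (x : E) V G : local_extension A f x V G -> differentiable G x.
Proof. by move=> [oV Vx sG _]; have [dG _] := sG 1%N; exact: dG. Qed.

Lemma smooth_on_diff (E F : normedModType R) (A : set E) (f : E -> F) (x : E) :
  open A -> A x -> smooth_on A f -> differentiable f x.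
Proof.
move=> oA Ax sf; have [V [G VG]] := sf x Ax.
by have [] := near_eq_diff (local_extension_near oA Ax VG)
  (local_extension_diff VG).
Qed.

Variables (n d : nat).
Local Notation E := 'rV[R]_n.
Local Notation F := 'rV[R]_d.

Lemma parametrization_inv (W : set E) x O V (phi : F -> E) g u :
    parametrization W x O V phi g u ->
  exists G : E -> F, [/\ differentiable phi u, differentiable G x,
    \forall w \near u, G (phi w) = w &
    \forall y \near x, W y -> V y /\ G y = g y].
Proof.
move=> [oO oV [sphi sg phig gphi] Ou phiu].
have WVx : (W `&` V) x by rewrite -phiu; have [] := phig _ Ou.
have [V' [G VG]] := sg _ WVx.
have dphi := smooth_on_diff oO Ou sphi.
exists G; split=> //; first exact: local_extension_diff VG.
- have [oV' V'x _ GE] := VG.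
  have nV' : \forall w \near u, V' (phi w).
    have := differentiable_continuous dphi; apply; rewrite phiu.
    exact: open_nbhs_nbhs.
  near=> w.
  have Ow : O w by near: w; exact: open_nbhs_nbhs.
  have [? ge] := phig w Ow.
  by rewrite GE//; near: w.
- have [oV' V'x _ GE] := VG.
  near=> y => Wy.
  have Vy : V y by near: y; apply: open_nbhs_nbhs; split => //; case: WVx.
  split=> //; apply: GE => //; near: y; exact: open_nbhs_nbhs.
Unshelve. all: by end_near. Qed.

Lemma tangent_jacobian (W : set E) x O V (phi : F -> E) g u :
    parametrization W x O V phi g u ->
  tangent d W x = [set xi | (xi <= jacobian phi u)%MS].
Proof.
move=> pW; apply/seteqP; split => xi; last first.
- move=> /submxP[w ->]; exists O, V, phi, g, u, w; split=> //.
  by rewrite /jacobian mul_rV_lin1.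
move=> [B [V' [phi' [g' [u' [w' [pW' ->]]]]]]].
have [G [dphi dG Gphi GE]] := parametrization_inv pW.
have [_ [dphi' _ _ _]] := parametrization_inv pW'.
have [oO oV [_ _ phig gphi] Ou phiu] := pW.
have [oB _ [_ _ phig' gphi'] Ou' phiu'] := pW'.
have nW : \forall w \near u',
    W (phi' w) -> V (phi' w) /\ G (phi' w) = g (phi' w).
  have /(_ [set y | W y -> V y /\ G y = g y]) :=
    differentiable_continuous dphi'.
  by apply; rewrite phiu'; exact: GE.
have e : \forall w \near u', (phi \o (G \o phi')) w = phi' w.
  near=> w.
  have Ow : B w by near: w; exact: open_nbhs_nbhs.
  have [[Ww _] _] := phig' w Ow.
  by have /(_ Ww) : W (phi' w) -> V (phi' w) /\ G (phi' w) = g (phi' w);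
    [near: w | move=> [Vw /= ->]; have [] := gphi _ (conj Ww Vw)].
have Gx : G x = u by have := nbhs_singleton Gphi; rewrite phiu.
have dGphi' : differentiable (G \o phi') u'.
  by apply: differentiable_comp; rewrite ?phiu'.
have dcomp : differentiable (phi \o (G \o phi')) u'.
  by apply: differentiable_comp => //=; rewrite phiu' Gx.
have [_ ->] := near_eq_diff e dcomp.
rewrite diff_comp//=; last by rewrite phiu' Gx.
rewrite phiu' Gx.
by apply/submxP; eexists; rewrite /jacobian mul_rV_lin1.
Unshelve. all: by end_near. Qed.

Lemma jacobian_free (W : set E) x O V (phi : F -> E) g u :
  parametrization W x O V phi g u -> row_free (jacobian phi u).
Proof.
move=> pW; have [G [dphi dG Gphi GE]] := parametrization_inv pW.
have [_ _ _ _ phiu] := pW.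
have did : differentiable (@id F) u by [].
have e : \forall w \near u, id w = (G \o phi) w by near do apply/esym.
have [_ dE] := near_eq_diff e did.
have dG' : differentiable G (phi u) by rewrite phiu.
have idE : 'd (@id F) u = id :> (F -> F) by exact: diff_val.
apply/inj_row_free => w w0.
transitivity ('d (G \o phi) u w).
  apply: esym; apply: etrans (congr1 (fun f : F -> F => f w) dE) _.
  exact: (congr1 (fun f : F -> F => f w) idE).
rewrite (diff_comp dphi dG') /=.
by move: w0; rewrite /jacobian mul_rV_lin1 => ->; rewrite linear0.
Unshelve. all: by end_near. Qed.

End TangentSpace.

Section GaussClosed.
Context {R : realType}.

Lemma cvg_mx_entry (T : Type) (F : set_system T) (FF : Filter F) m n
    (f : T -> 'M[R]_(m, n)) (M : 'M[R]_(m, n)) :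
  (forall i j, (fun t => f t i j) @ F --> M i j) -> f @ F --> M.
Proof.
move=> fM A [P MP PA]; rewrite /= nbhs_filterE.
have : \forall t \near F, forall ij : 'I_m * 'I_n, P ij.1 ij.2 (f t ij.1 ij.2).
  apply: filter_forall => -[i j] /=; exact: fM (MP i j).
by apply: filterS => t Pt; apply: PA => i j; exact: (Pt (i, j)).
Qed.

Lemma cvg_bigsum (T I : Type) (F : set_system T) (FF : Filter F) (r : seq I)
    (f : I -> T -> R) (a : I -> R) :
  (forall i, f i t @[t --> F] --> a i) ->
  \sum_(i <- r) f i t @[t --> F] --> \sum_(i <- r) a i.
Proof.
move=> fa; apply: (@cvg_big R I +%R 0 xpredT) => //.
by move=> x; exact: add_continuous.
Qed.

Lemma cvg_bigprod (T I : Type) (F : set_system T) (FF : Filter F) (r : seq I)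
    (f : I -> T -> R) (a : I -> R) :
  (forall i, f i t @[t --> F] --> a i) ->
  \prod_(i <- r) f i t @[t --> F] --> \prod_(i <- r) a i.
Proof.
move=> fa; apply: (@cvg_big R I *%R 1 xpredT) => //.
by move=> x; exact: mul_continuous.
Qed.

Lemma mulmxl_continuous m n p (C : 'M[R]_(m, n)) :
  continuous (fun M : 'M[R]_(n, p) => C *m M).
Proof.
move=> M; apply: (@cvg_mx_entry _ (nbhs M)) => i j.
rewrite [X in _ --> X]mxE; under eq_cvg do rewrite mxE.
apply: (@cvg_bigsum _ _ (nbhs M)) => k; apply: cvgM; first exact: cvg_cst.
exact: coord_continuous.
Qed.

Lemma mulmxr_continuous m n p (C : 'M[R]_(n, p)) :
  continuous (fun M : 'M[R]_(m, n) => M *m C).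
Proof.
move=> M; apply: (@cvg_mx_entry _ (nbhs M)) => i j.
rewrite [X in _ --> X]mxE; under eq_cvg do rewrite mxE.
apply: (@cvg_bigsum _ _ (nbhs M)) => k; apply: cvgM; last exact: cvg_cst.
exact: coord_continuous.
Qed.

Lemma det_continuous n : continuous (fun M : 'M[R]_n => \det M).
Proof.
move=> M; apply: (@cvg_bigsum _ _ (nbhs M)) => s; apply: cvgM; first exact: cvg_cst.
apply: (@cvg_bigprod _ _ (nbhs M)) => i; exact: coord_continuous.
Qed.

Lemma row_free_near m n (M : 'M[R]_(m, n)) : row_free M ->
  \forall N \near M, row_free N.
Proof.
move=> /row_freeP[C MC].
have : (fun N : 'M[R]_(m, n) => \det (N *m C)) @ M --> \det (M *m C).
  apply: (@continuous_comp _ _ _ (fun N : 'M[R]_(m, n) => N *m C)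
    (fun N : 'M[R]_m => \det N)); first exact: mulmxr_continuous.
  exact: det_continuous.
move=> /cvgr_neq0; rewrite MC det1 => /(_ (oner_neq0 _)).
apply: filterS => N.
rewrite -unitfE -[_ \is a GRing.unit]/(N *m C \in unitmx) => NC.
by apply/row_freeP; exists (C *m invmx (N *m C)); rewrite mulmxA mulmxV.
Qed.

Lemma row_free_col_mx m n (r : 'rV[R]_n) (M : 'M[R]_(m, n)) :
  row_free M -> ~~ (r <= M)%MS -> row_free (col_mx r M).
Proof.
move=> fM rM; apply/inj_row_free => w.
rewrite -[w]hsubmxK mul_row_col => w0.
have [a0|a0] := eqVneq (lsubmx w) 0.
  move: w0; rewrite a0 mul0mx add0r => /eqP.
  by rewrite mulmx_free_eq0// => /eqP ->; rewrite row_mx0.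
case/negP: rM; set a := lsubmx w in w0 a0.
have au : a \in unitmx.
  rewrite unitmxE det_mx11 unitfE; apply: contra a0 => /eqP a0.
  by apply/eqP/matrixP => i j; rewrite !ord1 a0 mxE.
apply/submxP; exists (- (invmx a *m rsubmx w)).
move/eqP: w0; rewrite addr_eq0 => /eqP/(congr1 (mulmx (invmx a))).
by rewrite mulmxA mulVmx// mul1mx => ->; rewrite mulmxN mulNmx mulmxA.
Qed.

Lemma row_free_col_mxN m n (r : 'rV[R]_n) (M : 'M[R]_(m, n)) :
  row_free (col_mx r M) -> ~~ (r <= M)%MS.
Proof.
move=> fr; apply/negP => /submxP[c rc].
have : row_mx 1%:M (- c) *m col_mx r M = 0.
  by rewrite mul_row_col mul1mx mulNmx rc subrr.
move=> /eqP; rewrite mulmx_free_eq0// => /eqP /(congr1 lsubmx).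
rewrite row_mxKl => /matrixP/(_ 0 0); rewrite !mxE eqxx.
by move/eqP; rewrite mulr1n oner_eq0.
Qed.

Lemma span_frame_surj d n (P : @Gr R d n) : exists M, span_frame M = P.
Proof.
case: P => V dV; have /eqP dVE := dV; subst d.
pose M : 'M[R]_(\dim V, n) := \matrix_(i < \dim V) (vbasis V)`_i.
have fM : row_free M.
  apply/inj_row_free => w; rewrite mulmx_sum_row => w0.
  have /freeP/(_ (fun i => w 0 i)) : free (vbasis V).
    exact: basis_free (vbasisP V).
  move=> fV; apply/rowP => i; rewrite mxE; apply: fV.
  by rewrite -[RHS]w0; apply: eq_bigr => j _; rewrite rowK.
have fM' : M \in @frames R (\dim V) n by rewrite inE.
exists (exist _ M fM'); apply/val_inj => /=; rewrite set_valE /=.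
apply/vspaceP => v; rewrite memv_rowspace; apply/idP/idP.
  move=> /submxP[w ->]; rewrite mulmx_sum_row; apply: memv_suml => j _.
  by rewrite memvZ// rowK vbasis_mem// mem_nth// size_tuple.
move=> /coord_vbasis ->; apply: summx_sub => j _; apply: scalemx_sub.
have <- : row j M = (vbasis V)`_j by rewrite rowK.
exact: row_sub.
Qed.

Lemma span_frame_near d n (M : @frames R d n) (A : set 'M[R]_(d, n)) :
  nbhs (set_val M) A ->
  nbhs (span_frame M) [set P | exists2 N, A (set_val N) & span_frame N = P].
Proof.
rewrite nbhsE => -[B [oB BM] BA].
pose S : set (@Gr R d n) :=
  [set P | exists2 N, B (set_val N) & span_frame N = P].
suff oS : open S.
  have : nbhs (span_frame M) S by apply: open_nbhs_nbhs; split=> //; exists M.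
  by apply: filterS => P [N BN <-]; exists N => //; exact: BA.
suff : open (@span_frame R d n @^-1` S : set (@frames R d n)) by [].
exists (\bigcup_(C in [set C | C \in unitmx]) ((fun N => C *m N) @^-1` B)).
  apply: bigcup_open => C _; apply: open_comp => // N _.
  exact: mulmxl_continuous.
apply/seteqP; split=> [[N Nf]|[N Nf]] /=; rewrite set_valE /=.
- have fN : row_free N := set_mem Nf.
  move=> [C /= Cu BCN].
  have CNf : C *m N \in @frames R d n.
    by rewrite inE /frames /= /row_free mxrankMfree// -/(row_free C) row_free_unit.
  exists (exist _ (C *m N) CNf) => //; apply/val_inj => /=; rewrite !set_valE /=.
  apply/vspaceP => v; rewrite !memv_rowspace; apply/idP/idP => vN.
    exact: submx_trans vN (submxMl _ _).
  apply: submx_trans vN _; apply/submxP; exists (invmx C).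
  by rewrite mulmxA mulVmx// mul1mx.
- have fN : row_free N := set_mem Nf.
  move=> [[N' N'f]]; rewrite set_valE /= => BN' /(congr1 val) /=.
  rewrite !set_valE /= => /vspaceP e.
  have fN' : row_free N' := set_mem N'f.
  have /submxP[C N'E] : (N' <= N)%MS.
    apply/row_subP => i; rewrite -memv_rowspace -e memv_rowspace.
    exact: row_sub.
  exists C => /=; last by rewrite -N'E.
  by rewrite -row_free_unit /row_free -(mxrankMfree C fN) -N'E.
Qed.

Variables (n d : nat).
Local Notation E := 'rV[R]_n.

Lemma tangent_frame (W : set E) x : submanifold d W -> W x ->
  exists H : E -> 'M[R]_(d, n),
    [/\ {for x, continuous H}, row_free (H x) &
      \forall y \near x, W y -> tangent d W y = [set xi | (xi <= H y)%MS]].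
Proof.
move=> sW Wx; have [D [V [phi [g [u pW]]]]] := sW x Wx.
have [G [dphi dG Gphi GE]] := parametrization_inv pW.
have [oD oV [sphi sg phig gphi] Du phiu] := pW.
have [V' [K VK]] := sphi u Du.
have [oV' V'u sK _] := VK.
have Gx : G x = u by have := nbhs_singleton Gphi; rewrite phiu.
have [dK cK] := sK 1%N.
pose H y : 'M[R]_(d, n) := \matrix_(i, j) ('D_(delta_mx 0 i) K (G y)) 0 j.
have nK : \forall w \near u, jacobian phi w =
    \matrix_(i, j) ('D_(delta_mx 0 i) K w) 0 j.
  have e := local_extension_near oD Du VK.
  have {}e : \near u, \near u, K u = phi u by exact: (nbhs_interior e).
  near=> w.
  have V'w : V' w by near: w; exact: open_nbhs_nbhs.
  have [] := @near_eq_diff _ _ _ K phi w _ (dK w V'w).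
    by near: w.
  move=> dpw eK; apply/matrixP => i j; rewrite !mxE (deriveE _ (dK w V'w)).
  exact: (congr1 (fun h : 'rV[R]_d -> E => h (delta_mx 0 i) 0 j) eK).
have nH : \forall y \near x, jacobian phi (G y) = H y.
  have /(_ [set w | jacobian phi w =
    \matrix_(i, j) ('D_(delta_mx 0 i) K w) 0 j]) := differentiable_continuous dG.
  by apply; rewrite Gx.
exists H; split.
- apply: (@cvg_mx_entry _ (nbhs x)) => i j; rewrite [X in _ --> X]mxE.
  under eq_cvg do rewrite mxE.
  apply: (@continuous_comp _ _ _ (fun y => 'D_(delta_mx 0 i) K (G y))
     (fun v : E => v 0 j)); last exact: coord_continuous.
  apply: (@continuous_comp _ _ _ G (fun w => 'D_(delta_mx 0 i) K w)).
    exact: differentiable_continuous.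
  by rewrite Gx; exact: cK.
- by rewrite -(nbhs_singleton nH) Gx; exact: jacobian_free pW.
- near=> y => Wy.
  have [Vy Gy] : V y /\ G y = g y.
    suff : W y -> V y /\ G y = g y by exact.
    by near: y.
  have [Ogy pgy] := gphi _ (conj Wy Vy).
  have pWy : parametrization W y D V phi g (g y) by split.
  rewrite (tangent_jacobian pWy) -Gy.
  by have -> : jacobian phi (G y) = H y by near: y.
Unshelve. all: by end_near. Qed.

Lemma gauss_closed (U : set E) (W : set E) :
  proper_submanifold d U W -> closed (gauss_set (d := d) (U := U) W).
Proof.
move=> [WU cW sW] [x P] clP.
have Wx : W (set_val x).
  apply: (cW x) => N xN.
  have [] := clP (N `*` setT); first by exists (N, setT) => //=; split=> //; exact: filterT.
  by move=> [y Q] /= [[Wy _] [Ny _]]; exists y.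
split=> //=.
have [H [cH fH tH]] := tangent_frame sW Wx.
rewrite (nbhs_singleton tH Wx).
have [M MP] := span_frame_surj P.
have fM : row_free (set_val M) by case: (M) => M' M'f; exact: set_mem M'f.
have PE v : (v \in sval P) = (v <= set_val M)%MS.
  by rewrite -MP /= memv_rowspace.
suff MH : (set_val M <= H (set_val x))%MS.
  have HM : (H (set_val x) <= set_val M)%MS.
    have := mxrank_leqif_sup MH => /leqifP.
    by move: fM fH; rewrite /row_free => /eqP -> /eqP ->; case: ifP => // _; rewrite ltnn.
  apply/seteqP; split=> v /=; rewrite PE => vM; exact: submx_trans vM _.
apply/negPn/negP => /row_subPn[i iH].
have fK := row_free_col_mx fH iH.
pose K (z : 'M[R]_(d, n) * E) := col_mx (row i z.1) (H z.2).
have cK : K z @[z --> (set_val M, set_val x)] --> K (set_val M, set_val x).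
  apply: (@cvg_mx_entry _ (nbhs (set_val M, set_val x))) => k l.
  rewrite /K; case: (split_ordP k) => j ->.
    under eq_cvg do rewrite col_mxEu mxE; rewrite col_mxEu mxE.
    apply: (@continuous_comp _ _ _ fst (fun N : 'M[R]_(d, n) => N i l)).
      exact: cvg_fst.
    exact: coord_continuous.
  under eq_cvg do rewrite col_mxEd; rewrite col_mxEd.
  apply: (@continuous_comp _ _ _ snd (fun y => H y j l)).
    exact: cvg_snd.
  apply: (@continuous_comp _ _ _ H (fun N : 'M[R]_(d, n) => N j l)) => //.
  exact: coord_continuous.
have [[A B] [/= MA xB] AB] := cK _ (row_free_near fK).
pose N1 : set U := set_val @^-1` (B `&` [set y | W y -> tangent d W y = [set xi | (xi <= H y)%MS]]).
have nN1 : nbhs x N1.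
  by apply: (@initial_continuous _ _ set_val); exact: filterI.
have nN2 := span_frame_near MA; rewrite MP in nN2.
have [] := clP (N1 `*` [set P | exists2 N, A (set_val N) & span_frame N = P]).
  by eexists (_, _); first split; [exact: nN1|exact: nN2|].
move=> [y Q] /= [[Wy Qy] [[By ty] [N AN NQ]]].
have /row_free_col_mxN/negP := AB (set_val N, set_val y) (conj AN By).
apply => /=.
have : [set v | v \in sval Q] (row i (set_val N)).
  by rewrite /= -NQ /= memv_rowspace row_sub.
by rewrite Qy ty.
Qed.

End GaussClosed.

Section Topologies.
Context {R : realType} {n : nat}.
Local Notation E := 'rV[R]_n.
Variables (d : nat) (U : set E).

Record psi := Psi { psi_set :> set E; psiP : proper_submanifold d U psi_set }.

HB.instance Definition _ := gen_eqMixin psi.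
HB.instance Definition _ := gen_choiceMixin psi.

Definition gauss (W : psi) : CL (set_type U * @Gr R d n)%type :=
  MkCL (gauss_closed (psiP W)).

(* psi(U) with the differential Fell topology. *)
Definition dfell : Type := initial_topology gauss.
HB.instance Definition _ := Topological.on dfell.

(* D is the domain of the exponential map of W.  That expW is partially
   defined is rendered by requiring sections (resp. Q) to take values in
   (resp. to lie in) D. *)
Definition gs (W : psi) (D : set (E * E)) (K : set E) (eps : R) : set psi :=
  [set W' | exists f : E -> E,
    [/\ normal_section d W W f,
        forall x, psi_set W x -> D (x, f x),
        [set expW (x, f x) | x in psi_set W] `&` K = psi_set W' `&` K &
        forall x, psi_set W x -> (psi_set W' `&` K) (expW (x, f x)) ->
          C1_size d W W f x < eps]].

Definition ls (W : psi) (D : set (E * E)) (K : set E) (eps : R) : set psi :=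
  [set W' | exists Q : set (E * E),
    [/\ Q `<=` D,
        psi_set W `&` K `<=` [set z.1 | z in Q],
        local_diffeo Q W fst,
        expW @` Q `&` K = psi_set W' `&` K &
        forall (V : set E) (f : E -> E), open V -> smooth_on (psi_set W `&` V) f ->
          (forall x, (psi_set W `&` V) x -> Q (x, f x)) ->
          forall x, (psi_set W `&` V) x -> C1_size d W (psi_set W `&` V) f x < eps]].

Definition compact_eps : set (set E * R) :=
  [set p | [/\ compact p.1, p.1 `<=` U & 0 < p.2]].

Definition gs_nbhs (D : psi -> set (E * E)) (W : psi) : set_system psi :=
  filter_from compact_eps (fun p => gs W (D W) p.1 p.2).

Definition ls_nbhs (D : psi -> set (E * E)) (W : psi) : set_system psi :=
  filter_from compact_eps (fun p => ls W (D W) p.1 p.2).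

(* The open sets of the Galatius--Randal-Williams topology. *)
Definition grw_open (D : psi -> set (E * E)) : set_system psi :=
  [set A | forall W : psi, A W -> gs_nbhs D W A].

End Topologies.

(* Main.v *)
(* Call [y] a sheet point of [W'] over [x] when [y = x + f x] for a C^1-small
   local section [f] of the normal bundle of [W] whose graph lies in [W'].  Sheet
   points are close to [W] in position and in tangent direction, and membership
   in [ls] or [gs] provides one over each point of [W] and through each point of
   [W'] in a given compact set; hence both topologies refine the differential
   Fell topology.

   Conversely, let [W'] be Fell-close to [W].  Since the Grassmannian is compact,
   [W'] is over a compact set close to [W] in position and in tangent direction,
   so its tangent spaces are transversal to the normal spaces of [W].  By the
   inverse function theorem the set [Q] of small normal vectors of [W] that end
   on [W'] is then locally diffeomorphic to [W].  Through every point of [W']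
   there is one (nearest point on [W]), and the angle between the tangent spaces
   together with the second fundamental form bounds the derivative of the local
   sections of [Q].

   For strictness, parallel affine sheets [L] and [L + e / k] merge to [L] in the
   Fell topology, whereas a section of the normal bundle of [L] has a single
   value over each point and cannot reach both.  As the Fell topology is
   Hausdorff here, the complement of this sequence is open in the finer topology
   only. *)

From HB Require Import structures.
Require Import Defs.
From mathcomp Require Import all_boot all_order all_algebra.
From mathcomp Require Import all_classical all_reals all_analysis.
From mathcomp Require Import ring lra.

Set Implicit Arguments.
Unset Strict Implicit.
Unset Printing Implicit Defensive.

Import Order.TTheory GRing.Theory Num.Theory.
Import numFieldNormedType.Exports.
Local Open Scope classical_set_scope.
Local Open Scope ring_scope.

(** Nearest points on [W] show that [Q] reaches every point of [W'], but not that [Q] has a point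
    over every [x] in [W] and [K]. For the latter, Fell closeness supplies some point of [W'] near
    [x], and the component of [y - x] tangent to [W] is minimized over [y] in [W']. The work lies in
    keeping the minimizer off the boundary of the ball in which it is sought: [W'] must stay close
    to [W], and [W] must be nearly flat there.

    The size in [ls] and [gs] sees only the normal component of the derivative of a section. With
    [A] and [B] the Jacobians of a chart and of the section read in it, vectors [a *m B] split as
    [b *m A + nu]. The normal part [nu] is governed by the operator norm or by the angle with [W'],
    the tangential part by the second fundamental form times the length of the section. This
    splitting serves both directions of the comparison.

    Charts carry no orthonormal frames; lower bounds for the Gram matrix [A *m A^T], uniform near a
    base point, replace them. Estimates are proved near one point of [W] and spread over compact
    sets by covering. *)

(** * Calculus of [C^k] maps *)

Section CkTheory.
Context {R : realType}.
Implicit Types E F G : normedModType R.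

Lemma diff_compE E F G (f : E -> F) (g : F -> G) x v :
  differentiable f x -> differentiable g (f x) ->
  'd (g \o f) x v = 'd g (f x) ('d f x v).
Proof.
by move=> df dg; exact: (congr1 (fun h : E -> G => h v) (diff_comp df dg)).
Qed.

Lemma derive_comp E F G (f : E -> F) (g : F -> G) x v :
  differentiable f x -> differentiable g (f x) ->
  'D_v (g \o f) x = 'd g (f x) ('D_v f x).
Proof.
move=> df dg.
by rewrite (deriveE _ (differentiable_comp df dg)) (deriveE _ df) diff_compE.
Qed.

Lemma diff_linE E F (L : {linear E -> F}) x v : continuous L -> 'd L x v = L v.
Proof. by move=> cL; exact: (congr1 (fun h : E -> F => h v) (diff_lin x cL)). Qed.

Lemma Ck_sub E F k (V V' : set E) (f : E -> F) :
  V' `<=` V -> Ck k V f -> Ck k V' f.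
Proof.
move=> V'V; elim: k f => [|k IH] f /=; first by move=> cf x /V'V; exact: cf.
by move=> [df cf]; split=> [x /V'V|v]; [exact: df|exact: IH].
Qed.

Lemma Ck_eq E F k (V : set E) (f g : E -> F) :
  open V -> (forall x, V x -> f x = g x) -> Ck k V f -> Ck k V g.
Proof.
move=> oV; elim: k f g => [|k IH] f g fg /=.
  move=> cf x Vx; have cfx := cf x Vx.
  have fgx : \forall y \near x, f y = g y.
    by near=> y; apply: fg; near: y; exact: open_nbhs_nbhs.
  apply: cvg_trans (near_eq_cvg _) _; last by rewrite -fg//; exact: cfx.
  by apply: filterS fgx => y ->.
have fgx x : V x -> \forall y \near x, f y = g y.
  by move=> Vx; near=> y; apply: fg; near: y; exact: open_nbhs_nbhs.
move=> [df cf]; split=> [x Vx|v].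
  by have [] := near_eq_diff (fgx x Vx) (df x Vx).
apply: IH (cf v) => x Vx; have [dg gf] := near_eq_diff (fgx x Vx) (df x Vx).
exact: etrans (deriveE v (df x Vx)) (etrans (esym (congr1 (fun h : E -> F => h v) gf)) (esym (deriveE v dg))).
Unshelve. all: by end_near. Qed.

Lemma Ck_local E F k (V : set E) (f : E -> F) :
  (forall x, V x -> exists2 V', V' x & Ck k V' f) -> Ck k V f.
Proof.
elim: k f => [|k IH] f /= cf; first by move=> x /cf[V' V'x]; exact.
split=> [x /cf[V' V'x []]|v]; first by move=> df _; exact: df.
by apply: IH => x /cf[V' V'x [_ cf']]; exists V'.
Qed.

Lemma Ck_le E F k (V : set E) (f : E -> F) : Ck k.+1 V f -> Ck k V f.
Proof.
elim: k f => [|k IH] f /=; first by move=> [df _] x /df; exact: differentiable_continuous.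
by move=> [df cf]; split=> // v; apply: IH; exact: cf.
Qed.

Lemma Ck_lin E F G k (V : set E) (f : E -> F) (L : {linear F -> G}) :
  open V -> continuous L -> Ck k V f -> Ck k V (L \o f).
Proof.
move=> oV cL; elim: k f => [|k IH] f /=.
  by move=> cf x Vx; apply: continuous_comp; [exact: cf|exact: cL].
have dL y : differentiable L y by exact: linear_differentiable.
move=> [df cf]; split=> [x Vx|v]; first by apply: differentiable_comp => //; exact: df.
apply: Ck_eq (IH _ (cf v)) => // x Vx.
by rewrite (derive_comp _ (df x Vx) (dL (f x))) diff_linE.
Qed.

Lemma Ck_cst E F k (V : set E) (a : F) : Ck k V (cst a : E -> F).
Proof.
elim: k a => [|k IH] a /=; first by move=> x _; exact: cst_continuous.
split=> [x _|v]; first exact: differentiable_cst.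
by rewrite (_ : (fun x => _) = cst 0)//; apply/funext => x; rewrite derive_cst.
Qed.

Lemma Ck_linear E F k (V : set E) (L : {linear E -> F}) :
  continuous L -> Ck k V L.
Proof.
move=> cL; have dL y : differentiable L y by exact: linear_differentiable.
case: k => [|k] /=; first by move=> x _; exact: cL.
split=> // v; rewrite (_ : (fun x => _) = cst (L v)); first exact: Ck_cst.
by apply/funext => x; rewrite deriveE// diff_linE.
Qed.

Lemma CkD E F k (V : set E) (f g : E -> F) :
  open V -> Ck k V f -> Ck k V g -> Ck k V (f + g).
Proof.
move=> oV; elim: k f g => [|k IH] f g /=.
  by move=> cf cg x Vx; apply: continuousD; [exact: cf|exact: cg].
move=> [df cf] [dg cg]; split=> [x Vx|v].
  by apply: differentiableD; [exact: df|exact: dg].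
apply: Ck_eq (IH _ _ (cf v) (cg v)) => // x Vx.
by rewrite deriveD//; apply: diff_derivable; [exact: df|exact: dg].
Qed.

Lemma Ck_sum E F k (V : set E) (I : Type) (r : seq I) (P : pred I) (f : I -> E -> F) :
  open V -> (forall i, P i -> Ck k V (f i)) ->
  Ck k V (fun x => \sum_(i <- r | P i) f i x).
Proof.
move=> oV cf.
rewrite (_ : (fun x => _) = \sum_(i <- r | P i) f i); last first.
  by apply/funext => x; rewrite fct_sumE.
elim/big_ind : _ => //; first exact: Ck_cst.
by move=> g h; exact: CkD.
Qed.

Lemma CkM E k (V : set E) (f g : E -> R) :
  open V -> Ck k V f -> Ck k V g -> Ck k V (f * g).
Proof.
move=> oV; elim: k f g => [|k IH] f g.
  by move=> cf cg x Vx; apply: continuousM; [exact: cf|exact: cg].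
move=> cf1 cg1; have cf0 := Ck_le cf1; have cg0 := Ck_le cg1.
move: cf1 cg1 => [df cf] [dg cg]; split=> [x Vx|v].
  by apply: differentiableM; [exact: df|exact: dg].
apply: Ck_eq (CkD oV (IH _ _ cf0 (cg v)) (IH _ _ cg0 (cf v))) => // x Vx.
by rewrite deriveM//; apply: diff_derivable; [exact: df|exact: dg].
Qed.

Lemma Ck_prod E k (V : set E) (I : Type) (r : seq I) (P : pred I) (f : I -> E -> R) :
  open V -> (forall i, P i -> Ck k V (f i)) ->
  Ck k V (fun x => \prod_(i <- r | P i) f i x).
Proof.
move=> oV cf.
rewrite (_ : (fun x => _) = \prod_(i <- r | P i) f i); last first.
  by apply/funext => x; rewrite fct_prodE.
elim/big_ind : _ => //; first exact: Ck_cst.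
by move=> g h; exact: CkM.
Qed.

Lemma CkV E k (V : set E) (f : E -> R) :
  open V -> (forall x, V x -> f x != 0) -> Ck k V f ->
  Ck k V (fun x => (f x)^-1).
Proof.
move=> oV f0; elim: k => [|k IH].
  by move=> cf x Vx; apply: continuousV; [exact: f0|exact: cf].
move=> cf1; have cf0 := Ck_le cf1; move: cf1 => [df cf]; split=> [x Vx|v].
  by apply: differentiableV; [exact: df|exact: f0].
have := CkM oV (CkM oV (@Ck_cst E R k V (-1)) (cf v)) (CkM oV (IH cf0) (IH cf0)).
apply: Ck_eq => // x Vx.
rewrite deriveV//; [|exact: f0|by apply: diff_derivable; exact: df].
rewrite /= /GRing.scale /= -[LHS]/(-1 * 'D_v f x * ((f x)^-1 * (f x)^-1)).
by rewrite -expr2 exprVn mulNr mul1r mulNr mulrC mulNr.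
Qed.

Lemma Ck_mxP E k m n (V : set E) (f : E -> 'M[R]_(m, n)) : open V ->
  Ck k V f <-> forall i j, Ck k V (fun x => f x i j).
Proof.
move=> oV; split=> [cf i j|cf].
  have lf : linear (fun M : 'M[R]_(m, n) => M i j) by move=> a M N; rewrite !mxE.
  pose L : {linear 'M[R]_(m, n) -> R} :=
    HB.pack (fun M : 'M[R]_(m, n) => M i j) (GRing.isLinear.Build _ _ _ _ _ lf).
  by apply: (Ck_lin (L := L)) cf => // M; exact: coord_continuous.
have -> : f = fun x => \sum_i \sum_j f x i j *: delta_mx i j.
  by apply/funext => x; exact: matrix_sum_delta.
apply: Ck_sum => // i _; apply: Ck_sum => // j _.
have lf : linear (fun a : R => a *: (delta_mx i j : 'M[R]_(m, n))).
  by move=> a b c; rewrite scalerDl scalerA.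
pose L : {linear R -> 'M[R]_(m, n)} :=
  HB.pack (fun a : R => a *: (delta_mx i j : 'M[R]_(m, n))) (GRing.isLinear.Build _ _ _ _ _ lf).
by apply: (Ck_lin (L := L)) (cf i j) => // x; exact: scalel_continuous.
Qed.

(** Expanding ['D_v g x] in the standard basis turns the chain rule into a finite sum of products of
    scalar functions, so that [CkM] and the induction hypothesis for the partial derivatives of [f]
    apply. Matrix values are reduced to this case entrywise. *)
Lemma Ck_comp_scalar E k m (V : set E) (V' : set 'rV[R]_m) (g : E -> 'rV[R]_m)
    (f : 'rV[R]_m -> R) :
  open V -> open V' -> (forall x, V x -> V' (g x)) ->
  Ck k V g -> Ck k V' f -> Ck k V (f \o g).
Proof.
move=> oV oV' gV; elim: k f => [|k IH] f.
  by move=> cg cf x Vx; apply: continuous_comp; [exact: cg|exact/cf/gV].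
move=> cg1; have cg0 := Ck_le cg1; move: cg1 => [dg cg] [df cf].
split=> [x Vx|v]; first by apply: differentiable_comp; [exact: dg|exact/df/gV].
have : Ck k V (fun x => \sum_j ('D_v g x) 0 j * 'D_(delta_mx 0 j) f (g x)).
  apply: Ck_sum => // j _; apply: CkM => //.
    by have /Ck_mxP := cg v; exact.
  exact: (IH ('D_(delta_mx 0 j) f) cg0 (cf _)).
apply: Ck_eq => // x Vx.
have dfx := df _ (gV x Vx); have dgx := dg x Vx.
rewrite (derive_comp _ dgx dfx) [in RHS](row_sum_delta ('D_v g x)) linear_sum.
by apply: eq_bigr => j _; rewrite linearZ/= (deriveE _ dfx).
Qed.

Lemma Ck_comp E k m n p (V : set E) (V' : set 'rV[R]_m) (g : E -> 'rV[R]_m)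
    (f : 'rV[R]_m -> 'M[R]_(n, p)) :
  open V -> open V' -> (forall x, V x -> V' (g x)) ->
  Ck k V g -> Ck k V' f -> Ck k V (f \o g).
Proof.
move=> oV oV' gV cg /Ck_mxP cf; apply/Ck_mxP => // i j.
by apply: (@Ck_comp_scalar _ _ _ V V' g (fun x => f x i j)) => //; exact: cf.
Qed.

Lemma Ck_mulmx E k m n p (V : set E) (f : E -> 'M[R]_(m, n)) (g : E -> 'M[R]_(n, p)) :
  open V -> Ck k V f -> Ck k V g -> Ck k V (fun x => f x *m g x).
Proof.
move=> oV /Ck_mxP cf /Ck_mxP cg; apply/Ck_mxP => // i j.
rewrite (_ : (fun x => _) = fun x => \sum_l f x i l * g x l j); last first.
  by apply/funext => x; rewrite mxE.
by apply: Ck_sum => // l _; apply: CkM => //; [exact: cf|exact: cg].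
Qed.

Lemma Ck_det E k n (V : set E) (f : E -> 'M[R]_n) :
  open V -> Ck k V f -> Ck k V (fun x => \det (f x)).
Proof.
move=> oV /Ck_mxP cf; apply: Ck_sum => // s _; apply: CkM => //; first exact: Ck_cst.
by apply: Ck_prod => // i _; exact: cf.
Qed.

(** Cramer's rule: the entries of the inverse are cofactors divided by the determinant. *)
Lemma Ck_invmx E k n (V : set E) (f : E -> 'M[R]_n) :
  open V -> (forall x, V x -> f x \in unitmx) -> Ck k V f ->
  Ck k V (fun x => invmx (f x)).
Proof.
move=> oV fu cf; have cf' := (Ck_mxP _ _ oV).1 cf.
apply/Ck_mxP => // i j.
have : Ck k V (fun x => (\det (f x))^-1 * cofactor (f x) j i).
  apply: CkM => //.
    apply: CkV => //; last exact: Ck_det.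
    by move=> x Vx; have := fu x Vx; rewrite unitmxE unitfE.
  apply: CkM => //; first exact: Ck_cst.
  apply: Ck_det => //; apply/Ck_mxP => // a b.
  by rewrite (_ : (fun x => _) = fun x => f x (lift j a) (lift i b));
    [exact: cf'|apply/funext => x; rewrite !mxE].
by apply: Ck_eq => // x Vx; rewrite /invmx (fu x Vx) !mxE.
Qed.

End CkTheory.

(** * The entrywise maximum norm on matrices *)

Section MatrixNorm.
Context {R : realType}.

Lemma coord_le_norm m n (A : 'M[R]_(m, n)) i j : `|A i j| <= `|A|.
Proof.
rewrite [leRHS]/Num.norm /= mx_normrE.
by apply: (le_bigmax _ (fun ij : 'I_m * 'I_n => `|A ij.1 ij.2|) (i, j)).
Qed.

Lemma norm_le_coord m n (A : 'M[R]_(m, n)) c :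
  0 <= c -> (forall i j, `|A i j| <= c) -> `|A| <= c.
Proof.
move=> c0 Ac; rewrite [leLHS]/Num.norm /= mx_normrE.
by apply/bigmax_leP; split=> // -[i j] _; exact: Ac.
Qed.

Lemma coordB m n (A B : 'M[R]_(m, n)) i j : (A - B) i j = A i j - B i j.
Proof. by rewrite !mxE. Qed.

(** The maximum norm is not submultiplicative; the factor is the inner dimension. Many dimension
    factors in later constants originate here. *)
Lemma norm_mulmx m n p (A : 'M[R]_(m, n)) (B : 'M[R]_(n, p)) :
  `|A *m B| <= n%:R * `|A| * `|B|.
Proof.
apply: norm_le_coord => [|i j]; first by rewrite !mulr_ge0.
rewrite mxE (le_trans (ler_norm_sum _ _ _))//.
rewrite (@le_trans _ _ (\sum_(k < n) `|A| * `|B|))//.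
  by apply: ler_sum => k _; rewrite normrM ler_pM// coord_le_norm.
by rewrite sumr_const card_ord -[leLHS]mulr_natl mulrA.
Qed.

End MatrixNorm.

(** * Mean value estimates, minima and strict differentiability *)

Section DifferentialCalculus.
Context {R : realType}.
Implicit Types E F : normedModType R.

Lemma differentiable_approx E F (f : E -> F) (L : {linear E -> F}) a :
  continuous L ->
  (forall e : R, 0 < e -> \forall x \near a, `|f x - f a - L (x - a)| <= e * `|x - a|) ->
  differentiable f a /\ 'd f a = L :> (E -> F).
Proof.
move=> cL fL.
have fo : f \o shift a = cst (f a) + L +o_ 0 id.
  apply/eqaddoP => e e0; near=> h.
  rewrite /= !fctE /= opprD addrA.
  suff : `|f (h + a) - f a - L (h + a - a)| <= e * `|h + a - a| by rewrite addrK.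
  near: h; have := fL e e0; rewrite (near_shift 0 a) /=.
  by apply: filterS => x; rewrite subr0.
have dE : 'd f a = L :> (E -> F) by exact: diff_unique.
by split=> //; apply/diff_locallyP; rewrite dE.
Unshelve. all: by end_near. Qed.

Lemma is_derive_line E F (f : E -> F) (y v : E) (t : R) :
  differentiable f (y + t *: v) ->
  is_derive t 1 (fun s : R => f (y + s *: v)) ('d f (y + t *: v) v).
Proof.
move=> df.
have dl : differentiable (fun s : R => y + s *: v) t.
  by apply: differentiableD => //; exact: differentiableZl.
have dfl := @differentiable_comp _ _ _ _ (fun s : R => y + s *: v) f t dl df.
split; first exact: diff_derivable.
rewrite (@derive_comp _ _ _ _ (fun s : R => y + s *: v) f t 1 dl df); congr ('d f _ _).
rewrite (_ : (fun s : R => y + s *: v) = cst y + (fun s : R => s *: v))//.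
rewrite deriveD; [|exact: derivable_cst|exact/diff_derivable/differentiableZl].
rewrite derive_cst add0r deriveE; last exact: differentiableZl.
by rewrite diffZl//= diff_val scale1r.
Qed.

Lemma segment_MVT E (f : E -> R) (x y : E) :
  (forall t : R, 0 <= t <= 1 -> differentiable f (y + t *: (x - y))) ->
  exists2 t : R, 0 < t < 1 & f x - f y = 'd f (y + t *: (x - y)) (x - y).
Proof.
move=> df.
have d (t : R) : 0 <= t <= 1 -> is_derive t 1 (fun s : R => f (y + s *: (x - y)))
    ('d f (y + t *: (x - y)) (x - y)).
  by move=> /df; exact: is_derive_line.
have cf : {within `[0, 1], continuous (fun s : R => f (y + s *: (x - y)))}.
  by apply: derivable_within_continuous => t t01; have [] := d t t01.
have [t] := MVT ltr01 (fun t t01 => d t (subset_itv_oo_cc t01)) cf.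
rewrite in_itv /= => t01; rewrite scale1r scale0r addr0 subr0 mulr1 [y + (x - y)]addrC subrK => ft.
by exists t.
Qed.

Lemma diff_min E (V : set E) (f : E -> R) a v :
  open V -> V a -> (forall x, V x -> differentiable f x) ->
  (forall x, V x -> f a <= f x) -> 'd f a v = 0.
Proof.
move=> oV Va df fmin.
have : \forall t \near (0 : R), V (a + t *: v).
  have cl : {for 0, continuous (fun t : R => a + t *: v)}.
    apply: (@differentiable_continuous _ R E).
    by apply: differentiableD => //; exact: differentiableZl.
  by apply: cl; rewrite scale0r addr0; exact: open_nbhs_nbhs.
move=> /nbhs_ballP[e /= e0 eV].
have tV (t : R) : t \in `]- e, e[%R -> V (a + t *: v).
  by rewrite in_itv /= => te; apply: eV; rewrite /ball /= sub0r normrN ltr_norml.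
have : is_derive (0 : R) 1 (fun t : R => f (a + t *: v)) 0.
  apply: (@derive1_at_min R _ (- e) e).
  - by rewrite -subr_ge0 opprK addr_ge0// ltW.
  - by move=> t te; have [] := is_derive_line (df _ (tV t te)).
  - by rewrite in_itv /= oppr_lt0 e0.
  - by move=> t te; rewrite scale0r addr0; exact/fmin/tV.
move=> [_ <-].
have := @is_derive_line _ _ f a v 0; rewrite scale0r addr0 => /(_ (df a Va)) [_ <-].
by [].
Qed.

Lemma jacobianE m n (f : 'rV[R]_m -> 'rV[R]_n) a i j : differentiable f a ->
  jacobian f a i j = ('D_(delta_mx 0 i) f a) 0 j.
Proof. by move=> df; rewrite deriveEjacobian// -rowE [RHS]mxE. Qed.

Lemma diff_jacobian m n (f : 'rV[R]_m -> 'rV[R]_n) a v : differentiable f a ->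
  'd f a v = v *m jacobian f a.
Proof. by move=> df; rewrite -deriveE// deriveEjacobian. Qed.

Lemma jacobian_diff m n (f : 'rV[R]_m -> 'rV[R]_n) a A :
  'd f a = mulmxr A :> ('rV[R]_m -> 'rV[R]_n) -> jacobian f a = A.
Proof.
move=> dfA; apply/row_matrixP => i; rewrite !rowE /jacobian mul_rV_lin1.
exact: (congr1 (fun h : 'rV[R]_m -> 'rV[R]_n => h (delta_mx 0 i)) dfA).
Qed.

Lemma Ck_jacobian k m n (V : set 'rV[R]_m) (f : 'rV[R]_m -> 'rV[R]_n) :
  open V -> Ck k.+1 V f -> Ck k V (jacobian f).
Proof.
move=> oV [df cf]; apply/Ck_mxP => // i j.
have /Ck_mxP := cf (delta_mx 0 i) => /(_ oV 0 j); apply: Ck_eq => // x Vx.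
by rewrite jacobianE//; exact: df.
Qed.

(** Continuity of the Jacobian makes the linear approximation at [a] uniform in both points. The
    mean value theorem is scalar, so it is applied to each coordinate along the segment from [y] to
    [x]. *)
Lemma strict_differentiable m n (V : set 'rV[R]_m) (f : 'rV[R]_m -> 'rV[R]_n) a e :
  open V -> V a -> Ck 1 V f -> 0 < e -> \forall r \near 0^'+,
  forall x y, ball a r x -> ball a r y ->
    `|f x - f y - (x - y) *m jacobian f a| <= e * `|x - y|.
Proof.
move=> oV Va cf e0.
have cJ := Ck_jacobian oV cf.
(* The denominator absorbs the factor [m] of [norm_mulmx]; the summand 1 covers [m = 0]. *)
have e'0 : 0 < e / (m%:R + 1) by rewrite divr_gt0// ltr_wpDl.
have : \forall x \near a, V x /\ `|jacobian f a - jacobian f x| < e / (m%:R + 1).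
  apply: filterI; first exact: open_nbhs_nbhs.
  by have /cvgrPdist_lt := cJ a Va; apply.
move=> /nbhs_ballP[r0 /= r00 r0P]; near=> r => x y ax ay.
apply: norm_le_coord => [|i j]; first by rewrite mulr_ge0// ltW.
rewrite [i]ord1.
have seg (t : R) : 0 <= t <= 1 -> ball a r0 (y + t *: (x - y)).
  move=> /andP[t0 t1]; apply: (@le_ball _ _ _ r); first by near: r; exact: nbhs_right_le.
  have -> : y + t *: (x - y) = (1 - t) *: y + t *: x.
    by rewrite scalerBr scalerBl scale1r addrA addrAC.
  move: ax ay; rewrite -!ball_normE /= => ax ay.
  have -> : a - ((1 - t) *: y + t *: x) = (1 - t) *: (a - y) + t *: (a - x).
    by rewrite !scalerBr !scalerBl !scale1r; apply/matrixP => k l; rewrite !mxE; ring.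
  rewrite (le_lt_trans (ler_normD _ _))// !normrZ !ger0_norm ?subr_ge0//.
  have [->|t0'] := eqVneq t 0; first by rewrite subr0 mul1r mul0r addr0.
  have tp : 0 < t by rewrite lt_neqAle eq_sym t0' t0.
  have : t * `|a - x| < t * r by rewrite ltr_pM2l.
  have : (1 - t) * `|a - y| <= (1 - t) * r by rewrite ler_wpM2l ?subr_ge0// ltW.
  by lra.
have dfs (t : R) : 0 <= t <= 1 -> differentiable f (y + t *: (x - y)).
  by move=> /seg/r0P[Vt _]; have [df _] := cf; exact: df.
have dfj (t : R) : 0 <= t <= 1 -> differentiable (fun z => f z 0 j) (y + t *: (x - y)).
  move=> /dfs df; apply: (@differentiable_comp _ _ _ _ f (fun z : 'rV_n => z 0 j) _ df).
  exact: differentiable_coord.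
have [t /andP[t0 t1] ft] := segment_MVT dfj.
have t01 : 0 <= t <= 1 by rewrite !ltW.
have dE : 'd (fun z => f z 0 j) (y + t *: (x - y)) (x - y) =
    ((x - y) *m jacobian f (y + t *: (x - y))) 0 j.
  rewrite -(diff_jacobian _ (dfs t t01)).
  have := @derive_comp _ _ _ _ f (fun z : 'rV_n => z 0 j) _ (x - y) (dfs t t01)
    (differentiable_coord _ _ _).
  rewrite deriveE; last exact: dfj.
  rewrite (deriveE _ (dfs t t01)) => ->.
  have lf : linear (fun z : 'rV[R]_n => z 0 j) by move=> b M N; rewrite !mxE.
  pose L : {linear 'rV[R]_n -> R} :=
    HB.pack (fun z : 'rV[R]_n => z 0 j) (GRing.isLinear.Build _ _ _ _ _ lf).
  by apply: (diff_linE (L := L)) => z; exact: coord_continuous.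
rewrite !coordB ft dE -coordB -mulmxBr.
apply: (le_trans (coord_le_norm _ _ _)); apply: (le_trans (norm_mulmx _ _)).
have [_ /ltW Je] := r0P _ (seg t t01).
rewrite distrC in Je.
rewrite mulrAC (@le_trans _ _ (m%:R * (e / (m%:R + 1)) * `|x - y|))//.
  by rewrite ler_wpM2r// ler_wpM2l.
rewrite ler_wpM2r// mulrCA ger_pMr// ler_pdivrMr ?ltr_wpDl// mul1r lerDl//.
Unshelve. all: by end_near. Qed.

End DifferentialCalculus.

(** * The smooth inverse function theorem *)

Section InverseFunction.
Context {R : realType}.

Lemma near_right_ex (P : set R) : (\forall r \near 0^'+, P r) ->
  exists2 r : R, 0 < r & P r.
Proof.
move=> nP; have /filter_ex[r [r0 Pr]] : \forall r \near (0 : R)^'+, 0 < r /\ P r.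
  by apply: filterI => //; exact: nbhs_right_gt.
by exists r.
Qed.

Lemma closed_sublevel (T : topologicalType) (f : T -> R) c :
  continuous f -> closed [set x | f x <= c].
Proof.
move=> cf; rewrite (_ : mkset _ = f @^-1` [set s | s <= c])//.
by apply: closed_comp; [move=> x _; exact: cf|exact: closed_le].
Qed.

Lemma open_sublevel (T : topologicalType) (f : T -> R) c :
  continuous f -> open [set x | f x < c].
Proof.
move=> cf; rewrite (_ : mkset _ = f @^-1` [set s | s < c])//.
by apply: open_comp; [move=> x _; exact: cf|exact: open_lt].
Qed.

Lemma distr_continuous (E : normedModType R) (x : E) :
  continuous (fun y : E => `|x - y|).
Proof.
move=> y.
have : {for y, continuous ((fun z : E => `|z|) \o (fun y0 : E => x - y0))}.
  apply: continuous_comp; last exact: norm_continuous.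
  by apply: continuousB; first exact: cst_continuous.
exact.
Qed.

Lemma closed_ball_compact n (x : 'rV[R]_n) r : compact [set y | `|x - y| <= r].
Proof.
apply: bounded_closed_compact.
  exists (`|x| + r); split; first by rewrite num_real.
  move=> M xM y /= yx; rewrite (le_trans _ (ltW xM))//.
  by rewrite -[y](subKr x) (le_trans (ler_normB _ _))// lerD2l.
exact/closed_sublevel/distr_continuous.
Qed.

Lemma open_setI_preimage (T1 T2 : topologicalType) (A : set T1) (B : set T2)
    (f : T1 -> T2) :
  open A -> open B -> (forall x, A x -> {for x, continuous f}) ->
  open (A `&` f @^-1` B).
Proof.
move=> oA oB cf; rewrite openE => x [Ax Bfx]; apply: filterI.
  exact: open_nbhs_nbhs.
by apply: cf => //; exact: open_nbhs_nbhs.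
Qed.

(* At a minimum [x] of [|h x - y|] the Newton step [x + (y - h x)] would at least
   halve this quantity. *)
Lemma near_identity_onto n (h : 'rV[R]_n -> 'rV[R]_n) a r :
  (forall x, ball a r x -> {for x, continuous h}) ->
  (forall x y, ball a r x -> ball a r y ->
    `|h x - h y - (x - y)| <= 2^-1 * `|x - y|) ->
  forall y, `|h a - y| < r / 16 -> exists2 x, ball a (r / 2) x & h x = y.
Proof.
move=> ch hh y yr.
have r0 : 0 < r by have := le_lt_trans (normr_ge0 _) yr; rewrite pmulr_lgt0// invr_gt0.
pose A := [set x | `|a - x| <= r / 2].
have Ar x : A x -> ball a r x.
  by rewrite -ball_normE /A /=; lra.
have aA : A a by rewrite /A /= subrr normr0; lra.
have cA : {within A, continuous (fun x => `|h x - y|)}.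
  apply: continuous_in_subspaceT => x /set_mem /Ar xr.
  under eq_fun do rewrite distrC.
  exact: (@continuous_comp _ _ _ h (fun z => `|y - z|) x (ch x xr) (@distr_continuous _ _ _)).
have [x /set_mem Ax xmin] := compact_EVT_min (ex_intro _ a aA)
  (@closed_ball_compact _ a (r / 2)) cA.
have := xmin a (mem_set aA); rewrite /= => xa.
have xr := Ar _ Ax; have ar := Ar _ aA.
(* By [hh], [h] shrinks distances by at most a factor 2, and both [h a] and [h x] are within
   [r / 16] of [y]; hence [x] lies within [r / 4] of [a]. The Newton step is shorter than [r / 16]
   and therefore stays inside [A]. *)
have Lxa : `|x - a| <= 2 * `|h x - h a|.
  have := hh x a xr ar.
  have := ler_normB (h x - h a) (h x - h a - (x - a)); rewrite subKr.
  lra.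
have xar : `|x - a| < r / 4.
  have := ler_distD y (h x) (h a); rewrite (distrC y (h a)).
  lra.
exists x; first by rewrite -ball_normE /= distrC; lra.
apply/eqP; rewrite -subr_eq0 -normr_eq0 eq_le normr_ge0 andbT leNgt.
apply/negP => p0.
pose x' : 'rV[R]_n := x + (y - h x).
have x'x : x' - x = y - h x by rewrite /x' [x + _]addrC addrK.
have Ax' : A x'.
  have := ler_distD x x' a; rewrite x'x (distrC y) /A /= (distrC a).
  lra.
have := hh x' x (Ar _ Ax') xr; have := xmin x' (mem_set Ax').
rewrite x'x opprB addrA subrK (distrC y).
lra.
Qed.

Lemma inverse_function n (V : set 'rV[R]_n) (f : 'rV[R]_n -> 'rV[R]_n) a :
  open V -> V a -> smooth_open V f -> jacobian f a \in unitmx ->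
  exists N M g, [/\ open N, N a, N `<=` V, open M &
    [/\ forall x, N x -> M (f x) /\ g (f x) = x,
        forall y, M y -> N (g y) /\ f (g y) = y & smooth_open M g]].
Proof.
move=> oV Va sf Ju.
pose A := invmx (jacobian f a).
have [c c0 c1] : exists2 c : R, 0 < c & n%:R * `|A| <= c.
  by exists (n%:R * `|A| + 1); rewrite ?lerDl// ltr_wpDl// mulr_ge0.
(* Right multiplication by [A] costs at most the factor [c], so with this error [f *m A] differs
   from the identity by a map with Lipschitz constant 1/2. *)
have e0 : 0 < (2 * c)^-1 by rewrite invr_gt0 mulr_gt0.
have dfV x : V x -> differentiable f x by have [df _] := sf 1%N; exact: df.
have Vu : \forall x \near a, V x /\ jacobian f x \in unitmx.
  apply: filterI; first exact: open_nbhs_nbhs.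
  have cJ : {for a, continuous (jacobian f)}.
    by have := Ck_jacobian oV (sf 1%N); apply.
  have Jf : row_free (jacobian f a) by rewrite row_free_unit.
  near=> x; rewrite -row_free_unit; near: x.
  exact: cJ (row_free_near Jf).
have /nbhs_ballP[r0 /= r00 r0V] := Vu.
have [r rgt0 [rr0 strict]] : exists2 r, 0 < r & r < r0 /\
    forall x y, ball a r x -> ball a r y ->
    `|f x - f y - (x - y) *m jacobian f a| <= (2 * c)^-1 * `|x - y|.
  apply: near_right_ex; apply: filterI; first exact: nbhs_right_lt.
  exact: strict_differentiable (sf 1%N) e0.
have rV x : ball a r x -> V x /\ jacobian f x \in unitmx.
  by move=> ax; apply: r0V; apply: le_ball ax; exact: ltW.
pose h x := f x *m A.
have hh x y : ball a r x -> ball a r y ->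
    `|h x - h y - (x - y)| <= 2^-1 * `|x - y|.
  move=> xr yr.
  have -> : h x - h y - (x - y) = (f x - f y - (x - y) *m jacobian f a) *m A.
    by rewrite [RHS]mulmxBl mulmxK// mulmxBl.
  rewrite (le_trans (norm_mulmx _ _))// mulrAC.
  rewrite (@le_trans _ _ (c * ((2 * c)^-1 * `|x - y|)))//.
    by rewrite ler_pM ?mulr_ge0// strict.
  by rewrite mulrA invfM mulrCA mulfV ?gt_eqF// mulr1.
have ch x : ball a r x -> {for x, continuous h}.
  move=> /rV[Vx _]; apply: (@continuous_comp _ _ _ f (fun z => z *m A)).
    exact: (sf 0%N).
  exact: mulmxr_continuous.
have hinj x y : ball a r x -> ball a r y -> `|x - y| <= 2 * `|h x - h y|.
  move=> xr yr; have := hh x y xr yr.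
  have := ler_normB (h x - h y) (h x - h y - (x - y)); rewrite subKr.
  lra.
have Au : A \in unitmx by rewrite unitmx_inv.
pose M := [set y : 'rV[R]_n | `|h a - y *m A| < r / 16].
have rball x : ball a (r / 2) x -> ball a r x by apply: le_ball; lra.
pose N := ball a (r / 2) `&` f @^-1` M.
have oM : open M.
  apply: open_sublevel => y.
  apply: (@continuous_comp _ _ _ (fun y : 'rV[R]_n => y *m A) (fun z : 'rV[R]_n => `|h a - z|)).
    exact: mulmxr_continuous.
  exact: distr_continuous.
have oN : open N.
  apply: open_setI_preimage => //; first exact: ball_open.
  by move=> x /rball/rV[Vx _]; exact: (sf 0%N).
have gex y : exists x, M y -> ball a (r / 2) x /\ f x = y.
  have [My|nMy] := pselect (M y); last by exists 0.
  have [x xr hxy] := near_identity_onto ch hh My.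
  by exists x => _; split=> //; rewrite -[f x](mulmxK Au) -/(h x) hxy mulmxK.
have [g gP] := choice gex.
have NgP y : M y -> N (g y) /\ f (g y) = y.
  by move=> My; have [gr fg] := gP y My; split=> //; split=> //=; rewrite fg.
have gN x : N x -> M (f x) /\ g (f x) = x.
  move=> [xr Mfx]; split=> //; have [gr fg] := gP _ Mfx.
  apply/eqP; rewrite -subr_eq0 -normr_eq0 eq_le normr_ge0 andbT.
  have := hinj _ _ (rball _ gr) (rball _ xr).
  by rewrite /h fg subrr normr0 mulr0.
have Na : N a by split; [exact: ballxx (divr_gt0 _ _)|rewrite /M /= -/(h a) subrr normr0; lra].
exists N, M, g; split=> //; first by move=> x [/rball/rV[]].
split=> //.
have lipg y y' : M y -> M y' -> `|g y' - g y| <= 2 * c * `|y' - y|.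
  move=> My My'; have [gr fg] := gP y My; have [gr' fg'] := gP y' My'.
  rewrite (le_trans (hinj _ _ (rball _ gr') (rball _ gr)))// -mulrA ler_wpM2l//.
  by rewrite /h fg fg' -mulmxBl (le_trans (norm_mulmx _ _))// mulrAC ler_wpM2r.
have cg y : M y -> {for y, continuous g}.
  move=> My; apply/(@cvgrPdist_lt _ _ _ (nbhs y)) => e e00.
  have nM : \forall y' \near y, M y' by exact: open_nbhs_nbhs.
  have ec : 0 < e / (2 * c) by rewrite divr_gt0// mulr_gt0.
  near=> y'.
  have My' : M y' by near: y'.
  have yy' : `|y - y'| < e / (2 * c).
    by near: y'; apply: (@cvgr_dist_lt _ _ _ (nbhs y)) => //; exact: cvg_id.
  rewrite distrC; apply: (le_lt_trans (lipg y y' My My')).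
  by rewrite mulrC -ltr_pdivlMr ?mulr_gt0// distrC.
(* Strict differentiability of [f] at [g y], multiplied by the inverse Jacobian and combined with
   the Lipschitz bound on [g], is differentiability of [g]. *)
have dg y : M y -> differentiable g y /\
    'd g y = mulmxr (invmx (jacobian f (g y))) :> ('rV[R]_n -> 'rV[R]_n).
  move=> My; have [[gr _] fg] := NgP y My.
  have [Vgy Jgu] := rV _ (rball _ gr).
  apply: differentiable_approx; first exact: mulmxr_continuous.
  move=> e e00; set B := invmx _.
  have [b b0 Bb] : exists2 b : R, 0 < b & n%:R * `|B| <= b.
    by exists (n%:R * `|B| + 1); rewrite ?lerDl// ltr_wpDl// mulr_ge0.
  have e'0 : 0 < e / (b * (2 * c)) by apply: divr_gt0 => //; apply: mulr_gt0 => //; exact: mulr_gt0.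
  have := strict_differentiable oV Vgy (sf 1%N) e'0.
  move=> /near_right_ex[s s0 sdP].
  near=> y'.
  have My' : M y' by near: y'; exact: open_nbhs_nbhs.
  have gs : ball (g y) s (g y').
    by near: y'; have /cvg_ball := cg y My; apply.
  have [_ fg'] := NgP y' My'.
  have := sdP _ _ gs (ballxx _ s0); rewrite fg fg' => sdy.
  have -> : g y' - g y - (y' - y) *m B =
      - ((y' - y - (g y' - g y) *m jacobian f (g y)) *m B).
    by rewrite [in RHS]mulmxBl mulmxK// opprB.
  rewrite normrN (le_trans (norm_mulmx _ _))// mulrAC.
  rewrite (@le_trans _ _ (b * (e / (b * (2 * c)) * (2 * c * `|y' - y|))))//.
    apply: ler_pM => //.
    rewrite (le_trans sdy)// ler_wpM2l//; first exact: ltW.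
    exact: lipg.
  have -> : b * (e / (b * (2 * c)) * (2 * c * `|y' - y|)) = e * `|y' - y|.
    by field; rewrite !gt_eqF.
  by [].
(* Bootstrapping: the derivative of [g] is the inverse Jacobian of [f] at [g y], so it is [C^k] as
   soon as [g] is. *)
elim=> [|k IH]; first exact: cg.
split=> [y My|v]; first by have [] := dg y My.
have : Ck k M (fun y => v *m (fun x => invmx (jacobian f x)) (g y)).
  apply: Ck_mulmx => //; first exact: Ck_cst.
  apply: (@Ck_comp _ _ _ _ _ _ M N g (fun x => invmx (jacobian f x))) => //.
    by move=> y /NgP[].
  apply: (Ck_invmx oN); first by move=> x [/rball/rV[_ Jx] _].
  apply: Ck_sub (Ck_jacobian oV (sf k.+1)).
  by move=> x [/rball/rV[Vx _] _].
apply: Ck_eq => // y My; have [dgy dgE] := dg y My.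
by rewrite deriveE//; exact: esym (congr1 (fun h : 'rV[R]_n -> 'rV[R]_n => h v) dgE).
Unshelve. all: by end_near. Qed.

End InverseFunction.

(** * The inner product and its comparison with the maximum norm *)

Section EuclideanNorm.
Context {R : realType} {n : nat}.
Implicit Types u v w : 'rV[R]_n.

Lemma dotE u v : dot u v = (u *m v^T) 0 0.
Proof. by rewrite mxE; apply: eq_bigr => i _; rewrite mxE. Qed.

Lemma dotC u v : dot u v = dot v u.
Proof. by apply: eq_bigr => i _; rewrite mulrC. Qed.

Lemma dotDl u v w : dot (u + v) w = dot u w + dot v w.
Proof. by rewrite !dotE mulmxDl mxE. Qed.

Lemma dotBl u v w : dot (u - v) w = dot u w - dot v w.
Proof. by rewrite !dotE mulmxBl mxE [in X in _ + X]mxE. Qed.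

Lemma dotZl a u v : dot (a *: u) v = a * dot u v.
Proof. by rewrite !dotE -scalemxAl mxE. Qed.

Lemma dotZr a u v : dot u (a *: v) = a * dot u v.
Proof. by rewrite !(dotC u) dotZl. Qed.

Lemma dot_ge0 v : 0 <= dot v v.
Proof. by apply: sumr_ge0 => i _; rewrite -expr2 sqr_ge0. Qed.

Lemma norm_sqr_le_dot v : `|v| ^+ 2 <= dot v v.
Proof.
rewrite -[dot v v]sqr_sqrtr ?dot_ge0// lerXn2r ?nnegrE ?sqrtr_ge0//.
apply: norm_le_coord => [|i j]; first exact: sqrtr_ge0.
rewrite ord1 -sqrtr_sqr ler_wsqrtr// /dot (bigD1 j)//= expr2 lerDl.
by apply: sumr_ge0 => k _; rewrite -expr2 sqr_ge0.
Qed.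

Lemma dot_eq0 v : dot v v = 0 -> v = 0.
Proof.
move=> v0; apply/eqP; rewrite -normr_eq0 -sqrf_eq0 eq_le sqr_ge0 andbT.
by rewrite -v0 norm_sqr_le_dot.
Qed.

Lemma dot_le u v : `|dot u v| <= n%:R * `|u| * `|v|.
Proof.
rewrite dotE (le_trans (coord_le_norm _ _ _))// (le_trans (norm_mulmx _ _))//.
rewrite ler_wpM2l ?mulr_ge0//; apply: norm_le_coord => // i j.
by rewrite mxE coord_le_norm.
Qed.

Lemma enorm_ge0 v : 0 <= enorm v. Proof. exact: sqrtr_ge0. Qed.

Lemma enorm_sqr v : enorm v ^+ 2 = dot v v.
Proof. by rewrite sqr_sqrtr// dot_ge0. Qed.

Lemma norm_le_enorm v : `|v| <= enorm v.
Proof.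
by rewrite -[leLHS]ger0_norm// -sqrtr_sqr ler_wsqrtr// norm_sqr_le_dot.
Qed.

Lemma enorm_le_norm v : enorm v <= n%:R * `|v|.
Proof.
rewrite -[leRHS]ger0_norm ?mulr_ge0// -sqrtr_sqr ler_wsqrtr//.
rewrite (le_trans (ler_norm _))// (le_trans (dot_le _ _))// exprMn -mulrA -expr2.
by rewrite ler_wpM2r ?sqr_ge0// expr2 -natrM ler_nat; case: (n) => // k; rewrite leq_pmulr.
Qed.

Lemma enormZ a v : enorm (a *: v) = `|a| * enorm v.
Proof. by rewrite /enorm dotZl dotZr mulrA -expr2 sqrtrM ?sqr_ge0// sqrtr_sqr. Qed.

Lemma dot_mulmx m (a : 'rV[R]_m) (A : 'M[R]_(m, n)) v :
  dot (a *m A) v = (a *m (v *m A^T)^T) 0 0.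
Proof. by rewrite dotE trmx_mul trmxK mulmxA. Qed.

Lemma dot_row m (A : 'M[R]_(m, n)) v i : dot (row i A) v = (v *m A^T) 0 i.
Proof. by rewrite dotC mxE; apply: eq_bigr => k _; rewrite !mxE. Qed.

Lemma normal_submx m (A : 'M[R]_(m, n)) v :
  (forall xi, (xi <= A)%MS -> dot xi v = 0) <-> v *m A^T = 0.
Proof.
split=> [vA|vA xi /submxP[a ->]]; last first.
  by rewrite dot_mulmx vA trmx0 mulmx0 mxE.
by apply/rowP => i; rewrite -dot_row vA ?row_sub// mxE.
Qed.

End EuclideanNorm.

(** * Gram matrices of frames *)

Section Gram.
Context {R : realType}.

Lemma gram_unit d n (A : 'M[R]_(d, n)) : row_free A -> A *m A^T \in unitmx.
Proof.
move=> fA; rewrite -row_free_unit; apply/inj_row_free => a a0.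
have : a *m A = 0.
  by apply: dot_eq0; rewrite dotE trmx_mul mulmxA -[a *m A *m _]mulmxA a0 mul0mx mxE.
by move=> /eqP; rewrite mulmx_free_eq0// => /eqP.
Qed.

Lemma unitmx_lower_bound d (X0 : 'M[R]_d) : X0 \in unitmx ->
  exists2 c : R, 0 < c & \forall X \near X0, forall b : 'rV[R]_d, `|b| <= c * `|b *m X|.
Proof.
move=> X0u.
have [c c0 cX] : exists2 c : R, 0 < c & forall b : 'rV[R]_d, `|b| <= c * `|b *m X0|.
  exists (d%:R * `|invmx X0| + 1); first by rewrite ltr_wpDl// mulr_ge0.
  move=> b; rewrite -[in leLHS](mulmxK X0u b) (le_trans (norm_mulmx _ _))//.
  by rewrite mulrAC ler_wpM2r// lerDl.
exists (2 * c); first by rewrite mulr_gt0.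
have e0 : 0 < (2 * c * (d%:R + 1))^-1 by rewrite invr_gt0 !mulr_gt0// ltr_wpDl.
near=> X => b.
have XX : `|X0 - X| < (2 * c * (d%:R + 1))^-1.
  by near: X; apply: (@cvgr_dist_lt _ _ _ (nbhs X0)) => //; exact: cvg_id.
have : `|b *m X0| <= `|b *m X| + (2 * c)^-1 * `|b|.
  rewrite -[b *m X0](subrK (b *m X)) addrC (le_trans (ler_normD _ _))// lerD2l.
  rewrite -mulmxBr (le_trans (norm_mulmx _ _))// mulrAC ler_wpM2r//.
  rewrite (@le_trans _ _ (d%:R * (2 * c * (d%:R + 1))^-1))//; first by rewrite ler_wpM2l// ltW.
  by rewrite invfM mulrCA ger_pMr ?invr_gt0 ?mulr_gt0// ler_pdivrMr ?ltr_wpDl// mul1r lerDl.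
move=> /(ler_wpM2l (ltW c0)) /(le_trans (cX b)).
have -> : c * (`|b *m X| + (2 * c)^-1 * `|b|) = c * `|b *m X| + 2^-1 * `|b|.
  by field; rewrite gt_eqF.
lra.
Unshelve. all: by end_near. Qed.

Lemma mulmx_tr_continuous d n : continuous (fun A : 'M[R]_(d, n) => A *m A^T).
Proof.
move=> A; apply: (@cvg_mx_entry _ _ (nbhs A)) => i j.
rewrite [X in _ --> X]mxE; under eq_cvg do rewrite mxE.
apply: (@cvg_bigsum _ _ _ (nbhs A)) => k.
rewrite [A^T k j]mxE; under eq_cvg do rewrite [_^T k j]mxE.
by apply: cvgM; exact: coord_continuous.
Qed.

(** Recovers the coordinates [b] of a vector [b *m A] from its products with the rows of [A], with
    one constant for all frames near [A0]. *)
Lemma gram_lower_bound d n (A0 : 'M[R]_(d, n)) : row_free A0 ->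
  exists2 c : R, 0 < c &
    \forall A \near A0, forall b : 'rV[R]_d, `|b| <= c * `|b *m (A *m A^T)|.
Proof.
move=> /gram_unit /unitmx_lower_bound[c c0 cP]; exists c => //.
exact: (mulmx_tr_continuous cP).
Qed.

End Gram.

(** * Neighbourhoods and compact sets in subspaces *)

Section Subtypes.

Lemma nbhs_initial (S : choiceType) (T : topologicalType) (f : S -> T)
    (x : initial_topology f) (A : set S) :
  nbhs x A -> exists2 B, nbhs (f x) B & f @^-1` B `<=` A.
Proof.
rewrite nbhsE => -[_ [[B oB <-] Bx] BA].
by exists B => //; exists B.
Qed.

Lemma nbhs_set_type (T : topologicalType) (U : set T) (x : set_type U) (A : set (set_type U)) :
  nbhs x A -> exists2 B, nbhs (set_val x) B & set_val @^-1` B `<=` A.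
Proof. exact: nbhs_initial. Qed.

Lemma set_val_continuous (T : topologicalType) (U : set T) :
  continuous (set_val : set_type U -> T).
Proof. exact: initial_continuous. Qed.

(** The Fell topology is formed over the subspace [set_type U], while compact sets are found in the
    ambient space. A cluster point of the image filter lifts because it lies in [A], hence in
    [U]. *)
Lemma compact_set_type (T : topologicalType) (U A : set T) :
  A `<=` U -> compact A -> compact (set_val @^-1` A : set (set_type U)).
Proof.
move=> AU cA F FF FA.
have [x [Ax clx]] := cA (set_val @ F) _ FA.
exists (exist _ x (mem_set (AU _ Ax))); split=> //= B C FB.
move=> /nbhs_set_type[D]; rewrite /= set_valE /= => xD DC.
have [|y []] := clx (set_val @` B) D _ xD.
  by rewrite /= nbhs_filterE; apply: filterS FB => z Bz; exists z.
by move=> [z Bz <-] Dz; exists z; split=> //; exact: DC.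
Qed.

End Subtypes.

(** * The Grassmannian: separation and compactness *)

Section Frames.
Context {R : realType}.
Variables (d n : nat).
Local Notation E := 'rV[R]_n.
Local Notation Gr := (@Gr R d n).

Definition plane (P : Gr) : set E := [set v | v \in sval P].

Lemma plane_span_frame (M : @frames R d n) :
  plane (span_frame M) = [set v | (v <= set_val M)%MS].
Proof. by apply/seteqP; split=> v; rewrite /plane /= memv_rowspace. Qed.

Lemma plane_inj (P Q : Gr) : plane P = plane Q -> P = Q.
Proof.
move=> PQ; apply/val_inj/vspaceP => v.
have : plane P v = plane Q v by rewrite PQ.
by rewrite /plane /= => e; apply/idP/idP; rewrite ?e// -?e.
Qed.

Lemma plane_submx (P : Gr) : exists2 M : 'M[R]_(d, n),
  row_free M & plane P = [set v | (v <= M)%MS].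
Proof.
have [M MP] := span_frame_surj P; exists (set_val M).
  by case: (M) => M' M'f; exact: set_mem M'f.
by rewrite -MP plane_span_frame.
Qed.

Lemma submx_plane (A : 'M[R]_(d, n)) : row_free A ->
  exists P : Gr, plane P = [set v | (v <= A)%MS].
Proof.
move=> fA; exists (span_frame (exist _ A (mem_set fA))).
by rewrite plane_span_frame set_valE.
Qed.

Lemma rowspace_eqmx (A B : 'M[R]_(d, n)) :
  [set v | (v <= A)%MS] = [set v : E | (v <= B)%MS] -> (A :=: B)%MS.
Proof.
move=> AB; apply/eqmxP/andP; split; apply/row_subP => i.
  have : [set v : E | (v <= A)%MS] (row i A) by exact: row_sub.
  by rewrite AB.
have : [set v : E | (v <= B)%MS] (row i B) by exact: row_sub.
by rewrite -AB.
Qed.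

Lemma span_frame_continuous : continuous (@span_frame R d n).
Proof. by apply/continuousP => O. Qed.

Lemma near_plane (A0 : 'M[R]_(d, n)) (P0 : Gr) (O : set Gr) :
  row_free A0 -> plane P0 = [set v | (v <= A0)%MS] -> nbhs P0 O ->
  \forall A \near A0, row_free A /\
    forall P : Gr, plane P = [set v | (v <= A)%MS] -> O P.
Proof.
move=> fA0 P0E nO.
pose M0 : @frames R d n := exist _ A0 (mem_set fA0).
have MP0 : span_frame M0 = P0.
  by apply: plane_inj; rewrite plane_span_frame P0E set_valE.
have : nbhs M0 (@span_frame R d n @^-1` O).
  by apply: span_frame_continuous; rewrite MP0.
move=> /nbhs_set_type[B nB BO]; rewrite set_valE /= in nB.
near=> A.
have fA : row_free A by near: A; exact: row_free_near.
split=> // P PE.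
pose M : @frames R d n := exist _ A (mem_set fA).
have <- : span_frame M = P.
  by apply: plane_inj; rewrite plane_span_frame PE set_valE.
by apply: BO; rewrite /= set_valE /=; near: A.
Unshelve. all: by end_near. Qed.

(** The planes have equal dimension, so some row of a frame of [P0] lies outside [P1]. Independence
    of this row from a frame of [P1] is an open condition on both frames that excludes equal planes,
    and [span_frame_near] carries it to the Grassmannian. *)
Lemma Gr_separated (P0 P1 : Gr) : P0 <> P1 ->
  exists O0 O1, [/\ nbhs P0 O0, nbhs P1 O1 & forall P, O0 P -> O1 P -> False].
Proof.
move=> P01.
have [M0 MP0] := span_frame_surj P0; have [M1 MP1] := span_frame_surj P1.
have fM (M : @frames R d n) : row_free (set_val M) by case: M => M' M'f; exact: set_mem M'f.
have MM : ~~ (set_val M0 <= set_val M1)%MS.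
  apply/negP => M01; apply: P01; rewrite -MP0 -MP1; apply: plane_inj.
  have M10 : (set_val M1 <= set_val M0)%MS.
    have := mxrank_leqif_sup M01 => /leqifP.
    by move: (fM M0) (fM M1); rewrite /row_free => /eqP -> /eqP ->; case: ifP => // _; rewrite ltnn.
  by rewrite !plane_span_frame; apply/seteqP; split=> v /= vM; exact: submx_trans vM _.
have /row_subPn[i iM] := MM.
have fK := row_free_col_mx (fM M1) iM.
pose K (z : 'M[R]_(d, n) * 'M[R]_(d, n)) := col_mx (row i z.1) z.2.
have cK : K z @[z --> (set_val M0, set_val M1)] --> K (set_val M0, set_val M1).
  apply: (@cvg_mx_entry _ _ (nbhs (set_val M0, set_val M1))) => k l.
  rewrite /K; case: (split_ordP k) => j ->.
    under eq_cvg do rewrite col_mxEu mxE; rewrite col_mxEu mxE.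
    apply: (@continuous_comp _ _ _ fst (fun N : 'M[R]_(d, n) => N i l)).
      exact: cvg_fst.
    exact: coord_continuous.
  under eq_cvg do rewrite col_mxEd; rewrite col_mxEd.
  apply: (@continuous_comp _ _ _ snd (fun N : 'M[R]_(d, n) => N j l)).
    exact: cvg_snd.
  exact: coord_continuous.
have [[A B] [/= M0A M1B] AB] := cK _ (row_free_near fK).
have nA := span_frame_near M0A; have nB := span_frame_near M1B.
rewrite MP0 in nA; rewrite MP1 in nB.
do 2 eexists; split; [exact: nA|exact: nB|].
move=> P [N AN NP] [N' BN' N'P].
have /row_free_col_mxN/negP := AB (set_val N, set_val N') (conj AN BN').
apply => /=.
have : plane (span_frame N) (row i (set_val N)) by rewrite plane_span_frame /= row_sub.
by rewrite NP -N'P plane_span_frame.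
Qed.

(** Gram-Schmidt, one row at a time: while fewer than [d] rows are found, a rank count leaves a row
    of [A] outside their span. *)
Lemma orthonormal_frame (A : 'M[R]_(d, n)) : row_free A ->
  exists M : 'M[R]_(d, n), M *m M^T = 1%:M /\ (M :=: A)%MS.
Proof.
move=> fA.
suff H k : (k <= d)%N -> exists N : 'M[R]_(k, n), N *m N^T = 1%:M /\ (N <= A)%MS.
  have [M [MM MA]] := H d (leqnn d); exists M; split=> //.
  have fM : row_free M by apply/row_freeP; exists M^T.
  apply/eqmxP; rewrite MA /=.
  have := mxrank_leqif_sup MA => /leqifP.
  by move: fM fA; rewrite /row_free => /eqP -> /eqP ->; case: ifP => // _; rewrite ltnn.
elim: k => [_|k IH kd].
  by exists 0; split; [apply/matrixP => -[]|exact: sub0mx].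
have [N [NN NA]] := IH (ltnW kd).
have : ~~ (A <= N)%MS.
  apply/negP => /mxrankS; move: fA; rewrite /row_free => /eqP -> dN.
  by have := leq_trans dN (rank_leq_row N); rewrite leqNgt kd.
move=> /row_subPn[i iN].
pose v := row i A - row i A *m N^T *m N.
have vN : v *m N^T = 0.
  by rewrite mulmxBl -[_ *m N *m _]mulmxA NN mulmx1 subrr.
have v0 : v != 0.
  apply: contra iN => /eqP/subr0_eq ->; exact: submxMl.
have ev0 : enorm v != 0.
  by apply: contra v0 => /eqP e0; rewrite -normr_eq0 eq_le normr_ge0 andbT -e0 norm_le_enorm.
pose w := (enorm v)^-1 *: v.
have ww : w *m w^T = 1%:M.
  apply/matrixP => a b; rewrite !ord1 -dotE dotZl dotZr -enorm_sqr mxE mulr1n.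
  by rewrite mulrA -invfM -expr2 mulVf// sqrf_eq0.
have wN : w *m N^T = 0 by rewrite -scalemxAl vN scaler0.
have KK : col_mx w N *m (col_mx w N)^T = 1%:M.
  rewrite tr_col_mx mul_col_row ww wN NN -[N *m w^T]trmxK trmx_mul trmxK wN trmx0.
  by rewrite -scalar_mx_block.
have KA : (col_mx w N <= A)%MS.
  rewrite col_mx_sub NA andbT scalemx_sub// addmx_sub ?row_sub// eqmx_opp.
  exact: submx_trans (submxMl _ _) NA.
by exists (col_mx w N).
Qed.

Lemma plane_orthonormal (P : Gr) : exists2 M : 'M[R]_(d, n),
  M *m M^T = 1%:M & plane P = [set v | (v <= M)%MS].
Proof.
have [A fA ->] := plane_submx P; have [M [MM MA]] := orthonormal_frame fA.
by exists M => //; apply/seteqP; split=> v /=; rewrite MA.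
Qed.

Lemma orthonormal_norm_le1 (M : 'M[R]_(d, n)) : M *m M^T = 1%:M -> `|M| <= 1.
Proof.
move=> MM; apply: norm_le_coord => // i j.
have : dot (row i M) (row i M) = 1.
  by rewrite dot_row -row_mul MM !mxE eqxx.
move=> rr; have := norm_sqr_le_dot (row i M); rewrite rr => r1.
have {}r1 : `|row i M| <= 1 by rewrite -(@expr_le1 _ 2)//.
by apply: le_trans r1; have := coord_le_norm (row i M) 0 j; rewrite mxE.
Qed.

Lemma orthonormal_compact : compact [set M : 'M[R]_(d, n) | M *m M^T = 1%:M].
Proof.
(* Matrices are flattened to row vectors, to which Heine-Borel is applied. *)
pose S' : set 'rV[R]_(d * n) := [set v | vec_mx v *m (vec_mx v)^T = 1%:M :> 'M[R]_d].
have cv : continuous (vec_mx : 'rV[R]_(d * n) -> 'M[R]_(d, n)).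
  move=> v; apply: (@cvg_mx_entry _ _ (nbhs v)) => i j; rewrite [X in _ --> X]mxE.
  under eq_cvg do rewrite mxE.
  exact: coord_continuous.
have -> : [set M : 'M[R]_(d, n) | M *m M^T = 1%:M] = vec_mx @` S'.
  apply/seteqP; split=> [M MM|_ [v vS <-]]; last exact: vS.
  by exists (mxvec M); rewrite ?mxvecK// /S' /= mxvecK.
apply: continuous_compact.
  by apply: continuous_in_subspaceT => v _; exact: cv.
apply: bounded_closed_compact.
  exists 1; split; first by rewrite num_real.
  move=> x x1 v vS; apply: le_trans (ltW x1).
  apply: norm_le_coord => // i j; rewrite ord1.
  case/mxvec_indexP: j => k l.
  have -> : v 0 (mxvec_index k l) = vec_mx v k l by rewrite mxE.
  exact: le_trans (coord_le_norm _ _ _) (orthonormal_norm_le1 vS).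
rewrite (_ : S' = [set v | `|1%:M - vec_mx v *m (vec_mx v)^T| <= 0]); last first.
  by apply/seteqP; split=> v; rewrite /S' /= normr_le0 subr_eq0 eq_sym => /eqP.
apply: closed_sublevel => v.
apply: (@continuous_comp _ _ _ (fun v => vec_mx v : 'M[R]_(d, n))
  (fun M : 'M[R]_(d, n) => `|1%:M - M *m M^T|)); first exact: cv.
apply: (@continuous_comp _ _ _ (fun M : 'M[R]_(d, n) => M *m M^T)
  (fun N : 'M[R]_d => `|1%:M - N|)); first exact: mulmx_tr_continuous.
exact: (@distr_continuous R 'M[R]_d).
Qed.

(** These planes are the image of a closed part of the compact set of orthonormal frames. The full
    [C] gives compactness of the Grassmannian; in [angle_near], [C] selects the planes far from a
    given one. *)
Lemma plane_set_compact (C : set 'M[R]_(d, n)) : closed C ->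
  compact [set P : Gr | exists M, [/\ M *m M^T = 1%:M, C M &
                                      plane P = [set v | (v <= M)%MS]]].
Proof.
move=> clC.
set B := mkset _.
pose S := [set M : 'M[R]_(d, n) | M *m M^T = 1%:M] `&` C.
have SF : S `<=` @frames R d n by move=> M [MM _]; apply/row_freeP; exists M^T.
have cS : compact S.
  by apply: compact_closedI => //; exact: orthonormal_compact.
have -> : B = @span_frame R d n @` (set_val @^-1` S : set (@frames R d n)).
  apply/seteqP; split=> [P [M [MM CM PM]]|_ [M [MM CM] <-]].
    have SM : S M by [].
    exists (exist _ M (mem_set (SF M SM))); rewrite /= ?set_valE//=.
    by apply: plane_inj; rewrite PM plane_span_frame set_valE.
  by exists (set_val M); rewrite plane_span_frame.
apply: continuous_compact; last exact: compact_set_type.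
by apply: continuous_in_subspaceT => M _; exact: span_frame_continuous.
Qed.

Lemma Gr_compact : compact [set: Gr].
Proof.
have := plane_set_compact closedT; congr compact; apply/seteqP; split=> // P _.
by have [M MM PM] := plane_orthonormal P; exists M.
Qed.

End Frames.

Opaque jacobian diff.

(** * Smooth charts of submanifolds *)

Section Charts.
Context {R : realType} {n : nat}.
Local Notation E := 'rV[R]_n.

Lemma smooth_on_open (E1 E2 : normedModType R) (A : set E1) (f : E1 -> E2) :
  open A -> smooth_on A f -> smooth_open A f.
Proof.
move=> oA sf k; apply: Ck_local => x Ax.
have [V [F [oV Vx sF FE]]] := sf x Ax.
exists (A `&` V) => //; have oAV : open (A `&` V) by exact: openI.
apply: (@Ck_eq _ _ _ _ _ F) => //; first by move=> y [Ay Vy]; exact: FE.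
by apply: Ck_sub (sF k) => y [].
Qed.

Lemma smooth_open_on (E1 E2 : normedModType R) (A V : set E1) (f : E1 -> E2) :
  open V -> A `<=` V -> smooth_open V f -> smooth_on A f.
Proof. by move=> oV AV sf x Ax; exists V, f; split=> //; exact: AV. Qed.

(** In contrast to [parametrization], [g] is smooth on the ambient open set [V] and not only on [W],
    so it can be composed with maps into the ambient space and differentiated. Shrinking [V] to the
    domain of a local extension provides this. *)
Definition chart (d : nat) (W : set E) (O : set 'rV[R]_d) (V : set E)
    (phi : 'rV[R]_d -> E) (g : E -> 'rV[R]_d) : Prop :=
  [/\ open O, open V, smooth_open O phi, smooth_open V g &
      (forall w, O w -> [/\ W (phi w), V (phi w) & g (phi w) = w]) /\
      (forall x, W x -> V x -> O (g x) /\ phi (g x) = x)].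

Lemma chart_exists d (W : set E) x : submanifold d W -> W x ->
  exists O V phi g, chart (d := d) W O V phi g /\ V x.
Proof.
move=> sW Wx; have [ O [V [phi [g [u pW]]]]] := sW x Wx.
have [oO oV [sphi sg phig gphi] Ou phiu] := pW.
have WVx : (W `&` V) x by rewrite -phiu; have [] := phig _ Ou.
have [V' [G [oV' V'x sG GE]]] := sg x WVx.
have sphi' := smooth_on_open oO sphi.
have oVV : open (V `&` V') by exact: openI.
have oO1 : open (O `&` phi @^-1` (V `&` V')).
  by apply: open_setI_preimage => // w Ow; exact: (sphi' 0%N).
exists (O `&` phi @^-1` (V `&` V')), (V `&` V'), phi, G.
split; last by split=> //; case: WVx.
split=> //.
- by move=> k; apply: Ck_sub (sphi' k) => w [].
- by move=> k; apply: Ck_sub (sG k) => w [].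
- split=> [w [Ow [Vw V'w]]|y Wy [Vy V'y]].
    by have [[Ww _] gw] := phig w Ow; split=> //; rewrite GE.
  have [Ogy pgy] := gphi y (conj Wy Vy).
  have -> : G y = g y by exact: GE.
  by rewrite pgy; split=> //; split=> //=; rewrite pgy.
Qed.

Section OneChart.
Variables (d : nat) (W : set E) (O : set 'rV[R]_d) (V : set E).
Variables (phi : 'rV[R]_d -> E) (g : E -> 'rV[R]_d).
Hypothesis cW : chart W O V phi g.

Lemma chart_parametrization w : O w -> parametrization W (phi w) O V phi g w.
Proof.
move=> Ow; have [oO oV sphi sg [phig gphi]] := cW; split=> //; split.
- exact: smooth_open_on sphi.
- by apply: smooth_open_on sg => // y [].
- by move=> w' /phig[? ? ?].
- by move=> y [Wy Vy]; exact: gphi.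
Qed.

Lemma chart_tangent w : O w ->
  tangent d W (phi w) = [set xi | (xi <= jacobian phi w)%MS].
Proof. by move=> Ow; exact: tangent_jacobian (chart_parametrization Ow). Qed.

Lemma chart_free w : O w -> row_free (jacobian phi w).
Proof. by move=> Ow; exact: jacobian_free (chart_parametrization Ow). Qed.

Lemma chart_diff w : O w -> differentiable phi w.
Proof. by move=> Ow; have [_ _ sphi _ _] := cW; have [df _] := sphi 1%N; exact: df. Qed.

Lemma chart_normal w v : O w ->
  normal d W (phi w) v <-> v *m (jacobian phi w)^T = 0.
Proof.
move=> Ow; rewrite -normal_submx /normal /= (chart_tangent Ow).
by split=> vn xi xiJ; exact: vn.
Qed.

Lemma chart_near x (P : set 'rV[R]_d) : W x -> V x ->
  (\forall w \near g x, P w) ->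
  \forall y \near x, W y -> [/\ V y, O (g y), phi (g y) = y & P (g y)].
Proof.
move=> Wx Vx nP; have [oO oV sphi sg [phig gphi]] := cW.
near=> y => Wy.
have Vy : V y by near: y; exact: open_nbhs_nbhs.
have [Ogy pgy] := gphi y Wy Vy.
split=> //; near: y; exact: (sg 0%N _ Vx _ nP).
Unshelve. all: by end_near. Qed.

Lemma chart_jacobian_continuous w : O w -> {for w, continuous (jacobian phi)}.
Proof.
by move=> Ow; have [oO _ sphi _ _] := cW; exact: (Ck_jacobian oO (sphi 1%N)).
Qed.

End OneChart.

Lemma tangent_plane d (W : set E) x : submanifold d W -> W x ->
  exists P : @Gr R d n, plane P = tangent d W x.
Proof.
move=> sW Wx; have [ O [V [phi [g [cW Vx]]]]] := chart_exists sW Wx.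
have [_ _ _ _ [_ gphi]] := cW; have [Ogx pgx] := gphi x Wx Vx.
have [P PE] := submx_plane (chart_free cW Ogx).
by exists P; rewrite PE -(chart_tangent cW Ogx) pgx.
Qed.

(** Near [w] the map [f] equals [phi \o (g \o f)], whose derivative has its values in the row space
    of the Jacobian of [phi]. *)
Lemma tangent_mapsto d (W : set E) (E1 : normedModType R) (f : E1 -> E) w v :
  submanifold d W -> differentiable f w -> (\forall w' \near w, W (f w')) ->
  tangent d W (f w) ('d f w v).
Proof.
move=> sW df nW; have Wfw := nbhs_singleton nW.
have [ O [V [phi [g [cW Vx]]]]] := chart_exists sW Wfw.
have [oO oV sphi sg [phig gphi]] := cW; have [Ogx pgx] := gphi _ Wfw Vx.
have dg : differentiable g (f w) by have [d1 _] := sg 1%N; exact: d1.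
have dgf := differentiable_comp df dg.
have dphi : differentiable phi ((g \o f) w) by exact: (chart_diff cW).
have fE : \forall w' \near w, (phi \o (g \o f)) w' = f w'.
  near=> w'.
  have [] // := gphi (f w'); first by near: w'.
  by near: w'; apply: (differentiable_continuous df); exact: open_nbhs_nbhs.
have [_ ->] := near_eq_diff fE (differentiable_comp dgf dphi).
rewrite diff_compE// -[X in tangent _ _ X]pgx (chart_tangent cW Ogx) /=.
rewrite diff_jacobian; last exact: (chart_diff cW).
exact: submxMl.
Unshelve. all: by end_near. Qed.

End Charts.

(** * Derivatives of normal sections in a chart *)

Section Sections.
Context {R : realType} {n d : nat}.
Local Notation E := 'rV[R]_n.

Lemma derive_coord (E1 : normedModType R) m p (M : E1 -> 'M[R]_(m, p)) x v i j :
  differentiable M x -> ('D_v M x) i j = 'D_v (fun y => M y i j) x.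
Proof.
move=> dM.
have lf : linear (fun N : 'M[R]_(m, p) => N i j) by move=> a N N'; rewrite !mxE.
pose L : {linear 'M[R]_(m, p) -> R} :=
  HB.pack (fun N : 'M[R]_(m, p) => N i j) (GRing.isLinear.Build _ _ _ _ _ lf).
have cL : continuous L by move=> N; exact: coord_continuous.
have := @derive_comp _ _ _ _ M L x v dM (linear_differentiable _ cL).
by rewrite diff_linE.
Qed.

Lemma norm_leD1 (E1 : normedModType R) (x y : E1) : `|x - y| < 1 -> `|y| <= `|x| + 1.
Proof.
move=> xy; rewrite -[y](subKr x) (le_trans (ler_normB _ _))// lerD2l.
exact: ltW.
Qed.

Lemma derive_mulmx (E1 : normedModType R) m p q (V : set E1)
    (M : E1 -> 'M[R]_(m, p)) (N : E1 -> 'M[R]_(p, q)) x v :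
  open V -> V x -> Ck 1 V M -> Ck 1 V N ->
  'D_v (fun y => M y *m N y) x = 'D_v M x *m N x + M x *m 'D_v N x.
Proof.
move=> oV Vx cM cN.
have [/(_ x Vx) dMN _] := Ck_mulmx oV cM cN.
have [/(_ x Vx) dM _] := cM; have [/(_ x Vx) dN _] := cN.
have dc r s (K : E1 -> 'M[R]_(r, s)) i j : differentiable K x ->
    differentiable (fun y => K y i j) x.
  move=> dK; apply: (@differentiable_comp _ _ _ _ K (fun z => z i j) x dK).
  exact: differentiable_coord.
apply/matrixP => i j; rewrite (derive_coord _ _ _ dMN) !mxE.
rewrite (_ : (fun y => _) = \sum_k (fun y => M y i k * N y k j)); last first.
  by apply/funext => y; rewrite mxE fct_sumE.
rewrite derive_sum; last first.
  by move=> k; apply: diff_derivable; apply: differentiableM; exact: dc.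
rewrite -big_split /=; apply: eq_bigr => k _.
rewrite (derive_coord _ _ _ dM) (derive_coord _ _ _ dN).
rewrite (@deriveM _ _ (fun y => M y i k) (fun y => N y k j));
  [|exact/diff_derivable/dc..].
by rewrite addrC [LHS]addrC addrC; congr (_ + _); rewrite /GRing.scale /= mulrC.
Qed.

Section SectionInChart.
Variables (W : set E) (O : set 'rV[R]_d) (V0 : set E).
Variables (phi : 'rV[R]_d -> E) (g : E -> 'rV[R]_d).
Hypothesis cW : chart W O V0 phi g.
Variables (V : set E) (f : E -> E).
Hypotheses (oV : open V) (sf : smooth_on (W `&` V) f).

Lemma open_chart_dom : open (O `&` phi @^-1` V).
Proof.
have [oO _ sphi _ _] := cW.
by apply: open_setI_preimage => // w Ow; exact: (sphi 0%N).
Qed.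

Lemma section_chart_smooth : smooth_open (O `&` phi @^-1` V) (f \o phi).
Proof.
have [oO _ sphi _ [phig gphi]] := cW.
move=> k; apply: Ck_local => w [Ow Vw]; have [Ww _ _] := phig w Ow.
have [V' [F [oV' V'w sF FE]]] := sf (conj Ww Vw).
have oO1 : open (O `&` phi @^-1` (V `&` V')).
  apply: open_setI_preimage => //; first exact: openI.
  by move=> w' Ow'; exact: (sphi 0%N).
exists (O `&` phi @^-1` (V `&` V')) => //.
apply: (@Ck_eq _ _ _ _ _ (F \o phi)) => //.
  by move=> w' [Ow' [Vw' V'w']]; have [Ww' _ _] := phig w' Ow'; exact: FE.
apply: (@Ck_comp _ _ _ _ _ _ _ V' phi F) => //.
- by move=> w' [_ []].
- by apply: Ck_sub (sphi k) => w' [].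
Qed.

Lemma section_chart_diff w : O w -> V (phi w) -> differentiable (f \o phi) w.
Proof. by move=> Ow Vw; have [df _] := section_chart_smooth 1%N; exact: df. Qed.

Lemma extension_diff w a V' F : O w -> V (phi w) ->
  local_extension (W `&` V) f (phi w) V' F ->
  'd F (phi w) (a *m jacobian phi w) = a *m jacobian (f \o phi) w.
Proof.
move=> Ow Vw [oV' V'w sF FE]; have [oO _ sphi _ [phig gphi]] := cW.
have dphi := chart_diff cW Ow.
have dF : differentiable F (phi w) by have [d1 _] := sF 1%N; exact: d1.
transitivity ('d F (phi w) ('d phi w a)).
  by congr ('d F _ _); exact: esym (diff_jacobian a dphi).
apply: etrans (diff_jacobian a (section_chart_diff Ow Vw)).
apply: etrans (esym (diff_compE a dphi dF)) _.
have fE : \forall w' \near w, (f \o phi) w' = (F \o phi) w'.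
  near=> w'.
  have Ow' : O w' by near: w'; exact: open_nbhs_nbhs.
  have VVw' : (V `&` V') (phi w').
    near: w'; apply: (differentiable_continuous dphi).
    by apply: open_nbhs_nbhs; split=> //; exact: openI.
  have [Ww' _ _] := phig w' Ow'; case: VVw' => Vw' V'w'.
  by apply/esym/FE.
have [_ dE] := near_eq_diff fE (section_chart_diff Ow Vw).
exact: (congr1 (fun h : 'rV[R]_d -> E => h a) dE).
Unshelve. all: by end_near. Qed.

(** Along tangent vectors every local extension of [f] has the derivative of [f \o phi]. Thus [tauD]
    does not depend on the extension and becomes the splitting of [a *m jacobian (f \o phi) w] into
    a tangential and a normal part. *)
Lemma tauD_chart w a nu : O w -> V (phi w) ->
  tauD d W (W `&` V) f (phi w) (a *m jacobian phi w) nu <->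
  normal d W (phi w) nu /\ (a *m jacobian (f \o phi) w - nu <= jacobian phi w)%MS.
Proof.
move=> Ow Vw; have [_ _ _ _ [phig _]] := cW; have [Ww _ _] := phig w Ow.
rewrite /tauD (chart_tangent cW Ow); split.
  by move=> [V' [F [VF nnu]]]; rewrite (extension_diff a Ow Vw VF).
move=> [nnu tnu]; have [V' [F VF]] := sf (conj Ww Vw).
by exists V', F; split=> //=; rewrite (extension_diff a Ow Vw VF).
Qed.

End SectionInChart.

(* Differentiating [dot (f (phi w)) ('D_v phi w) = 0] bounds the tangential
   component of the derivative of a normal section [f] by [f] itself, through
   the second derivatives of [phi] (the second fundamental form). *)
Lemma second_form_bound (W : set E) O V0 (phi : 'rV[R]_d -> E) g u :
  chart W O V0 phi g -> O u ->
  exists2 C : R, 0 < C & \forall w \near u, forall (V : set E) (f : E -> E),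
    open V -> smooth_on (W `&` V) f ->
    (forall x, (W `&` V) x -> normal d W x (f x)) -> O w -> V (phi w) ->
    `|jacobian (f \o phi) w *m (jacobian phi w)^T| <= C * `|f (phi w)|.
Proof.
move=> cW Ou; have [oO _ sphi _ [phig _]] := cW.
pose JT w := (jacobian phi w)^T.
have sJT k : Ck k O JT.
  apply/Ck_mxP => // i j; have /Ck_mxP := Ck_jacobian oO (sphi k.+1).
  move=> /(_ oO j i); apply: Ck_eq => // w Ow.
  by rewrite /JT [RHS]mxE.
pose B (i : 'I_d) w := 'D_(delta_mx 0 i) JT w.
exists (n%:R * \sum_i (`|B i u| + 1) + 1).
  by rewrite ltr_wpDl// mulr_ge0// sumr_ge0// => i _; rewrite addr_ge0.
have nB : \forall w \near u, forall i : 'I_d, `|B i w| <= `|B i u| + 1.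
  apply: (@filter_forall _ 'I_d (fun i w => `|B i w| <= `|B i u| + 1) (nbhs u)) => i.
  have cB : {for u, continuous (B i)} by have [_ /(_ (delta_mx 0 i)) cB] := sJT 1%N; exact: cB.
  near=> w.
  apply: norm_leD1.
  by near: w; apply: (@cvgr_dist_lt _ _ _ (nbhs u)).
near=> w.
have Bw : forall i : 'I_d, `|B i w| <= `|B i u| + 1 by near: w.
move=> V f oV sf nf Ow Vw.
have O1w : (O `&` phi @^-1` V) w by [].
have oO1 := open_chart_dom cW oV.
have c1 := section_chart_smooth cW oV sf 1%N.
have c2 : Ck 1 (O `&` phi @^-1` V) JT by apply: Ck_sub (sJT 1%N) => w' [].
apply: norm_le_coord => [|i j].
  by rewrite mulr_ge0// addr_ge0// mulr_ge0// sumr_ge0// => i _; rewrite addr_ge0.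
have dfphi := section_chart_diff cW oV sf Ow Vw.
have p0 : 'D_(delta_mx 0 i) (fun w' => (f \o phi) w' *m JT w') w = 0.
  have nE : \forall w' \near w, cst 0 w' = (f \o phi) w' *m JT w'.
    near=> w'; have [Ow' Vw'] : (O `&` phi @^-1` V) w'.
      by near: w'; exact: open_nbhs_nbhs.
    have [Ww' _ _] := phig w' Ow'.
    by rewrite /JT (chart_normal cW _ Ow').1//; exact: nf.
  have [dp pE] := near_eq_diff nE (differentiable_cst _ _).
  rewrite (deriveE _ dp); apply: etrans (congr1 (fun h => h _) pE) _.
  by rewrite diff_cst.
move: p0; rewrite (derive_mulmx _ oO1 O1w c1 c2) => /eqP.
rewrite addr_eq0 => /eqP e.
have -> : (jacobian (f \o phi) w *m (jacobian phi w)^T) i j =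
    (- (f (phi w) *m B i w)) 0 j.
  rewrite -[(f (phi w) *m B i w)]/((f \o phi) w *m 'D_(delta_mx 0 i) JT w) -e.
  by rewrite deriveEjacobian// -mulmxA -rowE [RHS]mxE.
apply: le_trans (coord_le_norm _ _ _) _; rewrite normrN.
apply: le_trans (norm_mulmx _ _) _; rewrite mulrAC ler_wpM2r//.
rewrite -[leLHS]addr0 lerD// ler_wpM2l//.
rewrite (@le_trans _ _ (`|B i u| + 1))//.
by rewrite (bigD1 i)//= lerDl sumr_ge0// => k _; rewrite addr_ge0.
Unshelve. all: by end_near. Qed.

End Sections.

(** * The operator norm of the normal derivative *)

Section OperatorNorm.
Context {R : realType} {n d : nat}.
Local Notation E := 'rV[R]_n.

Lemma row_free_submx_eq (A B : 'M[R]_(d, n)) :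
  row_free A -> row_free B -> (A <= B)%MS -> (A :=: B)%MS.
Proof.
move=> fA fB AB; apply/eqmxP; rewrite AB /=.
have := mxrank_leqif_sup AB => /leqifP.
by move: fA fB; rewrite /row_free => /eqP -> /eqP ->; case: ifP => // _; rewrite ltnn.
Qed.

Lemma opnorm_ge0 (W A : set E) f x : 0 <= tauD_opnorm d W A f x.
Proof.
rewrite /tauD_opnorm; set S := mkset _.
(* [sup] takes the value 0 on sets without a supremum. *)
have [sS|nS] := pselect (has_sup S); last by rewrite sup_out.
have [r Sr] := sS.1; apply: le_trans (ub_le_sup sS.2 Sr).
by have [xi [nu [_ _ _ ->]]] := Sr; exact: enorm_ge0.
Qed.

Lemma opnorm_le (W A : set E) f x b : 0 <= b ->
  (forall xi nu, tangent d W x xi -> enorm xi <= 1 -> tauD d W A f x xi nu ->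
    enorm nu <= b) ->
  tauD_opnorm d W A f x <= b.
Proof.
move=> b0 bP; rewrite /tauD_opnorm; set S := mkset _.
have [S0|/set0P/negP/negPn/eqP ->] := pselect (S !=set0); last by rewrite sup0.
by apply: ge_sup => // r [xi [nu [txi xi1 tau ->]]]; exact: (bP xi).
Qed.

Lemma C1_size_ge (W A : set E) f x : enorm (f x) <= C1_size d W A f x.
Proof. by rewrite /C1_size lerDl opnorm_ge0. Qed.

Lemma opnorm_le_C1_size (W A : set E) f x : tauD_opnorm d W A f x <= C1_size d W A f x.
Proof. by rewrite /C1_size lerDr enorm_ge0. Qed.

(** The size at [x] depends only on the germ of the section, since local extensions can be shrunk
    into [V]. *)
Lemma C1_size_restrict (W V : set E) f h x : open V -> V x -> W x ->
  (forall y, (W `&` V) y -> f y = h y) ->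
  C1_size d W (W `&` V) f x = C1_size d W W h x.
Proof.
move=> oV Vx Wx fh.
have tE xi nu : tauD d W (W `&` V) f x xi nu <-> tauD d W W h x xi nu.
  split=> -[V' [F [[oV' V'x sF FE] nnu tnu]]].
    exists (V' `&` V), F; split=> //; split=> //; first exact: openI.
      by move=> k; apply: Ck_sub (sF k) => y [].
    by move=> y Wy [V'y Vy]; rewrite FE// fh.
  exists (V' `&` V), F; split=> //; split=> //; first exact: openI.
    by move=> k; apply: Ck_sub (sF k) => y [].
  by move=> y [Wy _] [V'y Vy]; rewrite FE// fh.
rewrite /C1_size /tauD_opnorm fh//; congr (_ + sup _).
apply/seteqP; split=> r [xi [nu [? ? /tE ? ?]]]; by exists xi, nu.
Qed.

Section InChart.
Variables (W : set E) (O : set 'rV[R]_d) (V0 : set E).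
Variables (phi : 'rV[R]_d -> E) (g : E -> 'rV[R]_d).
Hypothesis cW : chart W O V0 phi g.
Variables (V : set E) (f : E -> E).
Hypotheses (oV : open V) (sf : smooth_on (W `&` V) f).
Variable w : 'rV[R]_d.
Hypotheses (Ow : O w) (Vw : V (phi w)).

(** Boundedness of the set in [tauD_opnorm] is what makes its supremum an upper bound: on an
    unbounded set [sup] has the default value 0 and would control nothing. *)
Lemma tauD_bounded : exists M : R, forall xi nu, tangent d W (phi w) xi ->
  tauD d W (W `&` V) f (phi w) xi nu -> enorm nu <= M * enorm xi.
Proof.
have fJ := chart_free cW Ow.
have [c c0 /nbhs_singleton cP] := gram_lower_bound fJ.
have tauE a nu := tauD_chart cW oV sf a nu Ow Vw.
have tanE := chart_tangent cW Ow; have nE := fun v => chart_normal cW v Ow.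
move: (jacobian phi w) (jacobian (f \o phi) w) fJ cP tauE tanE nE => J B fJ cP tauE tanE nE.
exists (n%:R * (n%:R * (d%:R * (c * (n%:R * `|J^T|)) * `|B|))).
move=> xi nu; rewrite tanE /= => /submxP[a ->] /tauE[/nE nuJ /submxP[b bE]].
have nn : dot nu nu = dot (a *m B) nu.
  have -> : a *m B = b *m J + nu by rewrite -bE subrK.
  by rewrite dotDl dot_mulmx nuJ trmx0 mulmx0 mxE add0r.
have nuB : `|nu| <= n%:R * `|a *m B|.
  have [->|nu0] := eqVneq nu 0; first by rewrite normr0 mulr_ge0.
  rewrite -(ler_pM2r (_ : 0 < `|nu|)) ?normr_gt0// -expr2.
  rewrite (le_trans (norm_sqr_le_dot nu))// nn (le_trans (ler_norm _))//.
  exact: dot_le.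
have aJ : `|a| <= c * (n%:R * `|J^T|) * enorm (a *m J).
  rewrite (le_trans (cP a))// mulmxA -!mulrA ler_wpM2l// ?(ltW c0)//.
  rewrite (le_trans (norm_mulmx _ _))// mulrAC -mulrA ler_wpM2l// ler_wpM2l//.
  exact: norm_le_enorm.
rewrite (le_trans (enorm_le_norm _))// -mulrA ler_wpM2l// (le_trans nuB)//.
rewrite -mulrA ler_wpM2l// (le_trans (norm_mulmx _ _))// [leRHS]mulrAC ler_wpM2r//.
by rewrite -mulrA ler_wpM2l.
Qed.

Lemma tauD_le_opnorm xi nu : tangent d W (phi w) xi ->
  tauD d W (W `&` V) f (phi w) xi nu ->
  enorm nu <= tauD_opnorm d W (W `&` V) f (phi w) * enorm xi.
Proof.
have [M MP] := tauD_bounded.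
move=> txi tau; have [xi0|xi0] := eqVneq (enorm xi) 0.
  by have := MP xi nu txi tau; rewrite xi0 !mulr0.
have xi_gt0 : 0 < enorm xi by rewrite lt_neqAle eq_sym xi0 enorm_ge0.
rewrite -ler_pdivrMr//.
have -> : enorm nu / enorm xi = enorm ((enorm xi)^-1 *: nu).
  by rewrite enormZ ger0_norm ?invr_ge0 ?enorm_ge0// mulrC.
have txi' : tangent d W (phi w) ((enorm xi)^-1 *: xi).
  by move: txi; rewrite (chart_tangent cW Ow) /=; exact: scalemx_sub.
have exi' : enorm ((enorm xi)^-1 *: xi) <= 1.
  by rewrite enormZ ger0_norm ?invr_ge0 ?enorm_ge0// mulVf.
have tau' : tauD d W (W `&` V) f (phi w) ((enorm xi)^-1 *: xi) ((enorm xi)^-1 *: nu).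
  move: txi tau; rewrite (chart_tangent cW Ow) /= => /submxP[a ->].
  move=> /(tauD_chart cW oV sf a nu Ow Vw)[/(chart_normal cW _ Ow) nnu tnu].
  rewrite scalemxAl; apply/(tauD_chart cW oV sf _ _ Ow Vw); split.
    by apply/(chart_normal cW _ Ow); rewrite -scalemxAl nnu scaler0.
  by rewrite -scalemxAl -scalerBr scalemx_sub.
rewrite /tauD_opnorm; apply: ub_le_sup; last by exists ((enorm xi)^-1 *: xi), ((enorm xi)^-1 *: nu).
exists `|M| => _ [xi' [nu' [t1 t2 t3 ->]]].
rewrite (le_trans (MP _ _ t1 t3))// (le_trans (ler_norm _))// normrM.
by rewrite ler_piMr// ger0_norm// enorm_ge0.
Qed.

End InChart.

End OperatorNorm.

(** * Tangent planes at sheet points *)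

Section Sheets.
Context {R : realType} {n d : nat}.
Local Notation E := 'rV[R]_n.

Definition sheet (W W' : set E) (eps : R) (x y : E) : Prop := exists V f,
  [/\ open V, (W `&` V) x, smooth_on (W `&` V) f,
      forall z, (W `&` V) z -> normal d W z (f z) /\ W' (z + f z) &
      C1_size d W (W `&` V) f x < eps /\ y = x + f x].

Lemma norm_row_mulmx m p (A : 'M[R]_(m, p)) i : `|row i A| <= `|A|.
Proof. by apply: norm_le_coord => // a b; rewrite mxE coord_le_norm. Qed.

Lemma section_tangent (W W' : set E) O V0 (phi : 'rV[R]_d -> E) g (V : set E) f w a :
  chart W O V0 phi g -> submanifold d W' -> open V -> smooth_on (W `&` V) f ->
  O w -> V (phi w) -> (forall z, (W `&` V) z -> W' (z + f z)) ->
  tangent d W' (phi w + f (phi w)) (a *m (jacobian phi w + jacobian (f \o phi) w)).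
Proof.
move=> cW sW' oV sf Ow Vw fW'; have [oO _ sphi _ [phig _]] := cW.
have dphi := chart_diff cW Ow; have dfphi := section_chart_diff cW oV sf Ow Vw.
pose F := phi + (f \o phi).
have dF : differentiable F w by exact: differentiableD.
have dFE : 'd F w a = a *m (jacobian phi w + jacobian (f \o phi) w).
  rewrite mulmxDr; apply: etrans (congr1 (fun h : 'rV[R]_d -> E => h a) (diffD dphi dfphi)) _.
  by congr (_ + _); [exact: diff_jacobian dphi|exact: diff_jacobian dfphi].
have nF : \forall w' \near w, W' (F w').
  near=> w'.
  have [Ow' Vw'] : (O `&` phi @^-1` V) w'.
    by near: w'; apply: open_nbhs_nbhs; split=> //; exact: (open_chart_dom cW oV).
  by have [Ww' _ _] := phig w' Ow'; exact: fW'.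
by rewrite -dFE; exact: tangent_mapsto sW' dF nF.
Unshelve. all: by end_near. Qed.

(** With [A] and [B] the Jacobians of [phi] and [f \o phi], the tangent space of [W'] at [y] is the
    row space of [A + B]. The operator norm bounds the normal components of the rows of [B], and
    [second_form_bound] the tangential ones; hence [B] tends to 0 with [r], uniformly in [W'] and in
    [x] near [x0]. *)
Lemma sheet_tangent (W : set E) x0 (P0 : @Gr R d n) (N : set (@Gr R d n)) :
  submanifold d W -> W x0 -> plane P0 = tangent d W x0 -> nbhs P0 N ->
  \forall r \near 0^'+, forall x W' y, W x -> `|x0 - x| < r -> submanifold d W' ->
    sheet W W' r x y ->
    exists2 P, plane P = tangent d W' y & N P.
Proof.
move=> sW Wx0 P0E nN.
have [ O [V0 [phi [g [cW V0x0]]]]] := chart_exists sW Wx0.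
have [oO oV0 sphi sg [phig gphi]] := cW; have [Ou phiu] := gphi x0 Wx0 V0x0.
set u := g x0 in Ou phiu.
have tanE := chart_tangent cW Ou; rewrite phiu in tanE.
have fJ := chart_free cW Ou.
have near_N := near_plane fJ (etrans P0E tanE) nN.
have [c c0 near_c] := gram_lower_bound fJ.
have [C C0 near_C] := second_form_bound cW Ou.
have /nbhs_ballP[rho /= rho0 rhoP] := near_N.
have cJ := chart_jacobian_continuous cW Ou.
have [L L0 LJ] : exists2 L : R, 0 <= L &
    forall A, `|jacobian phi u - A| < 1 -> `|A| <= L.
  exists (`|jacobian phi u| + 1); first exact: addr_ge0.
  by move=> A; exact: norm_leD1.
have near_w : \forall w \near u,
   [/\ `|jacobian phi u - jacobian phi w| < rho / 2,
       `|jacobian phi u - jacobian phi w| < 1,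
       forall b : 'rV[R]_d, `|b| <= c * `|b *m (jacobian phi w *m (jacobian phi w)^T)| &
       forall (V : set E) (f : E -> E),
    open V -> smooth_on (W `&` V) f ->
    (forall x, (W `&` V) x -> normal d W x (f x)) -> O w -> V (phi w) ->
    `|jacobian (f \o phi) w *m (jacobian phi w)^T| <= C * `|f (phi w)|].
  near=> w; split.
  - by near: w; apply: (@cvgr_dist_lt _ _ _ (nbhs u)) => //; exact: divr_gt0.
  - by near: w; apply: (@cvgr_dist_lt _ _ _ (nbhs u)).
  - by near: w; exact: cJ near_c.
  - by near: w; exact: near_C.
have /nbhs_ballP[r1 /= r10 r1P] := chart_near cW Wx0 V0x0 near_w.
(* The rows of [B] are at most [r] times the first two summands, which stem from the tangential and
   the normal component; the summand 1 makes [K] positive. *)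
pose K := d%:R * (c * C) * L + n%:R * L + 1.
have K0 : 0 < K by rewrite ltr_wpDl// addr_ge0// !mulr_ge0// ?(ltW c0) ?(ltW C0).
near=> r => x W' y Wx x0x sW' [V [f [oV [_ Vx] sf nf [size_f ->]]]].
have rr1 : r <= r1 by near: r; exact: nbhs_right_le.
have rK : r < rho / 2 / K by near: r; apply: nbhs_right_lt; rewrite !divr_gt0.
have r0 : 0 < r by near: r; exact: nbhs_right_gt.
have [|V0x Ogx pgx [A0A A0A1 cA CA]] := r1P x _ Wx.
  by rewrite -ball_normE /=; exact: lt_le_trans rr1.
set w := g x in Ogx pgx A0A A0A1 cA CA.
have Vw : V (phi w) by rewrite pgx.
have nf1 z : (W `&` V) z -> normal d W z (f z) by move=> /nf[].
have {}CA := CA V f oV sf nf1 Ogx Vw.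
have fx : `|f (phi w)| <= r.
  rewrite pgx (le_trans (norm_le_enorm _))// ltW// (le_lt_trans _ size_f)//.
  exact: C1_size_ge.
have opr : tauD_opnorm d W (W `&` V) f (phi w) <= r.
  by rewrite pgx ltW// (le_lt_trans _ size_f)// opnorm_le_C1_size.
have tF a : tangent d W' (x + f x) (a *m (jacobian phi w + jacobian (f \o phi) w)).
  by rewrite -{1 2}pgx; apply: section_tangent cW sW' oV sf Ogx Vw _ => z /nf[].
have rowB i : `|row i (jacobian (f \o phi) w)| < rho / 2.
  have tauE := fun nu => (tauD_chart cW oV sf (delta_mx 0 i) nu Ogx Vw).2.
  have tauO := fun nu => @tauD_le_opnorm _ _ _ _ _ _ _ _ cW _ _ oV sf _ Ogx Vw
    (delta_mx 0 i *m jacobian phi w) nu.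
  rewrite (chart_tangent cW Ogx) /= submxMl in tauO.
  have nE := fun v => (chart_normal cW v Ogx).2.
  have fA := chart_free cW Ogx.
  have AL : `|jacobian phi w| <= L by exact: LJ.
  move: (jacobian phi w) (jacobian (f \o phi) w) fA AL tauE tauO nE cA CA => A B fA AL tauE tauO nE cA CA.
  (* [b *m A] is the orthogonal projection of [eta] to the tangent space, written with the Gram
     matrix. *)
  pose eta := row i B; pose b := eta *m A^T *m invmx (A *m A^T).
  pose nu := eta - b *m A.
  have Gu := gram_unit fA.
  have bG : b *m (A *m A^T) = eta *m A^T by rewrite /b mulmxKV.
  have nuA : nu *m A^T = 0 by rewrite mulmxBl -mulmxA bG subrr.
  have nnu : enorm nu <= r * (n%:R * L).
    rewrite (le_trans (tauO nu isT _))//.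
      apply: tauE; split; first exact: nE.
      by rewrite -rowE -/eta /nu subKr submxMl.
    rewrite ler_pM ?opnorm_ge0 ?enorm_ge0// -rowE (le_trans (enorm_le_norm _))//.
    by rewrite ler_wpM2l// (le_trans (norm_row_mulmx _ _)).
  have bb : `|b| <= c * (C * r).
    rewrite (le_trans (cA b))// bG ler_wpM2l ?(ltW c0)// -row_mul.
    rewrite (le_trans (norm_row_mulmx _ _))// (le_trans CA)// ler_wpM2l// ltW//.
  have -> : row i B = b *m A + nu by rewrite /nu addrC subrK.
  rewrite (le_lt_trans (ler_normD _ _))//.
  have : `|b *m A| <= d%:R * (c * C) * L * r.
    rewrite (le_trans (norm_mulmx _ _))//.
    rewrite (@le_trans _ _ (d%:R * (c * (C * r)) * L))//; last by rewrite !mulrA mulrAC.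
    by rewrite ler_pM ?mulr_ge0// ler_wpM2l.
  have : `|nu| <= n%:R * L * r by rewrite (le_trans (norm_le_enorm _))// mulrC.
  move: rK; rewrite ltr_pdivlMr// /K mulrDr mulrDr mulr1.
  move: (d%:R * (c * C) * L) (n%:R * L) => X Y.
  nra.
have AB : ball (jacobian phi u) rho (jacobian phi w + jacobian (f \o phi) w).
  have Bn : `|jacobian (f \o phi) w| <= rho / 2.
    apply: norm_le_coord => [|i j]; first exact/ltW/divr_gt0.
    by apply: le_trans (ltW (rowB i)); have := coord_le_norm (row i (jacobian (f \o phi) w)) 0 j; rewrite mxE.
  move: A0A Bn; move: (jacobian phi u) (jacobian phi w) (jacobian (f \o phi) w) => A0 A B A0A Bn.
  by rewrite -ball_normE /= opprD addrA (le_lt_trans (ler_normB _ _))//; lra.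
have [fAB NAB] := rhoP _ AB.
have [P PE] := submx_plane fAB.
exists P; last exact: NAB.
have WFw : W' (x + f x) by have [] := nf x (conj Wx Vx).
have [Q QE] := tangent_plane sW' WFw.
have [M fM MQ] := plane_submx Q.
rewrite PE -QE MQ.
have ABM : ((jacobian phi w + jacobian (f \o phi) w)%R <= M)%MS.
  apply/row_subP => i; rewrite rowE.
  by have := tF (delta_mx 0 i); rewrite -QE MQ.
by apply/seteqP; split=> v /=; rewrite (row_free_submx_eq fAB fM ABM).
Unshelve. all: by end_near. Qed.

End Sheets.

Lemma nbhs_setX (X Y : topologicalType) (x : X) (y : Y) A B :
  nbhs x A -> nbhs y B -> nbhs (x, y) (A `*` B).
Proof. by move=> nA nB; exists (A, B). Qed.

(** * Subbasic neighbourhoods in the Fell topology *)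

Section FellTopology.
Variable X : topologicalType.

Lemma fell_open (S : set (CL X)) : fell_subbase S -> open S.
Proof.
move=> SS; exists [set S]; last by rewrite bigcup_set1.
by move=> _ ->; exact: (@finI_from1 _ _ (@fell_subbase X) id).
Qed.

Lemma fell_filter (A : CL X) (F : set_system (CL X)) : Filter F ->
  (forall S, fell_subbase S -> S A -> F S) -> nbhs A `<=` F.
Proof.
move=> FF FS B; rewrite nbhsE => -[_ [[D' sD' <-] [C D'C CA]] CB].
apply: filterS CB _; have [I Isub IC] := sD' _ D'C.
apply: (@filterS _ F FF C); first by move=> Z CZ; exists C.
rewrite -IC; apply: filter_bigI => S IS; apply: FS; first by have := Isub S IS; rewrite inE.
by move: CA; rewrite -IC; exact.
Qed.

End FellTopology.

(** * Compact thickenings *)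

Section CompactNeighbourhoods.
Context {R : realType} {n : nat}.
Local Notation E := 'rV[R]_n.

(** Provides room around [K]: membership in [ls] or [gs] relates normal vectors to [W'] only if they
    end in the given compact set, whereas a sheet needs a whole neighbourhood of such an end
    point. *)
Lemma compact_tube (K U : set E) : compact K -> open U -> K `<=` U ->
  \forall r \near (0 : R)^'+, compact [set y | exists2 x, K x & `|x - y| <= r] /\
    [set y | exists2 x, K x & `|x - y| <= r] `<=` U.
Proof.
move=> cK oU KU.
have cK' (r : R) : compact [set y | exists2 x, K x & `|x - y| <= r].
  have -> : [set y | exists2 x, K x & `|x - y| <= r] =
      (fun z : E * E => z.1 - z.2) @` (K `*` [set v | `|0 - v| <= r]).
    apply/seteqP; split=> [y [x Kx xy]|_ [[x v] /= [Kx vr] <-]].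
      by exists (x, x - y); rewrite /= ?subKr// sub0r normrN.
    by exists x => //; rewrite subKr -normrN -sub0r.
  apply: continuous_compact; last by apply: compact_setX => //; exact: closed_ball_compact.
  apply: continuous_in_subspaceT => z _.
  by apply: (@continuousB _ _ _ fst snd); [exact: cvg_fst|exact: cvg_snd].
have /compact_near_coveringP/(_ R (0^'+ : set_system R)) := cK.
move=> /(_ (fun r x => forall y, `|x - y| <= r -> U y) _) cov.
have : \forall r \near (0 : R)^'+, K `<=` fun x => forall y, `|x - y| <= r -> U y.
  apply: cov => x Kx.
  have /nbhs_ballP[e /= e0 eU] : nbhs x U by apply: open_nbhs_nbhs; split=> //; exact: KU.
  have e20 : 0 < e / 2 by rewrite divr_gt0.
  exists (ball x (e / 2), [set r | r < e / 2]) => /=.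
    by split; [exact: nbhsx_ballx|exact: nbhs_right_lt].
  move=> [x' r] /= [xx' re] y x'y; apply: eU; rewrite -ball_normE /=.
  move: xx'; rewrite -ball_normE /= => xx'.
  by have := ler_distD x' x y; lra.
apply: filterS => r rU; split=> // y [x Kx xy]; exact: rU xy.
Qed.

End CompactNeighbourhoods.

(** * A criterion for refining the differential Fell topology *)

Section DifferentialFell.
Context {R : realType} {n d : nat}.
Local Notation E := 'rV[R]_n.
Local Notation Gr := (@Gr R d n).
Variable U : set E.
Local Notation psi := (psi d U).
Local Notation gauss := (@gauss R n d U).

Lemma psi_sub (W : psi) : psi_set W `<=` U. Proof. by have [] := psiP W. Qed.

Lemma psi_submanifold (W : psi) : submanifold d (psi_set W).
Proof. by have [] := psiP W. Qed.
Arguments psi_submanifold W : clear implicits.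

Lemma psi_near_notin (W : psi) x : U x -> ~ psi_set W x ->
  exists2 e : R, 0 < e & forall y, `|x - y| < e -> ~ psi_set W y.
Proof.
move=> Ux nWx; have [WU cW _] := psiP W.
pose x' : set_type U := exist _ x (mem_set Ux).
have : nbhs x' (~` (set_val @^-1` psi_set W)).
  by apply: open_nbhs_nbhs; split; [exact: closed_openC|rewrite /= set_valE].
move=> /nbhs_set_type[B]; rewrite set_valE /= => /nbhs_ballP[e /= e0 eB] BW.
exists e => // y xy Wy.
apply: (BW (exist _ y (mem_set (WU _ Wy)))); rewrite /= ?set_valE//=.
by apply: eB; rewrite -ball_normE.
Qed.

Lemma dfell_hit (W : dfell d U) (O : set (set_type U * Gr)) : open O ->
  (gauss W `&` O !=set0) -> \forall W' \near W, gauss W' `&` O !=set0.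
Proof.
move=> oO WO.
have cg : {for W, continuous (gauss : dfell d U -> CL (set_type U * Gr)%type)} by exact: initial_continuous.
apply: (cg (fell_hit O)); apply: open_nbhs_nbhs; split=> //.
by apply: fell_open; left; exists O.
Qed.

Lemma dfell_miss (W : dfell d U) (K : set (set_type U * Gr)) : compact K ->
  gauss W `<=` ~` K -> \forall W' \near W, gauss W' `<=` ~` K.
Proof.
move=> cK WK.
have cg : {for W, continuous (gauss : dfell d U -> CL (set_type U * Gr)%type)} by exact: initial_continuous.
apply: (cg (fell_miss (~` K))); apply: open_nbhs_nbhs; split=> //.
by apply: fell_open; right; exists K.
Qed.

Lemma dfell_filter (W : dfell d U) (F : set_system psi) : Filter F ->
  (forall O, open O -> gauss W `&` O !=set0 ->
     \forall W' \near F, gauss W' `&` O !=set0) ->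
  (forall K, compact K -> gauss W `<=` ~` K -> \forall W' \near F, gauss W' `<=` ~` K) ->
  nbhs W `<=` F.
Proof.
move=> FF Fhit Fmiss A /nbhs_initial[B nB BA]; apply: filterS BA _.
suff : (gauss @ F) B by [].
move: B nB; apply: fell_filter => S [ [B oB <-] /= WB|[K cK <-] /= WK].
  exact: Fhit.
exact: Fmiss.
Qed.

Section SheetFilter.
Variables (W : psi) (F : set_system psi).
Context {FF : Filter F}.
Hypothesis Fhit : forall x eps, psi_set W x -> 0 < eps ->
  \forall W' \near F, exists y, sheet (d := d) W (psi_set W') eps x y.
Hypothesis Fcover : forall (K : set E) eps, compact K -> K `<=` U -> 0 < eps ->
  \forall W' \near F, forall y, psi_set W' y -> K y ->
    exists2 x, psi_set W x & sheet (d := d) W (psi_set W') eps x y.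

Lemma sheet_le (A A' : set E) e e' x y : e <= e' ->
  sheet (d := d) A A' e x y -> sheet (d := d) A A' e' x y.
Proof.
move=> ee' [V [f [oV Wx sf nf [se ->]]]]; exists V, f; split=> //; split=> //.
exact: lt_le_trans ee'.
Qed.

Lemma sheet_dist (A A' : set E) e x y : sheet (d := d) A A' e x y -> `|x - y| < e.
Proof.
move=> [V [f [oV Wx sf nf [se ->]]]]; rewrite opprD addNKr normrN.
apply: le_lt_trans se; apply: le_trans (norm_le_enorm _) _; exact: C1_size_ge.
Qed.

Lemma sheet_in (A A' : set E) e x y : sheet (d := d) A A' e x y -> A' y.
Proof. by move=> [V [f [oV Wx sf nf [se ->]]]]; have [] := nf x Wx. Qed.

(** [Fhit] settles the hit sets and [Fcover] the miss sets. For a missed compact [K] the size bound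
    must be uniform over its pairs [(y, P)], which follows by covering: at a single pair it comes
    from the distance to [W] if [y] is not in [W], and otherwise from separating [P] from the
    tangent plane at [y]. *)
Lemma sheets_nbhs : nbhs (W : dfell d U) `<=` F.
Proof.
apply: dfell_filter.
- move=> O oO [[x P] [[/= Wx PE] Oxp]].
  have : nbhs (x, P) O by exact: open_nbhs_nbhs.
  move=> [[N1 N2] /= [/nbhs_set_type[B xB BN1] N2P] NO].
  have /nbhs_ballP[e /= e0 eB] := xB.
  have := sheet_tangent (psi_submanifold W) Wx PE N2P.
  move=> core; have [r r0 [re rP]] : exists2 r : R, 0 < r & r <= e /\
      forall x0 W' y, psi_set W x0 -> `|set_val x - x0| < r -> submanifold d W' ->
      sheet (d := d) (psi_set W) W' r x0 y -> exists2 P, plane P = tangent d W' y & N2 P.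
    apply: near_right_ex; apply: filterI => //; exact: nbhs_right_le.
  apply: filterS (Fhit Wx r0) => W' [y sy].
  have [|P' P'E N2P'] := rP _ _ _ Wx _ (psi_submanifold W') sy.
    by rewrite subrr normr0.
  have W'y := sheet_in sy.
  exists (exist _ y (mem_set (psi_sub W'y)), P'); split.
    by split=> /=; rewrite set_valE.
  apply: NO; split=> //=; apply: BN1; rewrite /= set_valE /=; apply: eB.
  by rewrite -ball_normE /=; exact: lt_le_trans (sheet_dist sy) re.
- move=> K cK WK.
  pose K0 : set E := (fun q : set_type U * Gr => set_val q.1) @` K.
  have cK0 : compact K0.
    apply: continuous_compact => //; apply: continuous_in_subspaceT => q _.
    apply: (@continuous_comp _ _ _ fst (set_val : set_type U -> E)); first exact: cvg_fst.
    exact: set_val_continuous.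
  have K0U : K0 `<=` U by move=> _ [[x P] _ <-] /=; exact: set_valP.
  have /compact_near_coveringP/(_ R (0^'+ : set_system R)) := cK.
  move=> /(_ (fun eps q => forall (W' : psi) x, psi_set W x ->
    sheet (d := d) (psi_set W) (psi_set W') eps x (set_val q.1) ->
    plane q.2 = tangent d (psi_set W') (set_val q.1) -> False) _) cov.
  have [|eps eps0 epsP] := near_right_ex (cov _); last first.
    apply: filterS (Fcover cK0 K0U eps0) => W' W'P [y P] [/= W'y PE] Kq.
    have [|x Wx sx] := W'P (set_val y) W'y; first by exists (y, P).
    exact: epsP _ Kq W' x Wx sx PE.
  move=> [y P] Kq.
  have [Wy|nWy] := pselect (psi_set W (set_val y)); last first.
    have [e e0 eP] := psi_near_notin (set_valP y) nWy.
    have e20 : 0 < e / 2 by rewrite divr_gt0.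
    exists ((set_val @^-1` (ball (set_val y) (e / 2))) `*` setT, [set s | s < e / 2]).
      split; last exact: nbhs_right_lt.
      apply: nbhs_setX; last exact: filterT.
      by apply: set_val_continuous; exact: nbhsx_ballx.
    move=> [[y' P'] s] /= [[]]; rewrite -ball_normE /= => yy' _ se W' x Wx.
    move=> /sheet_dist xy' _; apply: (eP x) => //.
    by have := ler_distD (set_val y') (set_val y) x; rewrite (distrC (set_val y') x); lra.
  have [P0 P0E] := tangent_plane (psi_submanifold W) Wy.
  have PP0 : P <> P0 by move=> PP0; apply: (WK (y, P)) => //; split=> //=; rewrite PP0.
  have [N1 [N0 [nN1 nN0 N01]]] := Gr_separated PP0.
  have [r r0 rP] := near_right_ex (sheet_tangent (psi_submanifold W) Wy P0E nN0).
  have r20 : 0 < r / 2 by rewrite divr_gt0.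
  exists ((set_val @^-1` (ball (set_val y) (r / 2))) `*` N1, [set s | s < r / 2]).
    split; last exact: nbhs_right_lt.
    apply: nbhs_setX; last exact: nN1.
    by apply: set_val_continuous; exact: nbhsx_ballx.
  move=> [[y' P'] s] /= [[]]; rewrite -ball_normE /= => yy' N1P' se W' x Wx sx P'E.
  have xy' := sheet_dist sx.
  have yx : `|set_val y - x| < r.
    by have := ler_distD (set_val y') (set_val y) x; rewrite (distrC (set_val y') x); lra.
  have sx' : sheet (d := d) (psi_set W) (psi_set W') r x (set_val y').
    by apply: sheet_le sx; lra.
  have [Q QE N0Q] := rP x _ _ Wx yx (psi_submanifold W') sx'.
  have QP : Q = P' by apply: plane_inj; rewrite QE P'E.
  by apply: N01 N1P' _; rewrite -QP.
Qed.

End SheetFilter.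

End DifferentialFell.

(** * Sheets from membership in [ls] and [gs] *)

Section SheetsOfNeighbourhoods.
Context {R : realType} {n d : nat}.
Local Notation E := 'rV[R]_n.
Variable U : set E.
Local Notation psi := (psi d U).

Lemma smooth_on_sub (E1 E2 : normedModType R) (A A' : set E1) (f : E1 -> E2) :
  A' `<=` A -> smooth_on A f -> smooth_on A' f.
Proof.
move=> A'A sf x A'x; have [V [F [oV Vx sF FE]]] := sf x (A'A x A'x).
by exists V, F; split=> // y /A'A; exact: FE.
Qed.

(** Away from [x] the points [z + f z] may leave [N], outside which nothing is known about [W'], so
    [V] is shrunk to the points that end in [N]. As [f] is smooth only on [W], an ambient extension
    [F] is used to obtain an open set. The size is assumed for all smaller [V1] because the
    resulting one is not known beforehand. *)
Lemma sheet_of_section (W W' V N : set E) (f : E -> E) x eps :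
  open V -> (W `&` V) x -> smooth_on (W `&` V) f ->
  (forall z, (W `&` V) z -> normal d W z (f z)) ->
  open N -> (forall z, (W `&` V) z -> N (z + f z) -> W' (z + f z)) -> N (x + f x) ->
  (forall V1, open V1 -> V1 `<=` V -> V1 x -> C1_size d W (W `&` V1) f x < eps) ->
  sheet (d := d) W W' eps x (x + f x).
Proof.
move=> oV WVx sf nf oN fN Nx sz.
have [V' [F [oV' V'x sF FE]]] := sf x WVx.
pose V1 := (V `&` V') `&` (fun z => z + F z) @^-1` N.
have oV1 : open V1.
  apply: open_setI_preimage => //; first exact: openI.
  by move=> z [_ V'z]; apply: continuousD => //; exact: (sF 0%N).
have V1V : V1 `<=` V by move=> z [[]].
have V1x : V1 x by case: (WVx) => Wx Vx; split=> //; rewrite /= FE.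
have WV1 : W `&` V1 `<=` W `&` V by move=> z [Wz /V1V].
exists V1, f; split=> //.
- by case: WVx.
- exact: smooth_on_sub sf.
- move=> z WV1z; have WVz := WV1 z WV1z; split; first exact: nf.
  by apply: fN => //; case: WV1z => _ [[_ V'z]] /=; rewrite FE.
- by split=> //; exact: sz.
Qed.

Lemma subset_setI_eq (T : Type) (A B K K' : set T) :
  K' `<=` K -> A `&` K = B `&` K -> A `&` K' = B `&` K'.
Proof.
move=> K'K AB; apply/seteqP; split=> x [Ax K'x]; split=> //.
  have : (A `&` K) x by split=> //; exact: K'K.
  by rewrite AB => -[].
have : (B `&` K) x by split=> //; exact: K'K.
by rewrite -AB => -[].
Qed.

Lemma ls_mono (W : psi) D (K K' : set E) eps eps' : K' `<=` K -> eps <= eps' ->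
  ls W D K eps `<=` ls W D K' eps'.
Proof.
move=> K'K ee' W' [Q [QD WQ lQ QW' sQ]]; exists Q; split=> //.
- by move=> x [Wx /K'K Kx]; exact: WQ.
- exact: subset_setI_eq QW'.
- by move=> V f oV sf fQ x WVx; apply: lt_le_trans ee'; exact: sQ.
Qed.

Lemma gs_mono (W : psi) D (K K' : set E) eps eps' : K' `<=` K -> eps <= eps' ->
  gs W D K eps `<=` gs W D K' eps'.
Proof.
move=> K'K ee' W' [f [nf fD fW' sf]]; exists f; split=> //.
- exact: subset_setI_eq fW'.
- by move=> x Wx [W'x /K'K Kx]; apply: lt_le_trans ee'; exact: sf.
Qed.

Lemma filter_compact_eps (T : Type) (B : set E -> R -> set T) :
  (forall K K' eps eps', K' `<=` K -> eps <= eps' -> B K eps `<=` B K' eps') ->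
  Filter (filter_from (compact_eps U) (fun p => B p.1 p.2)).
Proof.
move=> Bmono; apply: filter_from_filter.
  by exists (set0, 1); split=> //=; exact: compact0.
move=> [K e] [K' e'] [/= cK KU e0] [/= cK' K'U e'0].
exists (K `|` K', Num.min e e'); first split=> /=.
- exact: compactU.
- by move=> x [/KU|/K'U].
- by rewrite lt_min e0.
- by move=> x Bx; split; apply: Bmono Bx => //=; rewrite ge_min lexx ?orbT.
Qed.

Variable D : psi -> set (E * E).
Hypothesis oU : open U.
Hypothesis eD : forall W : psi, exp_domain d U W (D W).

Global Instance ls_nbhs_filter (W : psi) : Filter (ls_nbhs D W).
Proof. by apply: filter_compact_eps => *; exact: ls_mono. Qed.

Global Instance gs_nbhs_filter (W : psi) : Filter (gs_nbhs D W).
Proof. by apply: filter_compact_eps => *; exact: gs_mono. Qed.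

Lemma domain_normal (W : psi) z : D W z -> normal_bundle d W z.
Proof. by have [DN _ _ _] := eD W; exact: DN. Qed.

Lemma local_diffeo_section (W : set E) (Q : set (E * E)) z :
  local_diffeo Q W fst -> Q z ->
  exists V f, [/\ open V, (W `&` V) z.1, smooth_on (W `&` V) f,
    forall x, (W `&` V) x -> Q (x, f x) & f z.1 = z.2].
Proof.
move=> lQ Qz.
have [B [V [g [oB Bz oV [_ sg fstg gfst]]]]] := lQ z Qz.
have [WVz1 gz] := fstg z (conj Qz Bz).
exists V, (snd \o g); split=> //=.
- move=> x /sg[V' [G [oV' V'x sG GE]]]; exists V', (snd \o G); split=> //.
    have ls : linear (snd : E * E -> E) by move=> a [u1 u2] [v1 v2].
    pose L : {linear (E * E)%type -> E} :=
      HB.pack (snd : E * E -> E) (GRing.isLinear.Build _ _ _ _ _ ls).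
    move=> k; apply: (Ck_lin (L := L)) (sG k) => // y.
    exact: cvg_snd.
  by move=> y WVy V'y; rewrite /= GE.
- by move=> x /gfst[[Qg _] gx]; rewrite -[x in (x, _)]gx -surjective_pairing.
- by rewrite gz.
Qed.

Lemma ls_sheet (W W' : psi) (K N : set E) (Q : set (E * E)) eps z :
  open N -> N `<=` K -> Q `<=` D W -> local_diffeo Q W fst ->
  [set expW z | z in Q] `&` K = psi_set W' `&` K ->
  (forall (V : set E) (f : E -> E), open V -> smooth_on (psi_set W `&` V) f ->
    (forall x, (psi_set W `&` V) x -> Q (x, f x)) ->
    forall x, (psi_set W `&` V) x -> C1_size d W (psi_set W `&` V) f x < eps) ->
  Q z -> `|z.2| < eps /\ (N (z.1 + z.2) ->
  sheet (d := d) (psi_set W) (psi_set W') eps z.1 (z.1 + z.2)).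
Proof.
move=> oN NK QD lQ QW' sQ Qz.
have [V [f [oV WVz sf fQ fz]]] := local_diffeo_section lQ Qz.
split.
  rewrite -fz (le_lt_trans (norm_le_enorm _))// (le_lt_trans _ (sQ V f oV sf fQ _ WVz))//.
  exact: C1_size_ge.
move=> Nz; rewrite -fz; apply: (@sheet_of_section _ _ V N) => //=.
- by move=> x /fQ/QD/domain_normal[].
- move=> x /fQ Qx Nx.
  have : ([set expW z | z in Q] `&` K) (x + f x).
    by split; [exists (x, f x)|exact: NK].
  by rewrite QW' => -[].
- by rewrite fz.
- move=> V1 oV1 V1V V1z; apply: (sQ V1 f) => //.
  + by apply: smooth_on_sub sf => x [Wx /V1V].
  + by move=> x [Wx /V1V Vx]; exact: fQ.
  + by case: WVz.
Qed.

Lemma ls_nbhs_sheets (W : psi) : nbhs (W : dfell d U) `<=` ls_nbhs D W.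
Proof.
apply: sheets_nbhs.
- move=> x eps Wx eps0; have Ux := psi_sub Wx.
  have /nbhs_ballP[e /= e0 eU] : nbhs x U by exact: open_nbhs_nbhs.
  have e20 : 0 < e / 2 by rewrite divr_gt0.
  (* The bound [e / 2] on the size keeps the end point of the vector of [Q] over [x] in the open
     ball, where it is known to belong to [W']. *)
  exists ([set y | `|x - y| <= e / 2], Num.min eps (e / 2)) => /=.
    split=> /=; first exact: closed_ball_compact.
      by move=> y xy; apply: eU; rewrite -ball_normE /= (le_lt_trans xy)//; lra.
    by rewrite lt_min eps0.
  move=> W' [Q [QD WQ lQ QW' sQ]].
  have [|z Qz zx] := WQ x; first by split=> //=; rewrite subrr normr0 ltW.
  have NK : ball x (e / 2) `<=` [set y | `|x - y| <= e / 2].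
    by move=> y; rewrite -ball_normE /= => /ltW.
  have [z2 sz] := ls_sheet (ball_open _ _) NK QD lQ QW' sQ Qz.
  exists (z.1 + z.2); rewrite -{1}zx; apply: (sheet_le _ (sz _)).
    by rewrite ge_min lexx.
  rewrite -ball_normE /= -zx opprD addNKr normrN.
  by move: z2; rewrite lt_min => /andP[].
- move=> K eps cK KU eps0.
  have [r r0 [cKr KrU]] := near_right_ex (compact_tube cK oU KU).
  exists ([set y | exists2 x, K x & `|x - y| <= r], eps) => //.
  move=> W' [Q [QD WQ lQ QW' sQ]] y W'y Ky.
  have : (psi_set W' `&` [set y | exists2 x, K x & `|x - y| <= r]) y.
    by split=> //; exists y; rewrite // subrr normr0 ltW.
  rewrite -QW' => -[[z Qz zy] _].
  exists z.1; first by have [] := domain_normal (QD _ Qz).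
  have [_ sz] := ls_sheet (open_interior _) (@interior_subset _ _) QD lQ QW' sQ Qz.
  rewrite -zy; apply: sz; rewrite -/(expW z) zy; apply/nbhs_ballP; exists r => //= y'.
  by rewrite -ball_normE /= => yy'; exists y => //; exact: ltW.
Qed.

(** In [gs] the size of [f] at [x] is bounded only if [x + f x] lies in [K], so [K] cannot be chosen
    from the size bound as for [ls]. Thinness of the domain breaks the circle: a compact [C]
    depending on [x] alone contains all possible end points. *)
Lemma gs_nbhs_sheets (W : psi) : nbhs (W : dfell d U) `<=` gs_nbhs D W.
Proof.
have gsheet (W' : psi) (K N : set E) eps f x : open N -> N `<=` K ->
    normal_section d W W f ->
    [set expW (x, f x) | x in psi_set W] `&` K = psi_set W' `&` K ->
    (forall x, psi_set W x -> (psi_set W' `&` K) (expW (x, f x)) ->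
          C1_size d W W f x < eps) ->
    psi_set W x -> N (x + f x) -> sheet (d := d) (psi_set W) (psi_set W') eps x (x + f x).
  move=> oN NK [sf nf] fW' szf Wx Nx.
  have W'N z : psi_set W z -> N (z + f z) -> (psi_set W' `&` K) (z + f z).
    move=> Wz Nz; rewrite -fW'; split; last exact: NK.
    by exists z.
  apply: (@sheet_of_section _ _ setT N) => //.
  - exact: openT.
  - by rewrite setIT.
  - by move=> z [Wz _]; exact: nf.
  - by move=> z [Wz _] Nz; have [] := W'N z Wz Nz.
  - move=> V1 oV1 _ V1x; rewrite (C1_size_restrict (h := f))//.
    by apply: szf => //; exact: W'N.
apply: sheets_nbhs.
- move=> x eps Wx eps0.
  have [_ _ _ /(_ x Wx)[C [cC CU DC]]] := eD W.
  have [r r0 [cKr KrU]] := near_right_ex (compact_tube cC oU CU).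
  exists ([set y | exists2 x, C x & `|x - y| <= r], eps) => //.
  move=> W' [f [nf fD fW' szf]]; exists (x + f x).
  apply: (gsheet _ _ _ _ _ _ (open_interior _) (@interior_subset _ _) nf fW' szf Wx).
  have Cx : C (x + f x) by exact: DC (fD x Wx).
  apply/nbhs_ballP; exists r => //= y'.
  by rewrite -ball_normE /= => yy'; exists (x + f x) => //; exact: ltW.
- move=> K eps cK KU eps0.
  have [r r0 [cKr KrU]] := near_right_ex (compact_tube cK oU KU).
  exists ([set y | exists2 x, K x & `|x - y| <= r], eps) => //.
  move=> W' [f [nf fD fW' szf]] y W'y Ky.
  have : (psi_set W' `&` [set y | exists2 x, K x & `|x - y| <= r]) y.
    by split=> //; exists y; rewrite // subrr normr0 ltW.
  rewrite -fW' => -[[x Wx xy] _]; exists x => //.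
  rewrite -xy; apply: (gsheet _ _ _ _ _ _ (open_interior _) (@interior_subset _ _) nf fW' szf Wx).
  rewrite -/(expW (x, f x)) xy; apply/nbhs_ballP; exists r => //= y'.
  by rewrite -ball_normE /= => yy'; exists y => //; exact: ltW.
Qed.

End SheetsOfNeighbourhoods.

Arguments psi_submanifold {R n d U} W.

(** * Secants and critical points *)

Section LocalGeometry.
Context {R : realType} {n d : nat}.
Local Notation E := 'rV[R]_n.
Local Notation Gr := (@Gr R d n).

Lemma norm_trmx m p (A : 'M[R]_(m, p)) : `|A^T| <= `|A|.
Proof. by apply: norm_le_coord => // i j; rewrite mxE coord_le_norm. Qed.

Lemma pos_bound (x : R) : exists2 c : R, 0 < c & x <= c.
Proof. by exists (`|x| + 1); rewrite ?ltr_wpDl// (le_trans (ler_norm _))// lerDl. Qed.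

Lemma half_bound (X c : R) : 0 <= X -> 0 < c -> X * (c / (2 * (X + 1))) <= c / 2.
Proof.
move=> X0 c0; have X1 : 0 < X + 1 by rewrite ltr_wpDl.
rewrite mulrA ler_pdivrMr ?mulr_gt0//.
have -> : c / 2 * (2 * (X + 1)) = c * (X + 1) by field.
by rewrite mulrC ler_wpM2l ?(ltW c0)// lerDl.
Qed.

(** Near [x0] a secant of [W] is almost tangent, so its products with a tangent frame at [x0]
    control its length. In [normal_meets] this locates a minimizer of the tangential component. *)
Lemma chart_secant (W : set E) O V0 (phi : 'rV[R]_d -> E) g x0 :
  chart W O V0 phi g -> W x0 -> V0 x0 ->
  exists2 C : R, 0 < C & \forall r \near 0^'+, forall x x', W x -> W x' ->
    `|x0 - x| < r -> `|x0 - x'| < r ->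
    `|x' - x| <= C * `|(x' - x) *m (jacobian phi (g x0))^T|.
Proof.
move=> cW Wx0 V0x0; have [oO oV0 sphi sg [phig gphi]] := cW.
have [Ou phiu] := gphi x0 Wx0 V0x0.
have [c c0 /nbhs_singleton cP] := gram_lower_bound (chart_free cW Ou).
have sd e e0 := @strict_differentiable R _ _ O phi (g x0) e oO Ou (sphi 1%N) e0.
have nearW := @chart_near _ _ _ _ _ _ _ _ cW x0 _ Wx0 V0x0.
move: (g x0) (jacobian phi (g x0)) Ou phiu cP sd nearW => u A Ou phiu cP sd nearW.
have [L L0 LA] := pos_bound (`|A^T|).
have [L' L'0 LA'] := pos_bound (`|A|).
have [N N0 nN] := pos_bound n%:R.
have [N' N'0 dN] := pos_bound d%:R.
(* With this [e] the deviation of the secant from [D *m A] costs half of [|D|], which is moved to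
   the left-hand side. *)
pose e := (2 * c * N * L)^-1.
have e0 : 0 < e by rewrite invr_gt0 !mulr_gt0.
have [s s0 sP] := near_right_ex (sd e e0).
have /nbhs_ballP[r0 /= r00 r0P] := nearW _ (nbhsx_ballx u _ s0).
exists ((N' * L' + e) * (2 * c)); first by rewrite mulr_gt0 ?addr_gt0 ?mulr_gt0.
near=> r => x x' Wx Wx' xr x'r.
have rr0 : r <= r0 by near: r; exact: nbhs_right_le.
have [|V0x _ pgx gxs] := r0P x _ Wx; first by rewrite -ball_normE /=; exact: lt_le_trans rr0.
have [|V0x' _ pgx' gxs'] := r0P x' _ Wx'; first by rewrite -ball_normE /=; exact: lt_le_trans rr0.
have := sP _ _ gxs' gxs; rewrite pgx pgx'.
move: (g x' - g x) => D DA.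
have D1 : `|D| <= c * (`|(x' - x) *m A^T| + N * (e * `|D|) * L).
  rewrite (le_trans (cP D))// ler_wpM2l ?(ltW c0)//.
  have -> : D *m (A *m A^T) = (x' - x) *m A^T - (x' - x - D *m A) *m A^T.
    by rewrite [(x' - x - _) *m _]mulmxBl subKr mulmxA.
  rewrite (le_trans (ler_normB _ _))// lerD2l (le_trans (norm_mulmx _ _))//.
  by rewrite ler_pM ?mulr_ge0// ler_pM.
have {}D1 : `|D| <= 2 * c * `|(x' - x) *m A^T|.
  move: D1; have -> : c * (`|(x' - x) *m A^T| + N * (e * `|D|) * L) =
      c * `|(x' - x) *m A^T| + 2^-1 * `|D|.
    by rewrite /e; field; rewrite !gt_eqF.
  lra.
have : `|x' - x| <= (N' * L' + e) * `|D|.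
  rewrite -[x' - x](subrK (D *m A)) (le_trans (ler_normD _ _))// mulrDl addrC lerD//.
  by rewrite (le_trans (norm_mulmx _ _))// mulrAC ler_wpM2r// ler_pM.
move=> /le_trans; apply; rewrite -[leRHS]mulrA ler_wpM2l// addr_ge0 ?(ltW e0)//.
by rewrite mulr_ge0// ltW.
Unshelve. all: by end_near. Qed.

Lemma Ck_tr (E1 : normedModType R) k m p (V : set E1) (f : E1 -> 'M[R]_(m, p)) :
  open V -> Ck k V f -> Ck k V (fun x => (f x)^T).
Proof.
move=> oV /Ck_mxP cf; apply/Ck_mxP => // i j.
by rewrite (_ : (fun x => _) = fun x => f x j i); [exact: cf|apply/funext => x; rewrite mxE].
Qed.

Lemma derive_tr (E1 : normedModType R) m p (f : E1 -> 'M[R]_(m, p)) x v :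
  differentiable f x -> differentiable (fun y => (f y)^T) x ->
  'D_v (fun y => (f y)^T) x = ('D_v f x)^T.
Proof.
move=> df dft; apply/matrixP => i j; rewrite [RHS]mxE (derive_coord _ _ _ df).
rewrite (derive_coord _ _ _ dft); congr ('D_v _ x).
by apply/funext => y; rewrite mxE.
Qed.

(** Fermat's condition for the squared length of [f], whose derivative is twice this product. It is
    applied to [y - phi] for nearest points and to the tangential component of [psi - x] in
    [normal_meets]. *)
Lemma critical_dot (E1 : normedModType R) p (V : set E1) (f : E1 -> 'rV[R]_p) x v :
  open V -> V x -> Ck 1 V f ->
  (forall y, V y -> enorm (f x) <= enorm (f y)) -> dot ('D_v f x) (f x) = 0.
Proof.
move=> oV Vx cf fmin; have cft := Ck_tr oV cf.
have [/(_ x Vx) df _] := cf; have [/(_ x Vx) dft _] := cft.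
pose q y := (f y *m (f y)^T) 0 0.
have cq : Ck 1 V q by have := Ck_mulmx oV cf cft => /Ck_mxP; exact.
have [dq _] := cq.
have qE y : q y = enorm (f y) ^+ 2 by rewrite enorm_sqr dotE.
have := diff_min v oV Vx dq.
have qmin y : V y -> q x <= q y.
  by move=> Vy; rewrite !qE lerXn2r ?nnegrE ?enorm_ge0//; exact: fmin.
move=> /(_ qmin); rewrite -deriveE; last exact: dq.
have [/(_ x Vx) dff _] := Ck_mulmx oV cf cft.
rewrite -(derive_coord _ _ _ dff) (derive_mulmx _ oV Vx cf cft) derive_tr//.
rewrite mxE -!dotE dotC => /eqP; rewrite -mulr2n mulrn_eq0 /= => /eqP.
by [].
Qed.

End LocalGeometry.

(** * Distances and angles to Fell-close submanifolds *)

Section FellNeighbourhoods.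
Context {R : realType} {n d : nat}.
Local Notation E := 'rV[R]_n.
Local Notation Gr := (@Gr R d n).
Variable U : set E.
Hypothesis oU : open U.
Local Notation psi := (psi d U).
Local Notation dfell := (dfell d U).

Lemma psi_compact (W : psi) (K : set E) :
  compact K -> K `<=` U -> compact (psi_set W `&` K).
Proof.
move=> cK KU F FF FWK; have FK : F K by apply: filterS FWK => x [].
have [x [Kx clx]] := cK F FF FK; exists x; split=> //; split=> //.
apply: contrapT => nWx; have [e e0 eP] := psi_near_notin (KU _ Kx) nWx.
have [y [[Wy _]]] := clx _ _ FWK (nbhsx_ballx x _ e0).
by rewrite -ball_normE /= => /eP.
Qed.

(** The points of [K] at distance at least [e] from [W], paired with all planes, form a compact set
    because the Grassmannian is compact. [W] misses it, hence so does every nearby [W']. *)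
Lemma dfell_close (W : dfell) (K : set E) e : compact K -> K `<=` U -> 0 < e ->
  \forall W' \near W, forall y, psi_set W' y -> K y ->
    exists2 x, psi_set W x & `|y - x| < e.
Proof.
move=> cK KU e0.
pose C := K `&` [set y | forall x, psi_set W x -> e <= `|x - y|].
have cC : compact C.
  apply: compact_closedI => //.
  have -> : [set y | forall x, psi_set W x -> e <= `|x - y|] =
      \bigcap_(x in psi_set W) [set y | e <= `|x - y|].
    by apply/seteqP; split=> y.
  apply: closed_bigI => x _.
  rewrite (_ : mkset _ = ~` [set y | `|x - y| < e]); last first.
    by apply/seteqP; split=> y /=; rewrite leNgt => /negP.
  exact/open_closedC/open_sublevel/distr_continuous.
have CU : C `<=` U by move=> y [/KU].
have := @dfell_miss _ _ _ _ W _ (compact_setX (compact_set_type CU cC) (@Gr_compact R d n)).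
have WC : gauss W `<=` ~` (set_val @^-1` C `*` [set: Gr]).
  move=> [y P] [/= Wy _] [[_ /(_ _ Wy)]]; rewrite subrr normr0 => e0' _.
  by have := lt_le_trans e0 e0'; rewrite ltxx.
move=> /(_ WC); apply: filterS => W' W'C y W'y Ky.
apply: contrapT => nx.
have [P PE] := tangent_plane (psi_submanifold W') W'y.
apply: (W'C (exist _ y (mem_set (psi_sub W'y)), P)).
  by split=> //=; rewrite set_valE.
split=> //=; rewrite set_valE /=; split=> // x Wx; rewrite leNgt; apply/negP => xy.
by apply: nx; exists x; rewrite // distrC.
Qed.

(** The planes far from the tangent plane at [x0] form a compact set [B]. The Gauss set of [W] is
    closed, so it misses [B] over a small closed ball around [x0], and Fell closeness passes this on
    to [W']. Tangent vectors of [W'] near [x0] thus lie almost in the tangent space of [W], nearly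
    orthogonal to its normal vectors. *)
Lemma angle_near (W : dfell) x0 (c : R) : psi_set W x0 -> 0 < c ->
  exists2 r : R, 0 < r & \forall W' \near W, forall x y zeta nu,
    psi_set W x -> `|x0 - x| < r -> psi_set W' y -> `|x0 - y| < r ->
    tangent d (psi_set W') y zeta -> normal d (psi_set W) x nu ->
    `|dot zeta nu| <= c * `|zeta| * `|nu|.
Proof.
move=> Wx0 c0; have sW := psi_submanifold W.
have [ O [V0 [phi [g [cW V0x0]]]]] := chart_exists sW Wx0.
have [oO oV0 sphi sg [phig gphi]] := cW; have [Ou phiu] := gphi x0 Wx0 V0x0.
have tanE := chart_tangent cW Ou; rewrite phiu in tanE.
have cJ := chart_jacobian_continuous cW Ou.
have /row_freeP[Gam AG] := chart_free cW Ou.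
pose c1 := c / (2 * (n%:R * n%:R * d%:R + 1)).
have c10 : 0 < c1 by rewrite divr_gt0// mulr_gt0// ltr_wpDl// !mulr_ge0.
have [L L0 LG] := pos_bound (`|Gam|).
pose c2 := c / (2 * (d%:R * n%:R * d%:R * n%:R * L * n%:R + 1)).
have c20 : 0 < c2 by rewrite divr_gt0// mulr_gt0// ltr_wpDl// !mulr_ge0// ltW.
have nearJ : \forall w \near g x0, `|jacobian phi (g x0) - jacobian phi w| < c2.
  by apply: (@cvgr_dist_lt _ _ _ (nbhs (g x0))).
have /nbhs_ballP[r1 /= r10 r1P] := chart_near cW Wx0 V0x0 nearJ.
have chN x v := chart_normal (w := x) cW v.
move: (g x0) (jacobian phi (g x0)) Ou phiu tanE AG r1P {cJ nearJ} => u A0 Ou phiu tanE AG r1P.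
(* As [Gam] is a right inverse of [A0], [Gam *m A0] projects row vectors onto the tangent space at
   [x0]. For an orthonormal frame [M], the norm of [M *m Del] then measures how far its plane is
   from that space. *)
pose Del : 'M[R]_n := 1%:M - Gam *m A0.
have ADel : A0 *m Del = 0 by rewrite mulmxBr mulmx1 mulmxA AG mul1mx subrr.
have MDel (M : 'M[R]_(d, n)) : M = M *m Del + M *m Gam *m A0.
  by rewrite mulmxBr mulmx1 mulmxA subrK.
move: Del ADel MDel => Del ADel MDel.
pose C := [set M : 'M[R]_(d, n) | c1 <= `|M *m Del|].
have clC : closed C.
  rewrite (_ : C = ~` [set M : 'M[R]_(d, n) | `|M *m Del| < c1]); last first.
    by apply/seteqP; split=> M; rewrite /C /= leNgt => /negP.
  apply/open_closedC/open_sublevel => M.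
  apply: (@continuous_comp _ _ _ (fun M : 'M[R]_(d, n) => M *m Del)
    (fun M : 'M[R]_(d, n) => `|M|)); last exact: norm_continuous.
  exact: mulmxr_continuous.
have cB := plane_set_compact clC.
set B := mkset _ in cB.
have /nbhs_ballP[e /= e0 eU] : nbhs x0 U.
  by apply: open_nbhs_nbhs; split=> //; exact: psi_sub Wx0.
have /compact_near_coveringP/(_ R (0^'+ : set_system R)) := cB.
move=> /(_ (fun r P => forall y, `|x0 - y| <= r -> psi_set W y ->
  plane P = tangent d (psi_set W) y -> False) _) cov.
have [r r0 [re rP]] : exists2 r : R, 0 < r & r < e /\ (forall P, B P ->
    forall y, `|x0 - y| <= r -> psi_set W y -> plane P = tangent d (psi_set W) y -> False).
  apply: near_right_ex; apply: filterI; first exact: nbhs_right_lt.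
  apply: cov => P [M [MM CM PM]].
  pose x0' : set_type U := exist _ x0 (mem_set (psi_sub Wx0)).
  have : nbhs (x0', P) (~` gauss W).
    apply: open_nbhs_nbhs; split; first exact/closed_openC/gauss_closed/psiP.
    move=> [/= _]; rewrite -/(plane P) PM set_valE /= tanE => /rowspace_eqmx MA0.
    have /submxP[a Ma] : (M <= A0)%MS by rewrite MA0.
    by move: CM; rewrite /C /= Ma -mulmxA ADel mulmx0 normr0 leNgt c10.
  move=> [[N1 N2] /= [/nbhs_set_type[N xN NN1] N2P] NW].
  move: xN; rewrite set_valE /= => /nbhs_ballP[s /= s0 sN].
  exists (N2, [set t | t < s]); first by split=> //=; exact: nbhs_right_lt.
  move=> [P' t] /= [N2P' ts] y xy Wy P'E.
  apply: (NW (exist _ y (mem_set (psi_sub Wy)), P')).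
    split=> //=; apply: NN1; rewrite /= set_valE /=; apply: sN.
    by rewrite -ball_normE /=; exact: le_lt_trans ts.
  by split=> //=; rewrite set_valE.
pose K := set_val @^-1` [set y | `|x0 - y| <= r] `*` B : set (set_type U * Gr).
have cK : compact K.
  apply: compact_setX => //; apply: compact_set_type; last exact: closed_ball_compact.
  by move=> y xy; apply: eU; rewrite -ball_normE /=; exact: le_lt_trans re.
have WK : gauss W `<=` ~` K by move=> [y P] [/= Wy PE] [/= xy BP]; exact: rP xy Wy PE.
exists (Num.min r r1); first by rewrite lt_min r0.
apply: filterS (dfell_miss cK WK) => W' W'K x y zeta nu Wx; rewrite !lt_min.
move=> /andP[xr xr1] W'y /andP[yr _] tzeta nnu.
have [|V0x Ogx pgx Ac2] := r1P x _ Wx; first by rewrite -ball_normE.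
have {nnu} nuA : nu *m (jacobian phi (g x))^T = 0 by apply/(chN _ _ Ogx); rewrite pgx.
move: (jacobian phi (g x)) Ac2 nuA => A Ac2 nuA.
have [P PE] := tangent_plane (psi_submanifold W') W'y.
have [M MM PM] := plane_orthonormal P.
have Mc1 : `|M *m Del| < c1.
  rewrite ltNge; apply/negP => CM.
  apply: (W'K (exist _ y (mem_set (psi_sub W'y)), P)).
    by split=> //=; rewrite set_valE.
  by split=> /=; [rewrite set_valE /= ltW|exists M].
have /submxP[a za] : (zeta <= M)%MS.
  by have : plane P zeta by [rewrite PE]; rewrite PM.
have M1 := orthonormal_norm_le1 MM.
have a1 : `|a| <= n%:R * `|zeta|.
  have -> : a = zeta *m M^T by rewrite za -mulmxA MM mulmx1.
  rewrite (le_trans (norm_mulmx _ _))// ler_piMr ?mulr_ge0//.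
  exact: le_trans (norm_trmx _) M1.
(* Two errors: [M *m Del], below [c1], compares the plane of [W'] with the tangent space at [x0];
   [A0 - A], below [c2], compares the tangent frames of [W] at [x0] and at [x]. *)
have nuM : nu *m M^T = nu *m (M *m Del)^T + nu *m (A0 - A)^T *m (M *m Gam)^T.
  have -> : nu *m (A0 - A)^T = nu *m A0^T by rewrite linearB /= mulmxBr nuA subr0.
  rewrite [in LHS](MDel M) linearD /= mulmxDr; congr (_ + _).
  by rewrite trmx_mul mulmxA.
have nuM1 : `|nu *m M^T| <= (n%:R * c1 + d%:R * (n%:R * c2) * (n%:R * L)) * `|nu|.
  rewrite nuM (le_trans (ler_normD _ _))// mulrDl lerD//.
    rewrite (le_trans (norm_mulmx _ _))// mulrAC ler_wpM2r// ler_wpM2l//.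
    exact: le_trans (norm_trmx _) (ltW Mc1).
  rewrite (le_trans (norm_mulmx _ _))//.
  rewrite (@le_trans _ _ (d%:R * (n%:R * `|nu| * c2) * (n%:R * L)))//; last first.
    by rewrite le_eqVlt; apply/orP; left; apply/eqP; ring.
  apply: ler_pM; rewrite ?mulr_ge0//.
    rewrite ler_wpM2l// (le_trans (norm_mulmx _ _))// ler_wpM2l ?mulr_ge0//.
    exact: le_trans (norm_trmx _) (ltW Ac2).
  rewrite (le_trans (norm_trmx _))// (le_trans (norm_mulmx _ _))//.
  by rewrite ler_pM ?mulr_ge0// ler_piMr.
rewrite za dot_mulmx -za (le_trans (coord_le_norm _ _ _))// (le_trans (norm_mulmx _ _))//.
rewrite (@le_trans _ _ (d%:R * (n%:R * `|zeta|) *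
    ((n%:R * c1 + d%:R * (n%:R * c2) * (n%:R * L)) * `|nu|)))//.
  apply: ler_pM; rewrite ?mulr_ge0// ?ler_wpM2l//.
  exact: le_trans (norm_trmx _) nuM1.
have -> : d%:R * (n%:R * `|zeta|) *
    ((n%:R * c1 + d%:R * (n%:R * c2) * (n%:R * L)) * `|nu|) =
  (n%:R * n%:R * d%:R * c1 + d%:R * n%:R * d%:R * n%:R * L * n%:R * c2) * (`|zeta| * `|nu|).
  by ring.
rewrite -[leRHS]mulrA ler_wpM2r ?mulr_ge0//.
rewrite (splitr c) lerD// half_bound// !mulr_ge0//.
exact: ltW.
Qed.

End FellNeighbourhoods.

(** * Normal vectors of [W] that end on [W'] *)

Section NormalDirections.
Context {R : realType} {n d : nat}.
Local Notation E := 'rV[R]_n.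
Variable U : set E.
Hypothesis oU : open U.
Local Notation dfell := (dfell d U).

Lemma Ck_id (E1 : normedModType R) k (V : set E1) : Ck k V (@id E1).
Proof. by apply: (@Ck_linear R E1 E1 k V idfun) => x; exact: cvg_id. Qed.

Lemma Ck_subr (E1 E2 : normedModType R) k (V : set E1) (f : E1 -> E2) x :
  open V -> Ck k V f -> Ck k V (fun y => f y - x).
Proof. by move=> oV cf; exact: (CkD oV cf (@Ck_cst _ _ _ k V (- x))). Qed.

Lemma Ck_rsub (E1 E2 : normedModType R) k (V : set E1) (f : E1 -> E2) x :
  open V -> Ck k V f -> Ck k V (fun y => x - f y).
Proof.
move=> oV cf; have cN : continuous (-%R : E2 -> E2) by move=> z; exact: opp_continuous.
exact: (CkD oV (@Ck_cst _ _ _ k V x) (Ck_lin (L := -%R : {linear E2 -> E2}) oV cN cf)).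
Qed.

Lemma derive_rsub (E1 E2 : normedModType R) (f : E1 -> E2) x w v :
  differentiable f w -> 'D_v (fun y => x - f y) w = - 'D_v f w.
Proof.
move=> df; have -> : (fun y => x - f y) = cst x - f by [].
by rewrite deriveB ?derive_cst ?sub0r//; exact: diff_derivable.
Qed.

Lemma derive_subr (E1 E2 : normedModType R) (f : E1 -> E2) x w v :
  differentiable f w -> 'D_v (fun y => f y - x) w = 'D_v f w.
Proof.
move=> df; have -> : (fun y => f y - x) = f - cst x by [].
by rewrite deriveB ?derive_cst ?subr0//; exact: diff_derivable.
Qed.

Lemma dotNl (u v : E) : dot (- u) v = - dot u v.
Proof. by rewrite -scaleN1r dotZl mulN1r. Qed.

(** Meant for a vector that is both tangent to [W'] and normal to [W], where [angle_near] bounds its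
    product with itself. *)
Lemma angle_transversal (c : R) (v : E) : c < 1 -> `|dot v v| <= c * `|v| * `|v| -> v = 0.
Proof.
move=> c1 vv; apply/eqP; rewrite -normr_eq0; apply/negPn/negP => v0.
have v_gt0 : 0 < `|v| by rewrite lt_neqAle eq_sym v0 normr_ge0.
have := le_trans (norm_sqr_le_dot v) (le_trans (ler_norm _) vv).
by rewrite -mulrA -expr2 leNgt gtr_pMl ?exprn_gt0// c1.
Qed.

Lemma dot_continuous m (B : 'M[R]_(n, m)) (x : E) :
  continuous (fun y : E => dot ((y - x) *m B) ((y - x) *m B)).
Proof.
have oT : open [set: E] by exact: openT.
have c1 : Ck 0 setT (fun y : E => (y - x) *m B).
  exact: (Ck_mulmx oT (Ck_subr x oT (@Ck_id E 0 setT)) (@Ck_cst _ _ _ 0 setT B)).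
have /Ck_mxP := Ck_mulmx oT c1 (Ck_tr oT c1) => /(_ oT 0 0) c2.
rewrite (_ : (fun y => _) = fun y => ((y - x) *m B *m ((y - x) *m B)^T) 0 0).
  by move=> y; exact: c2.
by apply/funext => y; rewrite dotE.
Qed.

Lemma enorm_distC (x y : E) : enorm (x - y) = enorm (y - x).
Proof. by rewrite -opprB -scaleN1r enormZ normrN1 mul1r. Qed.

Lemma nearest_normal (W : dfell) (K : set E) (delta : R) :
  compact K -> K `<=` U -> 0 < delta ->
  \forall W' \near W, forall y, psi_set W' y -> K y ->
    exists x, [/\ psi_set W x, `|y - x| < delta & normal d (psi_set W) x (y - x)].
Proof.
move=> cK KU delta0.
have [r r0 [rdelta [cKr KrU]]] := near_right_ex
  (filterI (nbhs_right_lt delta0) (compact_tube cK oU KU)).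
have [N N0 nN] := pos_bound (n%:R : R).
apply: filterS (dfell_close W cK KU (divr_gt0 r0 N0)) => W' W'P y W'y Ky.
have [x' Wx' yx'] := W'P y W'y Ky.
have yx'r : enorm (y - x') < r.
  rewrite (le_lt_trans (enorm_le_norm _))//.
  rewrite (@le_lt_trans _ _ (N * `|y - x'|))//; first by rewrite ler_wpM2r.
  by rewrite mulrC -ltr_pdivlMr.
have cS : compact (psi_set W `&` [set x | `|y - x| <= r]).
  apply: psi_compact; first exact: closed_ball_compact.
  by move=> x yx; apply: KrU; exists y.
have Sx' : (psi_set W `&` [set x | `|y - x| <= r]) x'.
  by split=> //=; rewrite (le_trans (norm_le_enorm _))// ltW.
have [x1 /set_mem [Wx1 yx1] x1min] := compact_EVT_min (ex_intro _ _ Sx') cS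
  (continuous_subspaceT (@dot_continuous _ 1%:M y)).
have {}x1min x : psi_set W x -> `|y - x| <= r -> enorm (y - x1) <= enorm (y - x).
  move=> Wx yx; have := x1min x (mem_set (conj Wx yx)).
  by rewrite /= !mulmx1 => /ler_wsqrtr; rewrite (enorm_distC y x1) (enorm_distC y x).
(* The minimizer lies strictly inside the ball because [x'] does so in the Euclidean norm; the
   constraint is therefore inactive and the point is critical. *)
have yx1r : `|y - x1| < r.
  rewrite (le_lt_trans (norm_le_enorm _))// (le_lt_trans _ yx'r)//.
  by apply: x1min => //; case: Sx'.
exists x1; split=> //; first exact: lt_trans yx1r _.
have [ O [V [phi [g [cW Vx1]]]]] := chart_exists (psi_submanifold W) Wx1.
have [oO oV sphi sg [phig gphi]] := cW; have [Ou phiu] := gphi x1 Wx1 Vx1.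
have oB : open (O `&` phi @^-1` ball y r).
  apply: open_setI_preimage => //; first exact: ball_open.
  by move=> w Ow; exact: (sphi 0%N).
have Bu : (O `&` phi @^-1` ball y r) (g x1).
  by split=> //=; rewrite phiu -ball_normE.
have cphi k : Ck k (O `&` phi @^-1` ball y r) phi by apply: Ck_sub (sphi k) => w [].
have cf := Ck_rsub y oB (cphi 1%N).
have dphi := chart_diff cW Ou.
have crit b := critical_dot b oB Bu cf.
rewrite -phiu; apply/(chart_normal cW _ Ou)/normal_submx => xi /submxP[b ->].
have fmin w : (O `&` phi @^-1` ball y r) w -> enorm (y - phi (g x1)) <= enorm (y - phi w).
  move=> [Ow]; rewrite -ball_normE /= => /ltW yw; rewrite phiu; apply: x1min => //.
  by have [] := phig w Ow.
have := crit b fmin; rewrite derive_rsub// phiu (deriveEjacobian b dphi) dotNl => /eqP.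
by rewrite oppr_eq0 => /eqP.
Qed.

(* The foot is found by minimizing the component of [y - x] tangent to [W] over
   [y] in [W']: at a critical point it vanishes, since the tangent space of [W']
   projects onto that of [W]. *)
Lemma normal_meets (W : dfell) x0 (delta : R) : psi_set W x0 -> 0 < delta ->
  \forall x \near x0 & W' \near W, psi_set W x ->
    exists v, [/\ normal d (psi_set W) x v, `|v| < delta & psi_set W' (x + v)].
Proof.
move=> Wx0 delta0; have sW := psi_submanifold W.
have [ O [V0 [phi [g [cW V0x0]]]]] := chart_exists sW Wx0.
have [oO oV0 sphi sg [phig gphi]] := cW; have [Ou phiu] := gphi x0 Wx0 V0x0.
have [C C0 sec] := chart_secant cW Wx0 V0x0.
have [rs rs0 {}sec] := near_right_ex sec.
have half0 : (0 : R) < 2^-1 by rewrite invr_gt0.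
have [ra ra0 ang] := angle_near oU Wx0 half0.
have /nbhs_ballP[e /= e0 eU] : nbhs x0 U.
  by apply: open_nbhs_nbhs; split=> //; exact: psi_sub Wx0.
have [dl dl0 [dl1 [dl2 [dl3 dl4]]]] : exists2 dl : R, 0 < dl &
    dl < delta /\ dl < ra / 2 /\ dl < rs / 4 /\ dl < e / 2.
  by apply: near_right_ex; do !apply: filterI; apply: nbhs_right_lt; rewrite ?divr_gt0.
have [N N0 nN] := pos_bound (n%:R : R).
have [N' N'0 dN] := pos_bound (d%:R : R).
have [L L0 LA] := pos_bound `|jacobian phi (g x0)|.
(* The minimizer [y1] must lie strictly inside the ball of radius [dl] around [x]. Its distance from
   [x] comes out below [eta * Kc + dl / 4]: [alpha] bounds the change of frame from [x0] to [x] and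
   yields [dl / 4], and [eta] makes the rest less than [dl / 2]. *)
pose alpha := (4 * C * N)^-1.
have alpha0 : 0 < alpha by rewrite invr_gt0 !mulr_gt0.
pose Kc := 1 + C * (N * L + 2 * N' * N * (L + 1)).
have Kc0 : 0 < Kc by rewrite ltr_pwDl// !(mulr_ge0, addr_ge0)// ltW.
have [eta eta0 [eta1 eta2]] : exists2 eta : R, 0 < eta & eta < dl / 2 /\ eta < dl / 2 / Kc.
  by apply: near_right_ex; apply: filterI; apply: nbhs_right_lt; rewrite !divr_gt0.
have cJ := chart_jacobian_continuous cW Ou.
have nearJ : \forall w \near g x0, `|jacobian phi (g x0) - jacobian phi w| < alpha /\
    `|jacobian phi (g x0) - jacobian phi w| < 1.
  by apply: filterI; apply: (@cvgr_dist_lt _ _ _ (nbhs (g x0))).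
have /nbhs_ballP[r1 /= r10 r1P] := chart_near cW Wx0 V0x0 nearJ.
have cKU : [set y | `|x0 - y| <= 2 * dl] `<=` U.
  by move=> y /= xy; apply: eU; rewrite -ball_normE /=; lra.
have close := dfell_close W (@closed_ball_compact _ _ x0 (2 * dl)) cKU eta0.
have hit : \forall W' \near W, exists2 y, psi_set W' y & `|x0 - y| < eta.
  have [P PE] := tangent_plane sW Wx0.
  have oH : open ((set_val @^-1` ball x0 eta) `*` setT : set (set_type U * @Gr R d n)).
    rewrite openE => -[y Q] [/= xy _]; apply: nbhs_setX; last exact: filterT.
    by apply: set_val_continuous; apply: open_nbhs_nbhs; split=> //; exact: ball_open.
  have WH : gauss W `&` ((set_val @^-1` ball x0 eta) `*` setT) !=set0.
    exists (exist _ x0 (mem_set (psi_sub Wx0)), P).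
    by split; split=> //=; rewrite set_valE //=; exact: ballxx.
  apply: filterS (dfell_hit oH WH) => W' [[y Q] [[/= W'y _] [xy _]]].
  by exists (set_val y) => //; rewrite -ball_normE in xy.
exists (ball x0 (Num.min eta r1), [set W' : dfell |
   (forall y, psi_set W' y -> `|x0 - y| <= 2 * dl -> exists2 x, psi_set W x & `|y - x| < eta) /\
   (exists2 y, psi_set W' y & `|x0 - y| < eta) /\
   (forall x y zeta nu, psi_set W x -> `|x0 - x| < ra -> psi_set W' y ->
       `|x0 - y| < ra -> tangent d (psi_set W') y zeta -> normal d (psi_set W) x nu ->
       `|dot zeta nu| <= 2^-1 * `|zeta| * `|nu|)]) => /=.
  split; first by apply: nbhsx_ballx; rewrite lt_min eta0.
  by apply: filterI => //; exact: filterI.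
move=> [x W'] /= [] {close hit ang} xx0 [close [[y0 W'y0 y0x0] ang]] Wx.
move: xx0; rewrite -ball_normE /= lt_min => /andP[xeta xr1].
have [|V0x Ogx pgx [AA Ac1]] := r1P x _ Wx; first by rewrite -ball_normE.
have chN v := chart_normal cW v Ogx; rewrite pgx in chN.
move: (jacobian phi (g x0)) (jacobian phi (g x)) LA sec AA Ac1 chN => A0 A LA sec AA Ac1 chN {r1P nearJ cJ}.
have AL : `|A| <= L + 1 by rewrite (le_trans (norm_leD1 Ac1))// lerD2r.
have xU y : `|x - y| <= dl -> U y.
  by move=> xy; apply: cKU => /=; have := ler_distD x x0 y; lra.
have cS : compact (psi_set W' `&` [set y | `|x - y| <= dl]).
  by apply: psi_compact; first exact: closed_ball_compact.
have y0x : `|y0 - x| < 2 * eta.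
  by have := ler_distD x0 y0 x; rewrite (distrC y0 x0); lra.
have Sy0 : (psi_set W' `&` [set y | `|x - y| <= dl]) y0.
  by split=> //=; rewrite distrC; lra.
have [y1 /set_mem [W'y1 yx1] ymin] := compact_EVT_min (ex_intro _ _ Sy0) cS
  (continuous_subspaceT (@dot_continuous _ A^T x)).
have {}ymin y : psi_set W' y -> `|x - y| <= dl ->
    enorm ((y1 - x) *m A^T) <= enorm ((y - x) *m A^T).
  by move=> W'y xy; have := ymin y (mem_set (conj W'y xy)); exact: ler_wsqrtr.
have x0y1 : `|x0 - y1| <= 2 * dl.
  by move: yx1 => /=; have := ler_distD x x0 y1; lra.
(* [chart_secant] concerns points of [W], so [y1] is replaced by a point [x'] of [W] within
   [eta]. *)
have [x' Wx' y1x'] := close y1 W'y1 x0y1.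
have b1 : `|(y1 - x) *m A^T| <= eta * (2 * N' * N * (L + 1)).
  rewrite (le_trans (norm_le_enorm _))// (le_trans (ymin y0 W'y0 Sy0.2))//.
  rewrite (le_trans (enorm_le_norm _))//.
  rewrite (@le_trans _ _ (N' * (N * (2 * eta) * (L + 1))))//; last first.
    by rewrite le_eqVlt; apply/orP; left; apply/eqP; ring.
  apply: ler_pM => //; apply: (le_trans (norm_mulmx _ _)).
  apply: ler_pM; rewrite ?mulr_ge0//; last exact: le_trans (norm_trmx _) AL.
  by apply: ler_pM => //; exact: ltW.
have b2 : `|(x' - y1) *m A0^T| <= eta * (N * L).
  rewrite (le_trans (norm_mulmx _ _))//.
  rewrite (@le_trans _ _ (N * eta * L))//; last by rewrite mulrA (mulrC eta).
  apply: ler_pM; rewrite ?mulr_ge0//; last exact: le_trans (norm_trmx _) LA.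
  by apply: ler_pM => //; rewrite distrC; exact: ltW.
have b3 : `|(y1 - x) *m (A0 - A)^T| <= N * dl * alpha.
  rewrite (le_trans (norm_mulmx _ _))//.
  apply: ler_pM; rewrite ?mulr_ge0//; last exact: le_trans (norm_trmx _) (ltW AA).
  by apply: ler_pM => //; rewrite distrC.
have secx : `|x' - x| <= C * (eta * (N * L) + eta * (2 * N' * N * (L + 1)) + N * dl * alpha).
  apply: (le_trans (sec x x' Wx Wx' _ _)); first by lra.
    by have := ler_distD y1 x0 x'; lra.
  rewrite ler_wpM2l ?(ltW C0)//.
  have -> : (x' - x) *m A0^T = (x' - y1) *m A0^T + (y1 - x) *m A^T + (y1 - x) *m (A0 - A)^T.
    have -> : (A0 - A)^T = A0^T - A^T by rewrite linearB.
    rewrite [(y1 - x) *m (_ - _)]mulmxBr -addrA [(y1 - x) *m A^T + _]addrC subrK.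
    by rewrite -mulmxDl addrA subrK.
  rewrite (le_trans (ler_normD _ _))// lerD//.
  by rewrite (le_trans (ler_normD _ _))// lerD.
have y1x : `|x - y1| < dl.
  rewrite distrC; have := ler_distD x' y1 x.
  have eK : eta * Kc < dl / 2 by rewrite -ltr_pdivlMr.
  have E : C * (eta * (N * L) + eta * (2 * N' * N * (L + 1)) + N * dl * alpha) =
      eta * Kc - eta + dl / 4.
    by rewrite /Kc /alpha; field; rewrite !gt_eqF.
  by move: secx; rewrite E; lra.
exists (y1 - x); split; [|by rewrite distrC; exact: lt_trans dl1|by rewrite addrC subrK].
have sW' := psi_submanifold W'.
have [B [V1 [psi [h [cW' V1y1]]]]] := chart_exists sW' W'y1.
have [oB oV1 spsi sh [psih hpsi]] := cW'; have [Bs psis] := hpsi y1 W'y1 V1y1.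
have oB1 : open (B `&` psi @^-1` ball x dl).
  apply: open_setI_preimage; [exact: oB|exact: ball_open|].
  by move=> s Bs'; exact: (spsi 0%N).
have Bs1 : (B `&` psi @^-1` ball x dl) (h y1).
  by split=> //=; rewrite psis -ball_normE.
have cpsi : Ck 1 (B `&` psi @^-1` ball x dl) psi by apply: Ck_sub (spsi 1%N) => s [].
have cf1 := Ck_subr x oB1 cpsi.
have cc := @Ck_cst _ _ _ 1 (B `&` psi @^-1` ball x dl) A^T.
have cf := Ck_mulmx oB1 cf1 cc.
have dpsi := chart_diff cW' Bs.
have fmin s : (B `&` psi @^-1` ball x dl) s ->
    enorm ((psi (h y1) - x) *m A^T) <= enorm ((psi s - x) *m A^T).
  move=> [Bs']; rewrite /= -ball_normE /= => /ltW xs; rewrite psis; apply: ymin => //.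
  by have [] := psih s Bs'.
have crit b : dot (b *m jacobian psi (h y1) *m A^T) ((y1 - x) *m A^T) = 0.
  have := critical_dot b oB1 Bs1 cf fmin.
  rewrite (derive_mulmx _ oB1 Bs1 cf1 cc) derive_cst mulmx0 addr0 derive_subr//.
  by rewrite (deriveEjacobian b dpsi) psis.
have tanE := chart_tangent cW' Bs; rewrite psis in tanE.
have fJ := chart_free cW' Bs.
move: (jacobian psi (h y1)) crit tanE fJ => J crit tanE fJ.
(* Transversality: a vector [b *m J] killed by [A^T] is tangent to [W'] and normal to [W], hence
   zero. Invertibility lets the direction in [crit] be chosen so that [(y1 - x) *m A^T] is paired
   with itself. *)
have JAu : J *m A^T \in unitmx.
  rewrite -row_free_unit; apply/inj_row_free => b b0.
  have bJ0 : b *m J = 0.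
    apply: (@angle_transversal 2^-1); first by lra.
    apply: (ang x y1) => //.
    - by lra.
    - by lra.
    - by rewrite tanE /= submxMl.
    - by apply/chN; rewrite -mulmxA.
  by move/eqP: bJ0; rewrite mulmx_free_eq0// => /eqP.
apply/chN; apply: dot_eq0.
have := crit ((y1 - x) *m A^T *m invmx (J *m A^T)).
by rewrite -mulmxA mulmxKV.
Qed.

End NormalDirections.

(** * The foot map of two charts *)

Section LocalDiffeomorphism.
Context {R : realType}.

Lemma Ck_open_preimage (E1 E2 : normedModType R) (A : set E1) (B : set E2) f :
  open A -> open B -> Ck 0 A f -> open (A `&` f @^-1` B).
Proof. exact: open_setI_preimage. Qed.

Lemma derive_fun_sub (E1 E2 : normedModType R) (f g : E1 -> E2) x v :
  differentiable f x -> differentiable g x ->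
  'D_v (fun y => f y - g y) x = 'D_v f x - 'D_v g x.
Proof. by move=> df dg; exact: (deriveB (diff_derivable df) (diff_derivable dg)). Qed.

Lemma Ck_row_mx (E1 : normedModType R) k m p q (V : set E1)
    (f : E1 -> 'M[R]_(m, p)) (g : E1 -> 'M[R]_(m, q)) :
  open V -> Ck k V f -> Ck k V g -> Ck k V (fun x => row_mx (f x) (g x)).
Proof.
move=> oV /Ck_mxP cf /Ck_mxP cg; apply/Ck_mxP => // i j.
case: (split_ordP j) => l ->.
  by rewrite (_ : (fun x => _) = fun x => f x i l); [exact: cf|apply/funext => x; rewrite row_mxEl].
by rewrite (_ : (fun x => _) = fun x => g x i l); [exact: cg|apply/funext => x; rewrite row_mxEr].
Qed.

Lemma Ck_lsubmx (E1 : normedModType R) k m p q (V : set E1) (f : E1 -> 'M[R]_(m, p + q)) :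
  open V -> Ck k V f -> Ck k V (fun x => lsubmx (f x)).
Proof.
move=> oV /Ck_mxP cf; apply/Ck_mxP => // i j.
by rewrite (_ : (fun x => _) = fun x => f x i (lshift q j)); [exact: cf|apply/funext => x; rewrite mxE].
Qed.

Lemma Ck_rsubmx (E1 : normedModType R) k m p q (V : set E1) (f : E1 -> 'M[R]_(m, p + q)) :
  open V -> Ck k V f -> Ck k V (fun x => rsubmx (f x)).
Proof.
move=> oV /Ck_mxP cf; apply/Ck_mxP => // i j.
by rewrite (_ : (fun x => _) = fun x => f x i (rshift p j)); [exact: cf|apply/funext => x; rewrite mxE].
Qed.

Lemma row_mx_continuous (T : topologicalType) m p q
    (f : T -> 'M[R]_(m, p)) (g : T -> 'M[R]_(m, q)) x :
  {for x, continuous f} -> {for x, continuous g} ->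
  {for x, continuous (fun y => row_mx (f y) (g y))}.
Proof.
move=> cf cg; apply: (@cvg_mx_entry _ _ (nbhs x)) => i j.
case: (split_ordP j) => l ->.
  under eq_cvg do rewrite row_mxEl; rewrite row_mxEl.
  by apply: (@continuous_comp _ _ _ f (fun N : 'M[R]_(m, p) => N i l)) => //; exact: coord_continuous.
under eq_cvg do rewrite row_mxEr; rewrite row_mxEr.
by apply: (@continuous_comp _ _ _ g (fun N : 'M[R]_(m, q) => N i l)) => //; exact: coord_continuous.
Qed.

Lemma Ck_pair (E1 E2 E3 : normedModType R) k (V : set E1) (f : E1 -> E2) (g : E1 -> E3) :
  open V -> Ck k V f -> Ck k V g -> Ck k V (fun x => (f x, g x)).
Proof.
move=> oV; elim: k f g => [|k IH] f g /=.
  move=> cf cg x Vx.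
  exact: (@cvg_pair _ _ _ (nbhs x) (nbhs (f x)) (nbhs (g x)) _ _ _ f g (cf x Vx) (cg x Vx)).
move=> [df cf] [dg cg]; split=> [x Vx|v].
  by apply: differentiable_pair; [exact: df|exact: dg].
apply: Ck_eq (IH _ _ (cf v) (cg v)) => // x Vx.
have dfx := df x Vx; have dgx := dg x Vx.
rewrite (deriveE _ dfx) (deriveE _ dgx) (deriveE _ (differentiable_pair dfx dgx)).
exact: esym (congr1 (fun h : E1 -> (E2 * E3)%type => h v) (diff_pair dfx dgx)).
Qed.

Context {n d : nat}.
Local Notation E := 'rV[R]_n.

(** The base points are confined to [Om] because estimates on [W'] are uniform only near a compact
    set; an open [Om] keeps the projection a local diffeomorphism. *)
Definition normal_tube (W W' Om : set E) (delta : R) : set (E * E) :=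
  [set z | [/\ normal_bundle d W z, Om z.1, `|z.2| < delta & W' (z.1 + z.2)]].

Section Transversal.
Variables (W W' : set E) (O O' : set 'rV[R]_d) (V V' : set E).
Variables (phi psi : 'rV[R]_d -> E) (g h : E -> 'rV[R]_d).
Hypotheses (cW : chart W O V phi g) (cW' : chart W' O' V' psi h).

(* [psi s - phi w] is normal to [W] at [phi w] iff the second component of
   [foot_map (w, s)] vanishes. *)
Definition foot_map (p : 'rV[R]_(d + d)) : 'rV[R]_(d + d) :=
  row_mx (lsubmx p) ((psi (rsubmx p) - phi (lsubmx p)) *m (jacobian phi (lsubmx p))^T).

Definition foot_dom : set 'rV[R]_(d + d) := [set p | O (lsubmx p) /\ O' (rsubmx p)].

Lemma Ck_lsubmx_id k m (A : set 'rV[R]_(m + m)) : open A ->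
  Ck k A (fun p : 'rV[R]_(m + m) => lsubmx p).
Proof. by move=> oA; exact: (Ck_lsubmx oA (@Ck_id R _ k A)). Qed.

Lemma Ck_rsubmx_id k m (A : set 'rV[R]_(m + m)) : open A ->
  Ck k A (fun p : 'rV[R]_(m + m) => rsubmx p).
Proof. by move=> oA; exact: (Ck_rsubmx oA (@Ck_id R _ k A)). Qed.

Lemma foot_dom_open : open foot_dom.
Proof.
have [oO _ _ _ _] := cW; have [oO' _ _ _ _] := cW'.
have oT : open [set: 'rV[R]_(d + d)] by exact: openT.
have o1 := Ck_open_preimage oT oO (Ck_lsubmx_id 0 oT).
have o2 := Ck_open_preimage oT oO' (Ck_rsubmx_id 0 oT).
rewrite (_ : foot_dom = (setT `&` (fun p : 'rV[R]_(d + d) => lsubmx p) @^-1` O) `&`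
    (setT `&` (fun p : 'rV[R]_(d + d) => rsubmx p) @^-1` O')); first exact: openI.
by apply/seteqP; split=> p; [move=> [? ?]|move=> [[_ ?] [_ ?]]].
Qed.

Lemma foot_diff_smooth : smooth_open foot_dom
  (fun p : 'rV[R]_(d + d) => psi (rsubmx p) - phi (lsubmx p)).
Proof.
have [oO _ sphi _ _] := cW; have [oO' _ spsi _ _] := cW'.
have oD := foot_dom_open => k.
have c1 : Ck k foot_dom (phi \o (fun p => lsubmx p)).
  apply: (@Ck_comp _ _ _ _ _ _ _ O (fun p : 'rV[R]_(d + d) => lsubmx p) phi) => //.
  - by move=> p [].
  - exact: Ck_lsubmx_id.
have c2 : Ck k foot_dom (psi \o (fun p => rsubmx p)).
  apply: (@Ck_comp _ _ _ _ _ _ _ O' (fun p : 'rV[R]_(d + d) => rsubmx p) psi) => //.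
  - by move=> p [].
  - exact: Ck_rsubmx_id.
have cN : continuous (-%R : E -> E) by move=> z; exact: opp_continuous.
exact: (CkD oD c2 (Ck_lin (L := -%R : {linear E -> E}) oD cN c1)).
Qed.

Lemma foot_jacobian_smooth : smooth_open foot_dom
  (fun p : 'rV[R]_(d + d) => (jacobian phi (lsubmx p))^T).
Proof.
have [oO _ sphi _ _] := cW; have oD := foot_dom_open => k.
apply: (Ck_tr oD).
apply: (@Ck_comp _ _ _ _ _ _ _ O (fun p : 'rV[R]_(d + d) => lsubmx p) (jacobian phi)) => //.
- by move=> p [].
- exact: Ck_lsubmx_id.
- exact: (Ck_jacobian oO (sphi k.+1)).
Qed.

Lemma foot_map_smooth : smooth_open foot_dom foot_map.
Proof.
have oD := foot_dom_open => k.
apply: (Ck_row_mx oD (Ck_lsubmx_id k oD)).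
exact: (Ck_mulmx oD (foot_diff_smooth k) (foot_jacobian_smooth k)).
Qed.

(** A kernel vector [a] has [lsubmx a = 0], since the first component of the foot map is a
    projection. Moving [s] alone leaves the frame at [phi u] fixed, so no second derivative of [phi]
    enters, and the second component shows [rsubmx a *m jacobian psi s] to be normal to [W] as well
    as tangent to [W']. *)
Lemma foot_jacobian_unit u s : O u -> O' s ->
  (forall zeta, tangent d W' (psi s) zeta -> normal d W (phi u) zeta -> zeta = 0) ->
  jacobian foot_map (row_mx u s) \in unitmx.
Proof.
move=> Ou Os tr; have oD := foot_dom_open.
set p0 := row_mx u s.
have Dp0 : foot_dom p0 by rewrite /foot_dom /= row_mxKl row_mxKr.
have dphi := chart_diff cW Ou; have dpsi := chart_diff cW' Os.
have [/(_ p0 Dp0) dH _] := foot_map_smooth 1%N.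
have cM := foot_diff_smooth 1%N; have cN := foot_jacobian_smooth 1%N.
have [/(_ p0 Dp0) dl _] := Ck_lsubmx_id (m := d) 1 oD.
have [/(_ p0 Dp0) dr _] := Ck_rsubmx_id (m := d) 1 oD.
have did : differentiable (@id 'rV[R]_(d + d)) p0 by [].
have Dl a : 'D_a (fun p : 'rV[R]_(d + d) => lsubmx p) p0 = lsubmx a.
  apply/matrixP => i j; rewrite (derive_coord _ _ _ dl).
  rewrite (_ : (fun y : 'rV[R]_(d + d) => _) = fun y => id y i (lshift d j)); last first.
    by apply/funext => y; rewrite mxE.
  by rewrite -(derive_coord _ _ _ did) derive_id mxE.
have Dr a : 'D_a (fun p : 'rV[R]_(d + d) => rsubmx p) p0 = rsubmx a.
  apply/matrixP => i j; rewrite (derive_coord _ _ _ dr).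
  rewrite (_ : (fun y : 'rV[R]_(d + d) => _) = fun y => id y i (rshift d j)); last first.
    by apply/funext => y; rewrite mxE.
  by rewrite -(derive_coord _ _ _ did) derive_id mxE.
rewrite -row_free_unit; apply/inj_row_free => a a0.
have Da : 'D_a foot_map p0 = 0 by rewrite deriveEjacobian.
have a1 : lsubmx a = 0.
  rewrite -Dl; apply/matrixP => i j; rewrite (derive_coord _ _ _ dl).
  rewrite (_ : (fun y : 'rV[R]_(d + d) => _) = fun y => foot_map y i (lshift d j)); last first.
    by apply/funext => y; rewrite row_mxEl.
  by rewrite -(derive_coord _ _ _ dH) Da !mxE.
have [/(_ p0 Dp0) dMN _] := Ck_mulmx oD cM cN.
have DMN : 'D_a (fun p : 'rV[R]_(d + d) => (psi (rsubmx p) - phi (lsubmx p)) *m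
    (jacobian phi (lsubmx p))^T) p0 = 0.
  apply/matrixP => i j; rewrite (derive_coord _ _ _ dMN).
  rewrite (_ : (fun y : 'rV[R]_(d + d) => _) = fun y => foot_map y i (rshift d j)); last first.
    by apply/funext => y; rewrite row_mxEr.
  by rewrite -(derive_coord _ _ _ dH) Da !mxE.
have lp0 : lsubmx p0 = u by rewrite row_mxKl.
have rp0 : rsubmx p0 = s by rewrite row_mxKr.
have dphi0 : differentiable phi (lsubmx p0) by rewrite lp0.
have dpsi0 : differentiable psi (rsubmx p0) by rewrite rp0.
have DM : 'D_a (fun p : 'rV[R]_(d + d) => psi (rsubmx p) - phi (lsubmx p)) p0 =
    rsubmx a *m jacobian psi s.
  have d1 := @differentiable_comp _ _ _ _ (fun p : 'rV[R]_(d + d) => rsubmx p) psi p0 dr dpsi0.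
  have d2 := @differentiable_comp _ _ _ _ (fun p : 'rV[R]_(d + d) => lsubmx p) phi p0 dl dphi0.
  have e1 : 'D_a (psi \o (fun p : 'rV[R]_(d + d) => rsubmx p)) p0 = rsubmx a *m jacobian psi s.
    apply: etrans (derive_comp _ dr dpsi0) _.
    by rewrite Dr rp0; exact: diff_jacobian dpsi.
  have e2 : 'D_a (phi \o (fun p : 'rV[R]_(d + d) => lsubmx p)) p0 = 0.
    apply: etrans (derive_comp _ dl dphi0) _.
    by rewrite Dl a1 linear0.
  apply: etrans (derive_fun_sub a d1 d2) _.
  by apply: etrans (congr2 (fun x y : E => x - y) e1 e2) _; exact: subr0.
have DN : 'D_a (fun p : 'rV[R]_(d + d) => (jacobian phi (lsubmx p))^T) p0 = 0.
  have [oO _ sphi _ _] := cW.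
  have [/(_ u Ou) dJ _] := Ck_tr oO (Ck_jacobian oO (sphi 2%N)).
  have dJ0 : differentiable (fun w => (jacobian phi w)^T) (lsubmx p0) by rewrite lp0.
  have := @derive_comp _ _ _ _ (fun p : 'rV[R]_(d + d) => lsubmx p)
    (fun w => (jacobian phi w)^T) p0 a dl dJ0.
  by rewrite Dl a1 linear0.
move: DMN; rewrite (derive_mulmx _ oD Dp0 cM cN) DM DN mulmx0 addr0 lp0 => DMN.
have a2 : rsubmx a *m jacobian psi s = 0.
  apply: tr; first by rewrite (chart_tangent cW' Os) /= submxMl.
  exact/(chart_normal cW _ Ou).
move/eqP: a2; rewrite mulmx_free_eq0; last exact: (chart_free cW' Os).
by move/eqP => a2; rewrite -[a]hsubmxK a1 a2 row_mx0.
Qed.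

End Transversal.
End LocalDiffeomorphism.

(** * The normal tube as a space locally diffeomorphic to [W] *)

Section NormalTube.
Context {R : realType} {n d : nat}.
Local Notation E := 'rV[R]_n.

Lemma local_diffeo_normal_tube (W W' Om : set E) (delta : R) :
  submanifold d W -> submanifold d W' -> open Om ->
  (forall z, normal_tube (d := d) W W' Om delta z -> forall zeta,
     tangent d W' (z.1 + z.2) zeta -> normal d W z.1 zeta -> zeta = 0) ->
  local_diffeo (normal_tube (d := d) W W' Om delta) W fst.
Proof.
move=> sW sW' oOm tr [x v] Qz; have [[/= Wx nv] Omx vdelta W'xv] := Qz.
have [ O [V [phi [g [cW Vx]]]]] := chart_exists sW Wx.
have [ O' [V' [psi [h [cW' V'y]]]]] := chart_exists sW' W'xv.
have [oO oV sphi sg [phig gphi]] := cW; have [Ou phiu] := gphi x Wx Vx.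
have [oO' oV' spsi sh [psih hpsi]] := cW'; have [Os psis] := hpsi _ W'xv V'y.
have oD := foot_dom_open cW cW'.
have sH := foot_map_smooth cW cW'.
have Dus : foot_dom O O' (row_mx (g x) (h (x + v))).
  by rewrite /foot_dom /= row_mxKl row_mxKr.
have Hu : jacobian (foot_map phi psi) (row_mx (g x) (h (x + v))) \in unitmx.
  apply: (foot_jacobian_unit cW cW' Ou Os) => zeta; rewrite phiu psis.
  exact: tr Qz zeta.
have [N [M [I [oN Nus ND oM [HN IM sI]]]]] := inverse_function oD Dus sH Hu.
have footE w s : O w -> normal d W (phi w) (psi s - phi w) ->
    foot_map phi psi (row_mx w s) = row_mx w 0.
  move=> Ow /(chart_normal cW _ Ow) ns.
  by rewrite /foot_map row_mxKl row_mxKr ns.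
pose i0 w : 'rV[R]_(d + d) := row_mx w (0 : 'rV[R]_d).
(* [I (i0 w)] is the pair [(w, sigma w)], where [psi (sigma w)] lies on [W'] in the normal direction
   from [phi w]. Hence [F] below is the local section through [(x, v)]. *)
pose sigma w := rsubmx (I (i0 w)).
have sigmaP w : M (i0 w) -> [/\ O w, O' (sigma w), N (row_mx w (sigma w)) &
    normal d W (phi w) (psi (sigma w) - phi w)].
  move=> Mw; have [NI HI] := IM _ Mw.
  have [Ol Or] := ND _ NI.
  have l : lsubmx (I (i0 w)) = w.
    by have := congr1 lsubmx HI; rewrite /foot_map !row_mxKl.
  have := congr1 rsubmx HI; rewrite /foot_map !row_mxKr l => HI2.
  rewrite l in Ol; split=> //; last exact/(chart_normal cW _ Ol).
  by rewrite /sigma -[w in row_mx w _]l hsubmxK.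
have Ci0 k : Ck k V (fun x' => i0 (g x')).
  exact: (Ck_row_mx oV (sg k) (@Ck_cst _ _ _ k V 0)).
pose V1 := V `&` (fun x' => i0 (g x')) @^-1` M.
have oV1 : open V1 := Ck_open_preimage oV oM (Ci0 0%N).
have V1V : V1 `<=` V by move=> ? [].
have V1M x' : V1 x' -> M (i0 (g x')) by move=> [].
pose F x' := psi (sigma (g x')) - x'.
have CF k : Ck k V1 F.
  have c1 : Ck k V1 (I \o (fun x' => i0 (g x'))).
    exact: (Ck_comp oV1 oM V1M (Ck_sub V1V (Ci0 k)) (sI k)).
  have c2 := Ck_rsubmx oV1 c1.
  have c3 : Ck k V1 (psi \o (fun x' => rsubmx ((I \o (fun x' => i0 (g x'))) x'))).
    apply: (Ck_comp oV1 oO' _ c2 (spsi k)) => x' V1x'.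
    by have [] := sigmaP _ (V1M x' V1x').
  have cN : continuous (-%R : E -> E) by move=> z; exact: opp_continuous.
  exact: (CkD oV1 c3 (@Ck_linear _ _ _ k V1 (-%R : {linear E -> E}) cN)).
pose V2 := (V1 `&` F @^-1` ball 0 delta) `&` Om.
have oV2 : open V2.
  by apply: openI => //; exact: (Ck_open_preimage oV1 (ball_open _ _) (CF 0%N)).
have ball0 (w : E) : ball 0 delta w <-> `|w| < delta.
  by rewrite -ball_normE /= sub0r normrN.
have oT : open [set: E * E] by exact: openT.
have cfst : continuous (fst : E * E -> E) by move=> z; exact: cvg_fst.
have cadd : continuous (fun z : E * E => z.1 + z.2).
  by move=> z; apply: (@cvgD _ _ _ (nbhs z)); [exact: cvg_fst|exact: cvg_snd].
pose B1 := (setT `&` (fst : E * E -> E) @^-1` V2) `&` (setT `&` (fun z : E * E => z.1 + z.2) @^-1` V').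
have oB1 : open B1.
  apply: openI; apply: open_setI_preimage.
  - exact: oT.
  - exact: oV2.
  - by move=> z _; exact: cfst.
  - exact: oT.
  - exact: oV'.
  - by move=> z _; exact: cadd.
(* Chart coordinates of the base point and the end point of [z]. Requiring them in [N], where the
   foot map is injective, leaves at most one tube point per fibre. *)
pose G (z : E * E) : 'rV[R]_(d + d) := row_mx (g z.1) (h (z.1 + z.2)).
pose B := B1 `&` G @^-1` N.
have oB : open B.
  apply: open_setI_preimage => // z [[_ [[[Vz _] _] _]] [_ V'z]].
  apply: row_mx_continuous.
    by apply: (@continuous_comp _ _ _ fst g); [exact: cfst|exact: (sg 0%N)].
  by apply: (@continuous_comp _ _ _ (fun z : E * E => z.1 + z.2) h); [exact: cadd|exact: (sh 0%N)].
(* Every point of the tube in [B] is recovered from its foot. *)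
have recover a b : W a -> V a -> normal d W a b -> W' (a + b) -> V' (a + b) ->
    N (G (a, b)) -> [/\ M (i0 (g a)), F a = b & row_mx (g a) (sigma (g a)) = G (a, b)].
  move=> Wa Va nb W'ab V'ab NG; have [Oa pa] := gphi a Wa Va.
  have [Oab pab] := hpsi _ W'ab V'ab.
  have HG : foot_map phi psi (G (a, b)) = i0 (g a).
    by apply: footE => //; rewrite pa pab addrC addKr.
  have [MG IG] := HN _ NG; rewrite HG in MG IG.
  have sE : sigma (g a) = h (a + b) by rewrite /sigma IG row_mxKr.
  by split=> //; [rewrite /F sE pab addrC addKr|rewrite sE].
have [Mx Fx _] := recover x v Wx Vx nv W'xv V'y Nus.
exists B, V2, (fun x' => (x', F x')); split=> //.
- split; last exact: Nus.
  split; split=> //=; split=> //; split=> //=.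
  by rewrite Fx; exact/ball0.
- split.
  + apply: (@smooth_open_on _ _ _ _ setT) => // k.
    exact: (@Ck_linear _ _ _ k setT (fst : {linear (E * E)%type -> E}) cfst).
  + apply: (@smooth_open_on _ _ _ _ V1) => //; first by move=> y [_ [[]]].
    by move=> k; exact: (Ck_pair oV1 (@Ck_id _ E k V1) (CF k)).
  + move=> [a b] [[[/= Wa nb] Oma bdelta W'ab] [[[_ V2a] [_ V'ab]] NG]].
    split=> //; have [_ Fa _] := recover a b Wa V2a.1.1.1 nb W'ab V'ab NG.
    by rewrite Fa.
  + move=> a [Wa V2a]; have [[V1a Fa] Oma] := V2a.
    have [Oa pa] := gphi a Wa (V1V _ V1a).
    have [_ Osig Nsig nsig] := sigmaP _ (V1M a V1a); rewrite pa in nsig.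
    have [W'sig V'sig hsig] := psih _ Osig.
    have aF : a + F a = psi (sigma (g a)) by rewrite /F addrC subrK.
    split; last by [].
    have tube : normal_tube (d := d) W W' Om delta (a, F a).
      by split; [split; [exact: Wa|exact: nsig]|exact: Oma|exact/ball0|rewrite /= aF; exact: W'sig].
    have inB1 : B1 (a, F a).
      by split; split; [exact: Logic.I|exact: V2a|exact: Logic.I|rewrite /= aF; exact: V'sig].
    have inN : N (G (a, F a)) by rewrite /G /= aF hsig; exact: Nsig.
    by split; [exact: tube|split; [exact: inB1|exact: inN]].
Qed.

End NormalTube.

(** * The [C^1] size of sections that end on [W'] *)

Section SmallSize.
Context {R : realType} {n d : nat}.
Local Notation E := 'rV[R]_n.
Variable U : set E.
Hypothesis oU : open U.
Local Notation dfell := (dfell d U).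

(** Let [nu] be the normal part of the derivative of [f] along [a *m A]. The vector [a *m (A + B)]
    is tangent to [W'] and equals [(a + b) *m A + nu], with [b] bounded through [second_form_bound].
    The angle estimate then gives [|nu| <= c' * (M1 + |nu|)], so [nu] is small with [c']. *)
Lemma C1_size_small (W : dfell) x0 (eps : R) : psi_set W x0 -> 0 < eps ->
  exists2 r : R, 0 < r & \forall W' \near W, forall x V f,
    (psi_set W `&` V) x -> `|x0 - x| < r -> open V -> smooth_on (psi_set W `&` V) f ->
    (forall z, (psi_set W `&` V) z ->
       normal d (psi_set W) z (f z) /\ psi_set W' (z + f z)) ->
    `|f x| < r -> C1_size d (psi_set W) (psi_set W `&` V) f x < eps.
Proof.
move=> Wx0 eps0; have sW := psi_submanifold W.
have [ O [V0 [phi [g [cW V0x0]]]]] := chart_exists sW Wx0.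
have [oO oV0 sphi sg [phig gphi]] := cW; have [Ou phiu] := gphi x0 Wx0 V0x0.
have [c c0 near_c] := gram_lower_bound (chart_free cW Ou).
have [C C0 near_C] := second_form_bound cW Ou.
have cJ := chart_jacobian_continuous cW Ou.
have [L L0 LJ] : exists2 L : R, 0 < L &
    forall A, `|jacobian phi (g x0) - A| < 1 -> `|A| <= L.
  exists (`|jacobian phi (g x0)| + 1); first by rewrite ltr_wpDl.
  by move=> A; exact: norm_leD1.
have near_w : \forall w \near g x0,
   [/\ `|jacobian phi (g x0) - jacobian phi w| < 1,
       forall b : 'rV[R]_d, `|b| <= c * `|b *m (jacobian phi w *m (jacobian phi w)^T)| &
       forall (V : set E) (f : E -> E),
    open V -> smooth_on (psi_set W `&` V) f ->
    (forall x, (psi_set W `&` V) x -> normal d (psi_set W) x (f x)) -> O w -> V (phi w) ->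
    `|jacobian (f \o phi) w *m (jacobian phi w)^T| <= C * `|f (phi w)|].
  near=> w; split.
  - by near: w; apply: (@cvgr_dist_lt _ _ _ (nbhs (g x0))).
  - by near: w; exact: cJ near_c.
  - by near: w; exact: near_C.
have /nbhs_ballP[r1 /= r10 r1P] := chart_near cW Wx0 V0x0 near_w.
have [N N0 nN] := pos_bound (n%:R : R).
have [N' N'0 dN] := pos_bound (d%:R : R).
pose ka := c * (N * L); have ka0 : 0 < ka by rewrite !mulr_gt0.
pose M1 := (ka + c * (N' * ka * C)) * (N' * L).
have M10 : 0 < M1 by rewrite mulr_gt0 ?addr_gt0 ?mulr_gt0.
(* The first bound absorbs [|nu|] on the right and leaves [|nu| <= 2 * c' * M1]; the second makes
   this at most [eps / (2 * N)], where [N] pays for the Euclidean norm. The other half of [eps] is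
   spent on [f x]. *)
pose c' := Num.min 2^-1 (eps / (4 * N * M1)).
have half0 : (0 : R) < 2^-1 by rewrite invr_gt0.
have eM0 : 0 < eps / (4 * N * M1) by rewrite divr_gt0// mulr_gt0// mulr_gt0.
have c'0 : 0 < c' by rewrite /c' lt_min half0.
have c'2 : c' <= 2^-1 by rewrite /c' ge_min lexx.
have c'e : 2 * c' * M1 <= eps / (2 * N).
  have : c' <= eps / (4 * N * M1) by rewrite /c' ge_min lexx orbT.
  move/(ler_wpM2l (ltW (mulr_gt0 (ltr0Sn R 1) M10))).
  have -> : 2 * M1 * (eps / (4 * N * M1)) = eps / (2 * N) by field; rewrite !gt_eqF.
  by rewrite mulrAC.
have [ra ra0 ang] := angle_near oU Wx0 c'0.
have [r r0 [rr1 [r_1 [rra re]]]] : exists2 r : R, 0 < r &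
    r < r1 /\ r < 1 /\ r < ra / 2 /\ r < eps / 2 / N.
  by apply: near_right_ex; do !apply: filterI; apply: nbhs_right_lt; rewrite ?divr_gt0.
exists r => //; apply: filterS ang => W' ang x V f WVx xr oV sf nf fr.
have [Wx Vx] := WVx; have sW' := psi_submanifold W'.
have [|V0x Ogx pgx [A1 cA CA]] := r1P x _ Wx.
  by rewrite -ball_normE /=; exact: lt_trans rr1.
have Vw : V (phi (g x)) by rewrite pgx.
have nf1 z : (psi_set W `&` V) z -> normal d (psi_set W) z (f z) by move=> /nf[].
have {}CA := CA V f oV sf nf1 Ogx Vw.
have fW' z : (psi_set W `&` V) z -> psi_set W' (z + f z) by move=> /nf[].
have tF a := section_tangent a cW sW' oV sf Ogx Vw fW'.
have tauE a nu := (tauD_chart cW oV sf a nu Ogx Vw).1.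
have tanE := chart_tangent cW Ogx.
have nE v := (chart_normal cW v Ogx).1.
rewrite pgx in CA tF tauE tanE nE.
have AL := LJ _ A1.
move: (jacobian phi (g x)) (jacobian (f \o phi) (g x)) AL cA CA tF tauE tanE nE
  => A B AL cA CA tF tauE tanE nE.
have fe : enorm (f x) < eps / 2.
  rewrite (le_lt_trans (enorm_le_norm _))// (@le_lt_trans _ _ (N * `|f x|))//.
    by rewrite ler_wpM2r.
  by rewrite mulrC -ltr_pdivlMr//; exact: lt_trans re.
rewrite /C1_size [ltRHS]splitr ltr_leD//.
apply: opnorm_le; first by rewrite ltW// divr_gt0.
move=> xi nu; rewrite tanE /= => /submxP[a ->] xi1 /tauE[nnu /submxP[b bE]].
have nuA := nE _ nnu.
have aka : `|a| <= ka.
  rewrite (le_trans (cA a))// ler_wpM2l ?(ltW c0)// mulmxA (le_trans (norm_mulmx _ _))//.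
  apply: ler_pM; rewrite ?mulr_ge0//; last exact: le_trans (norm_trmx _) AL.
  rewrite -[leRHS]mulr1; apply: ler_pM => //.
  exact: le_trans (norm_le_enorm _) xi1.
have bb : `|b| <= c * (N' * ka * C).
  rewrite (le_trans (cA b))// ler_wpM2l ?(ltW c0)//.
  have -> : b *m (A *m A^T) = a *m (B *m A^T) by rewrite mulmxA -bE mulmxBl nuA subr0 mulmxA.
  rewrite (le_trans (norm_mulmx _ _))//; apply: ler_pM; rewrite ?mulr_ge0//.
    by apply: ler_pM.
  by rewrite (le_trans CA)// ler_piMr ?(ltW C0)// ltW// (lt_trans fr).
have zE : a *m (A + B) = (a + b) *m A + nu.
  by rewrite mulmxDr mulmxDl -bE -addrA subrK.
have nn : dot nu nu = dot (a *m (A + B)) nu.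
  by rewrite zE dotDl dot_mulmx nuA trmx0 mulmx0 mxE add0r.
have zM : `|a *m (A + B)| <= M1 + `|nu|.
  rewrite zE (le_trans (ler_normD _ _))// lerD2r (le_trans (norm_mulmx _ _))//.
  rewrite /M1 [leRHS]mulrA; apply: ler_pM; rewrite ?mulr_ge0//.
  rewrite [leRHS]mulrC; apply: ler_pM => //.
  by rewrite (le_trans (ler_normD _ _))// lerD.
have {}ang := ang x (x + f x) _ nu Wx _ (fW' _ WVx) _ (tF a) nnu.
have nub : `|nu| <= c' * (M1 + `|nu|).
  have [->|nu0] := eqVneq nu 0; first by rewrite normr0 addr0 ltW// mulr_gt0.
  rewrite -(ler_pM2r (_ : 0 < `|nu|)) ?normr_gt0// -expr2.
  rewrite (le_trans (norm_sqr_le_dot nu))// nn (le_trans (ler_norm _))//.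
  rewrite (le_trans (ang _ _))//; first by lra.
    have := ler_distD x x0 (x + f x); rewrite opprD addNKr normrN; lra.
  by rewrite ler_wpM2r// ler_wpM2l// ltW.
have nub2 : `|nu| <= eps / (2 * N).
  apply: le_trans c'e.
  have : c' * `|nu| <= 2^-1 * `|nu| by rewrite ler_wpM2r.
  move: nub; rewrite mulrDr; lra.
rewrite (le_trans (enorm_le_norm _))// (@le_trans _ _ (N * (eps / (2 * N))))//.
  by apply: ler_pM.
by rewrite le_eqVlt; apply/orP; left; apply/eqP; field; rewrite gt_eqF.
Unshelve. all: by end_near. Qed.

End SmallSize.

(** * The sets [ls] as Fell neighbourhoods *)

Section LeafSpaceNeighbourhoods.
Context {R : realType} {n d : nat}.
Local Notation E := 'rV[R]_n.
Variable U : set E.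
Hypothesis oU : open U.
Local Notation psi := (psi d U).
Local Notation dfell := (dfell d U).

Lemma domain_tube (W : psi) (D : set (E * E)) (K : set E) :
  exp_domain d U (psi_set W) D -> compact K -> K `<=` U ->
  \forall delta \near (0 : R)^'+, forall x v, psi_set W x -> K x -> `|v| < delta ->
    normal d (psi_set W) x v -> D (x, v).
Proof.
move=> [_ nD _ _] cK KU.
have /compact_near_coveringP/(_ R (0^'+ : set_system R)) := psi_compact (W := W) cK KU.
move=> /(_ (fun delta x => forall v, psi_set W x -> `|v| < delta ->
    normal d (psi_set W) x v -> D (x, v)) _) cov.
apply: filterS (cov _) => [delta P x v Wx Kx|]; first exact: (P x).
move=> x [Wx Kx]; have [[A B] /= [xA B0] AB] := nD x Wx.
have /nbhs_ballP[e /= e0 eB] := B0.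
exists (A, [set s | s < e]); first by split=> //=; exact: nbhs_right_lt.
move=> [x' s] /= [Ax' se] v Wx' vs nv; apply: (AB (x', v)) => //.
split=> //=; apply: eB; rewrite -ball_normE /= sub0r normrN; exact: lt_trans se.
Qed.

(** [angle_near] and [C1_size_small] hold near single points; compactness of the part of [W] in [K]
    makes them uniform. The covering argument has one parameter filter, so [W'] and [delta] are
    combined in a product. *)
Lemma tube_control (W : dfell) (K : set E) (eps : R) : compact K -> K `<=` U -> 0 < eps ->
  \forall W' \near W & delta \near (0 : R)^'+, forall x, psi_set W x -> K x ->
    (forall v zeta, `|v| < delta -> psi_set W' (x + v) ->
       tangent d (psi_set W') (x + v) zeta -> normal d (psi_set W) x zeta -> zeta = 0) /\
    (forall V f, open V -> V x -> smooth_on (psi_set W `&` V) f ->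
      (forall z, (psi_set W `&` V) z ->
         normal d (psi_set W) z (f z) /\ psi_set W' (z + f z)) ->
      `|f x| < delta -> C1_size d (psi_set W) (psi_set W `&` V) f x < eps).
Proof.
move=> cK KU eps0.
have /compact_near_coveringP/(_ (dfell * R)%type
  (filter_prod (nbhs W) (0^'+ : set_system R))) := psi_compact (W := W) cK KU.
move=> /(_ (fun p x => psi_set W x ->
    (forall v zeta, `|v| < p.2 -> psi_set p.1 (x + v) ->
       tangent d (psi_set p.1) (x + v) zeta -> normal d (psi_set W) x zeta -> zeta = 0) /\
    (forall V f, open V -> V x -> smooth_on (psi_set W `&` V) f ->
      (forall z, (psi_set W `&` V) z ->
         normal d (psi_set W) z (f z) /\ psi_set p.1 (z + f z)) ->
      `|f x| < p.2 -> C1_size d (psi_set W) (psi_set W `&` V) f x < eps)) _) cov.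
apply: filterS (cov _) => [p P x Wx Kx|]; first exact: (P x).
move=> x0 [Wx0 Kx0].
have half0 : (0 : R) < 2^-1 by rewrite invr_gt0.
have [ra ra0 ang] := angle_near oU Wx0 half0.
have [rc rc0 sml] := C1_size_small oU Wx0 eps0.
have ra20 : 0 < ra / 2 by rewrite divr_gt0.
have m0 : 0 < Num.min (ra / 2) rc by rewrite lt_min ra20.
exists (ball x0 (Num.min (ra / 2) rc),
   [set p : dfell * R | p.2 < Num.min (ra / 2) rc /\ (
    (forall x y zeta nu, psi_set W x -> `|x0 - x| < ra -> psi_set p.1 y ->
       `|x0 - y| < ra -> tangent d (psi_set p.1) y zeta -> normal d (psi_set W) x nu ->
       `|dot zeta nu| <= 2^-1 * `|zeta| * `|nu|) /\
    (forall x V f,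
    (psi_set W `&` V) x -> `|x0 - x| < rc -> open V -> smooth_on (psi_set W `&` V) f ->
    (forall z, (psi_set W `&` V) z ->
       normal d (psi_set W) z (f z) /\ psi_set p.1 (z + f z)) ->
    `|f x| < rc -> C1_size d (psi_set W) (psi_set W `&` V) f x < eps))]).
  split; first exact: nbhsx_ballx.
  eexists (_, _); first by split; [exact: (filterI ang sml)|exact: (nbhs_right_lt m0)].
  by move=> [W' s] /= [].
move=> [x [W' s]] /= [] {ang sml}; rewrite -ball_normE /= !lt_min.
move=> /andP[xra xrc] [/andP[sra src] [ang sml]] Wx; split.
  move=> v zeta vs W'xv tz nz; apply: (@angle_transversal R n 2^-1); first by lra.
  apply: (ang x (x + v)) => //; first by lra.
  by have := ler_distD x x0 (x + v); rewrite opprD addNKr normrN; lra.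
move=> V f oV Vx sf nf fs; apply: sml => //; exact: lt_trans src.
Qed.

Lemma ls_near (D : psi -> set (E * E)) (W : psi) (K : set E) (eps : R) :
  exp_domain d U (psi_set W) (D W) -> compact K -> K `<=` U -> 0 < eps ->
  \forall W' \near (W : dfell), ls W (D W) K eps W'.
Proof.
move=> eD cK KU eps0.
have [rho rho0 [cKr KrU]] := near_right_ex (compact_tube cK oU KU).
set Kr := mkset _ in cKr KrU.
(* The feet of points of [W'] in [K] need not lie in [K], only within [dl < rho] of it. [Om]
   contains them and lies in the compact [Kr], where the estimates hold. *)
pose Om : set E := \bigcup_(x in K) ball x rho.
have oOm : open Om by apply: bigcup_open => x _; exact: ball_open.
have OmKr : Om `<=` Kr.
  by move=> y [x Kx]; rewrite -ball_normE /= => xy; exists x => //; exact: ltW.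
have [[A B] /= [nA nB] AB] := tube_control W cKr KrU eps0.
have [dl dl0 [Bdl [dlrho dom]]] := near_right_ex
  (filterI nB (filterI (nbhs_right_lt rho0) (domain_tube eD cKr KrU))).
have cWK := psi_compact (W := W) cK KU.
(* This makes [Q] hit every point of [W] in [K]; [near3] below makes its end points exhaust [W'] in
   [K]. *)
have meets : \forall W' \near (W : dfell), psi_set W `&` K `<=` fun x =>
    psi_set W x -> exists v, [/\ normal d (psi_set W) x v, `|v| < dl & psi_set W' (x + v)].
  have /compact_near_coveringP/(_ dfell (nbhs (W : dfell))) := cWK.
  move=> /(_ (fun W' x => psi_set W x ->
    exists v, [/\ normal d (psi_set W) x v, `|v| < dl & psi_set W' (x + v)]) _) cov.
  by apply: cov => x [Wx Kx]; exact: (normal_meets oU (W := W) Wx dl0).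
have near3 := nearest_normal oU W cK KU dl0.
apply: filterS (filterI nA (filterI meets near3)) => W' [AW' [meetsW' nearW']].
have ctrl := AB (W', dl) (conj AW' Bdl).
exists (normal_tube (d := d) (psi_set W) (psi_set W') Om dl); split.
- move=> [x v] [[/= Wx nv] Omx vdl W'xv]; apply: dom => //; exact: OmKr.
- move=> x [Wx Kx]; have [v [nv vdl W'xv]] := meetsW' x (conj Wx Kx) Wx.
  exists (x, v) => //; split=> //=.
  by exists x => //; exact: ballxx.
- apply: local_diffeo_normal_tube => //; [exact: psi_submanifold..|].
  move=> [x v] [[/= Wx nv] Omx vdl W'xv] zeta.
  have [tr _] := ctrl x Wx (OmKr x Omx).
  exact: tr.
- apply/seteqP; split=> y.
    by move=> [[[x v] [[/= Wx nv] Omx vdl W'xv] <-] Ky].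
  move=> [W'y Ky]; split=> //; have [x [Wx yx nx]] := nearW' y W'y Ky.
  exists (x, y - x); last by rewrite /expW /= addrC subrK.
  split=> //=; last by rewrite addrC subrK.
  by exists y => //; rewrite -ball_normE /=; exact: lt_trans dlrho.
- move=> V f oV sf fQ x [Wx Vx].
  have [[_ nfx] Omx fdl W'x] := fQ x (conj Wx Vx).
  have [_ sml] := ctrl x Wx (OmKr x Omx).
  apply: sml => // z WVz; have [[_ nz] _ _ W'z] := fQ z WVz.
  by split.
Qed.

Theorem nbhs_dfell_ls (D : psi -> set (E * E)) :
  (forall W : psi, exp_domain d U (psi_set W) (D W)) ->
  forall W : dfell, nbhs W = ls_nbhs D W.
Proof.
move=> eD W; apply/seteqP; split; first exact: ls_nbhs_sheets.
by move=> A [[K eps] [/= cK KU eps0] lsA]; apply: filterS lsA _; exact: ls_near.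
Qed.

End LeafSpaceNeighbourhoods.

(** * The Hausdorff property of the differential Fell topology *)

Section DfellHausdorff.
Context {R : realType} {n d : nat}.
Local Notation E := 'rV[R]_n.
Variable U : set E.
Hypothesis oU : open U.
Local Notation psi := (psi d U).
Local Notation dfell := (dfell d U).

Lemma psi_inj (W W' : psi) : psi_set W = psi_set W' -> W = W'.
Proof.
case: W W' => [A PA] [A' PA'] /= AA'; move: AA' PA PA' => -> PA PA'.
by rewrite (Prop_irrelevance PA PA').
Qed.

(** A small compact ball around [x] lies in [U] and is missed by [W']. Meeting it and missing it,
    with arbitrary planes, exclude each other, and missing is an open condition because the
    Grassmannian is compact. *)
Lemma dfell_separated_at (W W' : dfell) x : psi_set W x -> ~ psi_set W' x ->
  exists A A', [/\ nbhs W A, nbhs W' A' & forall W'', A W'' -> A' W'' -> False].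
Proof.
move=> Wx nW'x; have Ux : U x := psi_sub Wx.
have [e e0 eW'] := psi_near_notin Ux nW'x.
have /nbhs_ballP[e' /= e'0 e'U] : nbhs x U by exact: open_nbhs_nbhs.
pose r := Num.min e e' / 2.
have m0 : 0 < Num.min e e' by rewrite lt_min e0.
have [re re'] : r < e /\ r < e'.
  by apply/andP; rewrite -lt_min ltr_pdivrMr// ltr_pMr// ltr1n.
have r0 : 0 < r by rewrite divr_gt0.
pose C := [set y | `|x - y| <= r].
have CU : C `<=` U.
  by move=> y /= xy; apply: e'U; rewrite -ball_normE /=; exact: le_lt_trans re'.
have W'C : gauss W' `<=` ~` (set_val @^-1` C `*` [set: @Gr R d n]).
  by move=> [y P] [/= W'y _] [/= xy _]; apply: (eW' _ _ W'y); exact: le_lt_trans re.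
exists [set W'' : dfell | exists2 y, psi_set W'' y & C y],
  [set W'' : dfell | gauss W'' `<=` ~` (set_val @^-1` C `*` [set: @Gr R d n])]; split.
- apply: filterS (dfell_hit (O := set_val @^-1` ball x r `*` [set: @Gr R d n]) _ _).
  + move=> W'' [[y P] [[/= W''y _] [/= xy _]]]; exists (set_val y) => //.
    by move: xy; rewrite -ball_normE /= => /ltW.
  + rewrite openE => -[y P] [/= xy _]; apply: nbhs_setX; last exact: filterT.
    by apply: set_val_continuous; apply: open_nbhs_nbhs; split=> //; exact: ball_open.
  + have [P PE] := tangent_plane (psi_submanifold W) Wx.
    exists (exist _ x (mem_set Ux), P); split; first by split=> //=; rewrite set_valE.
    by split=> //=; rewrite set_valE; exact: ballxx.
- apply: dfell_miss => //; apply: compact_setX; last exact: Gr_compact.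
  by apply: compact_set_type => //; exact: closed_ball_compact.
- move=> W'' [y W''y Cy] W''C; have [P PE] := tangent_plane (psi_submanifold W'') W''y.
  apply: (W''C (exist _ y (mem_set (psi_sub W''y)), P)); first by split=> //=; rewrite set_valE.
  by split=> //=; rewrite set_valE.
Qed.

Lemma dfell_hausdorff : hausdorff_space dfell.
Proof.
move=> W W' cWW'; apply: psi_inj; apply: contrapT => neq.
have [x] : exists x, (psi_set W x /\ ~ psi_set W' x) \/ (psi_set W' x /\ ~ psi_set W x).
  apply: contrapT => nx; apply: neq; apply/seteqP; split=> x Wx; apply: contrapT => nWx.
    by apply: nx; exists x; left.
  by apply: nx; exists x; right.
move=> [[Wx nW'x]|[W'x nWx]].
  have [A [A' [nA nA' AA']]] := dfell_separated_at Wx nW'x.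
  by have [W'' []] := cWW' _ _ nA nA'; exact: AA'.
have [A [A' [nA nA' AA']]] := dfell_separated_at W'x nWx.
by have [W'' [] A'W'' AW''] := cWW' _ _ nA' nA; exact: (AA' W'').
Qed.

(** Separating [W'] from the limit [W] also separates it from a tail of the sequence; the finitely
    many other terms are removed one by one, points being closed. *)
Lemma nbhs_sequence_setC (w : nat -> dfell) (W W' : dfell) :
  w k @[k --> \oo] --> W -> W' <> W -> (forall k, W' <> w k) ->
  nbhs W' (~` range w).
Proof.
move=> wW W'W W'w.
have [A [A' [nA nA' AA']]] : exists A A',
    [/\ nbhs W A, nbhs W' A' & forall W'', A W'' -> A' W'' -> False].
  apply: contrapT => nsep; apply: W'W; apply/esym/dfell_hausdorff => A A' nA nA'.
  apply: contrapT => AA'; apply: nsep; exists A, A'; split=> // W'' AW'' A'W''.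
  by apply: AA'; exists W''.
have [N _ wN] := wW _ nA.
have finN : \forall W'' \near W', forall k : nat, (k < N)%N -> W'' <> w k.
  elim: N {wN} => [|N IH]; first by apply: filterS filterT => W'' _ k.
  have nN : \forall W'' \near W', W'' <> w N.
    have [B oB] : exists2 B : set dfell, open B & B W' /\ ~ B (w N).
      exists (~` [set w N]); last by split; [exact: W'w|apply].
      exact/closed_openC/accessible_closed_set1/hausdorff_accessible/dfell_hausdorff.
    move=> [BW' nB]; apply: filterS (open_nbhs_nbhs (conj oB BW')) => W'' BW'' e.
    by apply: nB; rewrite -e.
  by apply: filterS2 IH nN => W'' H1 H2 k; rewrite ltnS leq_eqVlt => /orP[/eqP ->|/H1].
apply: filterS2 nA' finN => W'' A'W'' fW'' [k _ kW''].
have [kN|Nk] := ltnP k N; first by exact: (fW'' k).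
by apply: (AA' W'') => //; rewrite -kW''; exact: wN.
Qed.

End DfellHausdorff.

(** * Parallel affine sheets and their limit *)

Section AffineLeaves.
Context {R : realType} {n d : nat}.
Local Notation E := 'rV[R]_n.
Variables (U : set E) (B : 'M[R]_(d, n)) (e p : E).
Hypotheses (oU : open U) (BB : B *m B^T = 1%:M) (eB : e *m B^T = 0) (e0 : e != 0).

Definition affine (q : E) : set E := [set y | ((y - q)%R <= B)%MS].

Lemma affineP q y : affine q y <-> y = q + (y - q) *m B^T *m B.
Proof.
split=> [/submxP[w yq]|yq]; last first.
  by rewrite /affine /= {1}yq addrC addKr submxMl.
by rewrite yq -[w *m B *m B^T]mulmxA BB mulmx1 -yq addrC subrK.
Qed.

Lemma affine_closed q : closed (affine q).
Proof.
rewrite (_ : affine q = (fun y : E => (y - q) *m cokermx B) @^-1` [set 0]); last first.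
  by apply/seteqP; split=> y; rewrite /affine /= submxE => /eqP.
apply: preimage_closed; last by apply: accessible_closed_set1; exact/hausdorff_accessible/norm_hausdorff.
move=> y _; apply: (@continuous_comp _ _ _ (fun y : E => y - q) (mulmxr (cokermx B))).
  by apply: continuousB; [exact: cvg_id|exact: cst_continuous].
exact: mulmxr_continuous.
Qed.

Lemma affine_parametrization (W V : set E) q x :
  open V -> V x -> W x -> (forall y, V y -> W y <-> affine q y) ->
  parametrization W x ((fun w : 'rV[R]_d => q + w *m B) @^-1` V) V
    (fun w => q + w *m B) (fun y => (y - q) *m B^T) ((x - q) *m B^T).
Proof.
move=> oV Vx Wx WA.
have cphi k : Ck k setT (fun w : 'rV[R]_d => q + w *m B).
  apply: (@CkD _ _ _ _ _ (cst q) (mulmxr B)); first exact: openT.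
    exact: Ck_cst.
  exact/Ck_linear/mulmxr_continuous.
have cg k : Ck k setT (fun y : E => (y - q) *m B^T).
  apply: (@Ck_lin _ _ _ _ _ _ (fun y : E => y - q) (mulmxr B^T)); first exact: openT.
    exact: mulmxr_continuous.
  by apply: Ck_subr; [exact: openT|exact: Ck_id].
have gphi w : (q + w *m B - q) *m B^T = w.
  by rewrite [q + _]addrC addrK -mulmxA BB mulmx1.
have phig y : W y -> V y -> q + (y - q) *m B^T *m B = y.
  by move=> Wy Vy; apply/esym/affineP; exact/WA.
split=> //.
- apply: open_comp => // w _; exact: (cphi 0%N w I).
- split.
  + exact: (smooth_open_on openT _ cphi).
  + exact: (smooth_open_on openT _ cg).
  + move=> w Vw; split; last exact: gphi.
    by split=> //; apply/WA => //; apply/affineP; rewrite gphi.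
  + by move=> y [Wy Vy]; rewrite /= phig.
- by rewrite /= phig.
- by rewrite phig.
Qed.

Lemma affine_tangent (W V : set E) q x :
  open V -> V x -> W x -> (forall y, V y -> W y <-> affine q y) ->
  tangent d W x = [set xi | (xi <= B)%MS].
Proof.
move=> oV Vx Wx WA; have pW := affine_parametrization oV Vx Wx WA.
rewrite (tangent_jacobian pW).
have -> // : jacobian (fun w : 'rV[R]_d => q + w *m B) ((x - q) *m B^T) = B.
apply: jacobian_diff.
have cB : continuous (mulmxr B : 'rV[R]_d -> E) by exact: mulmxr_continuous.
apply/funext => v; rewrite -deriveE.
  have -> : (fun w : 'rV[R]_d => q + w *m B) = cst q + mulmxr B by [].
  rewrite deriveD; [|exact: derivable_cst|].
    by rewrite derive_cst add0r deriveE ?diff_linE//; exact: linear_differentiable.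
  by apply/diff_derivable/linear_differentiable.
apply: differentiableD; first exact: differentiable_cst.
exact: (@linear_differentiable _ _ _ (mulmxr B)).
Qed.

(* Two parallel sheets, which coincide for a = 0. *)
Definition leaf_set (a : R) : set E := U `&` (affine p `|` affine (p + a *: e)).

Lemma affine_disjoint (a : R) y : affine p y -> affine (p + a *: e) y -> a = 0.
Proof.
move=> /affineP yp /affineP ype.
have : (a *: e) *m e^T = 0.
  have -> : a *: e = (y - p) *m B^T *m B - (y - (p + a *: e)) *m B^T *m B.
    apply/(addrI p)/(addIr ((y - (p + a *: e)) *m B^T *m B)).
    by rewrite -ype addrA subrK -yp.
  have Be : B *m e^T = 0 by rewrite -[B]trmxK -trmx_mul eB trmx0.
  by rewrite mulmxBl -!(mulmxA _ B) Be !mulmx0 subr0.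
rewrite -scalemxAl => /matrixP/(_ 0 0); rewrite mxE -dotE mxE => /eqP.
rewrite mulf_eq0 => /orP[/eqP //|/eqP/dot_eq0 ee].
by move: e0; rewrite ee eqxx.
Qed.

Lemma leaf_local a x : leaf_set a x -> exists V q,
  [/\ open V, V x & forall y, V y -> leaf_set a y <-> affine q y].
Proof.
move=> [Ux]; have [->|a0] := eqVneq a 0.
  move=> _; exists U, p; split=> // y Uy; rewrite /leaf_set scale0r addr0 setUid.
  by split=> [[]|].
move=> [px|pax].
- exists (U `&` ~` affine (p + a *: e)), p; split.
  + apply: openI => //; exact/closed_openC/affine_closed.
  + by split=> // /(affine_disjoint px)/eqP; rewrite (negPf a0).
  + by move=> y [Uy npy]; split=> [[_ []]//|py]; split=> //; left.
- exists (U `&` ~` affine p), (p + a *: e); split.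
  + apply: openI => //; exact/closed_openC/affine_closed.
  + by split=> // /affine_disjoint/(_ pax)/eqP; rewrite (negPf a0).
  + by move=> y [Uy npy]; split=> [[_ []]//|py]; split=> //; right.
Qed.

Lemma leaf_proper a : proper_submanifold d U (leaf_set a).
Proof.
split; first by move=> x [].
- rewrite (_ : _ @^-1` _ = set_val @^-1` (affine p `|` affine (p + a *: e))); last first.
    by apply/seteqP; split=> -[x Ux]; rewrite /= set_valE /=; [case|split=> //; exact: set_mem Ux].
  apply: preimage_closed; first by move=> x _; exact: set_val_continuous.
  by apply: closedU; exact: affine_closed.
- move=> x Wx; have [V [q [oV Vx WA]]] := leaf_local Wx.
  by do 5 eexists; exact: affine_parametrization oV Vx Wx WA.
Qed.

Lemma leaf_tangent a x : leaf_set a x -> tangent d (leaf_set a) x = [set xi | (xi <= B)%MS].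
Proof.
by move=> Wx; have [V [q [oV Vx WA]]] := leaf_local Wx; exact: affine_tangent oV Vx Wx WA.
Qed.

Definition leaf (a : R) : psi d U := Psi (leaf_proper a).

Lemma leaf_cvg : (leaf a : dfell d U) @[a --> 0] --> (leaf 0 : dfell d U).
Proof.
have FF : Filter ((fun a => leaf a : psi d U) @ (0 : R)).
  exact: fmap_filter.
apply: (dfell_filter FF).
- move=> O oO [[x P] [[/= Wx Px] Ox]].
  suff : \forall a \near (0 : R), gauss (leaf a) `&` O !=set0 by [].
  (* The sheet [affine p] belongs to every [leaf a], so a hit persists for all [a]. *)
  apply: filterS filterT => a _; exists (x, P); split=> //; split=> /=.
    by case: Wx => Ux [?|]; split=> //; [left|left; move: b; rewrite scale0r addr0].
  rewrite Px leaf_tangent// leaf_tangent//.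
  by case: Wx => Ux [?|]; split=> //; [left|left; move: b; rewrite scale0r addr0].
- move=> K cK WK.
  suff : \forall a \near (0 : R), gauss (leaf a) `<=` ~` K by [].
  have [A PA] : exists A : @Gr R d n, plane A = [set xi | (xi <= B)%MS].
    by apply: submx_plane; apply/row_freeP; exists B^T.
  have /compact_near_coveringP/(_ R (nbhs (0 : R))) := cK.
  move=> /(_ (fun a z => ~ CL_set (gauss (leaf a)) z) _) cov.
  apply: filterS (cov _) => [a aK z zW Kz|]; first exact: (aK z).
  move=> [x P] Kx.
  (* All leaves have the tangent plane [A]. A pair with another plane is avoided by separating
     planes; a pair with plane [A] has its point off the closed set [affine p], and translating by
     [a *: e] with small [a] does not bring the sheet close to it. *)
  have [PA'|PA'] := pselect (P = A); last first.
    have [ O0 [ O1 [nO0 nO1 O01]]] := Gr_separated PA'.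
    exists ([set z : set_type U * @Gr R d n | O0 z.2], setT) => /=.
      split; last exact: filterT.
      by exists (setT, O0) => //=; [split=> //; exact: filterT|move=> [? ?] []].
    move=> [[y Q] a] /= [ O0Q _] [/= Wy QE].
    have QA : Q = A by apply: plane_inj; rewrite PA -(leaf_tangent Wy).
    by apply: (O01 Q) => //; rewrite QA; exact: nbhs_singleton.
  have nx : ~ affine p (set_val x).
    move=> px; apply: (WK (x, P)) => //.
    have Wx : leaf_set 0 (set_val x).
      by split; [case: (x) => y Uy; rewrite set_valE; exact: set_mem Uy|left].
    by split=> //=; rewrite leaf_tangent// -PA -PA'.
  have nO : nbhs (set_val x) (~` affine p).
    by apply: open_nbhs_nbhs; split=> //; exact/closed_openC/affine_closed.
  have /nbhs_ballP[r /= r0 rp] := nO.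
  have r20 : 0 < r / 2 by rewrite divr_gt0.
  have ne0 : 0 < `|e| by rewrite normr_gt0.
  exists ((set_val @^-1` ball (set_val x) (r / 2)) `*` setT, [set a | `|a| < r / 2 / `|e|]).
    split=> /=.
      apply: nbhs_setX; last exact: filterT.
      by apply: set_val_continuous; exact: nbhsx_ballx.
    have /nbhs_ballP : exists2 s : R, 0 < s & ball (0 : R) s `<=` [set a | `|a| < r / 2 / `|e|].
      exists (r / 2 / `|e|); first exact: divr_gt0.
      by move=> a; rewrite -ball_normE /= sub0r normrN.
    by [].
  move=> [[y Q] a] /= [[]]; rewrite -ball_normE /= => xy _; rewrite ltr_pdivlMr// => ar.
  move=> [[_ [py|pay]] _].
    by apply: (rp (set_val y)) => //; rewrite -ball_normE /=; lra.
  apply: (rp (set_val y - a *: e)); last by rewrite /affine /= -addrA -opprD [_ + p]addrC.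
  rewrite -ball_normE /= opprB addrCA; apply: le_lt_trans (ler_normD _ _) _.
  by rewrite normrZ; lra.
Qed.

End AffineLeaves.

(** * A set open only in the finer topology *)

Section Strictness.
Context {R : realType} {n d : nat}.
Local Notation E := 'rV[R]_n.
Variables (U : set E) (oU : open U).

(* A section of the normal bundle of one sheet reaches p and p + a e only from
   the foot point p. *)
Lemma leaf_not_gs (B : 'M[R]_(d, n)) (e p : E) (BB : B *m B^T = 1%:M)
    (eB : e *m B^T = 0) (e0 : e != 0) (D : set (E * E)) (K : set E) eps a :
  a != 0 -> K p -> U p -> K (p + a *: e) -> U (p + a *: e) ->
  ~ gs (leaf p oU BB eB e0 0) D K eps (leaf p oU BB eB e0 a).
Proof.
move=> a0 Kp Up Kpa Upa [f [[sf nf] _ fW' _]].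
have foot b x : leaf_set U B e p 0 x -> x + f x = p + b *: e -> x = p.
  move=> Wx xfx; have nx := nf x Wx.
  have px : affine B p x by case: (Wx) => _ []//; rewrite scale0r addr0.
  have Bt w : dot (w *m B) (f x) = 0.
    by apply: nx; rewrite leaf_tangent//= submxMl.
  have Be w : dot (w *m B) e = 0.
    by rewrite dotC dotE trmx_mul mulmxA eB mul0mx mxE.
  have [w xpw] := submxP px.
  apply/eqP; rewrite -subr_eq0; apply/eqP/dot_eq0.
  have {2}-> : x - p = b *: e - f x.
    by apply/eqP; rewrite subr_eq addrAC eq_sym subr_eq addrC -xfx addrC.
  by rewrite xpw dotC dotBl !(dotC _ (w *m B)) dotZr Be mulr0 Bt subr0.
have hit b : (b == 0) || (b == a) -> K (p + b *: e) -> U (p + b *: e) -> f p = b *: e.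
  move=> b0 Kb Ub.
  have : (leaf_set U B e p a `&` K) (p + b *: e).
    split=> //; split=> //; case/orP: b0 => /eqP ->; [left|right].
      by rewrite /affine /= scale0r addr0 subrr sub0mx.
    by rewrite /affine /= subrr sub0mx.
  rewrite -fW' => -[[x Wx xf] _]; have xp := foot b x Wx xf.
  by move: xf; rewrite xp => /addrI.
have := hit 0; rewrite eqxx scale0r addr0 => /(_ isT Kp Up) fp.
have := hit a; rewrite eqxx orbT fp => /(_ isT Kpa Upa)/esym/eqP.
by rewrite scaler_eq0 (negPf a0) (negPf e0).
Qed.

Lemma normal_frame_exists : (d < n)%N -> exists (B : 'M[R]_(d, n)) (e : E),
  [/\ B *m B^T = 1%:M, e *m B^T = 0 & e != 0].
Proof.
move=> dn; exists (pid_mx d).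
have /rowV0Pn[e /sub_kermxP eB e0] : kermx ((pid_mx d : 'M[R]_(d, n))^T) != 0.
  rewrite -mxrank_eq0 mxrank_ker subn_eq0 -ltnNge.
  exact: leq_ltn_trans (rank_leq_col _) dn.
by exists e; split=> //; rewrite tr_pid_mx pid_mx_id ?pid_mx_1// ltnW.
Qed.

Lemma grw_open_not_dfell_open (D : psi d U -> set (E * E)) :
  (forall W, exp_domain d U (psi_set W) (D W)) -> U !=set0 -> (d < n)%N ->
  exists2 A : set (dfell d U), grw_open D A & ~ open A.
Proof.
move=> eD [p Up] /normal_frame_exists[B [e1 [BB e1B e10]]].
have /nbhs_ballP[r /= r0 rU] : nbhs p U by exact: open_nbhs_nbhs.
have ne10 : 0 < `|e1| by rewrite normr_gt0.
(* The scaling gives [e] the norm [r / 2]; as [harmonic k] is at most 1, the compact ball [K] inside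
   [U] contains [p] and every [p + harmonic k *: e]. *)
pose c := r / 2 / `|e1|; have c0 : 0 < c by rewrite !divr_gt0.
pose e := c *: e1.
have eB : e *m B^T = 0 by rewrite -scalemxAl e1B scaler0.
have e0 : e != 0 by rewrite scaler_eq0 negb_or e10 andbT gt_eqF.
have ne : `|e| = r / 2 by rewrite normrZ gtr0_norm// divfK// gt_eqF.
pose K := [set y | `|p - y| <= r / 2].
have KU : K `<=` U.
  by move=> y /= py; apply: rU; rewrite -ball_normE /=; apply: le_lt_trans py _; lra.
have Kp : K p by rewrite /K /= subrr normr0; lra.
have Kh k : K (p + harmonic k *: e).
  rewrite /K /= opprD addNKr normrN normrZ ne ger0_norm ?ler_piMl//; first by lra.
  by rewrite /harmonic /= invf_le1 ?ler1n.
have h0 k : harmonic k != 0 :> R by rewrite gt_eqF// harmonic_gt0.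
pose W0 : dfell d U := leaf p oU BB eB e0 0.
pose w k : dfell d U := leaf p oU BB eB e0 (harmonic k).
have W0w k : W0 <> w k.
  move=> /(congr1 (fun W : dfell d U => psi_set W)) /= W0k.
  have : leaf_set U B e p 0 (p + harmonic k *: e).
    rewrite W0k; split; first exact/KU/Kh.
    by right; rewrite /affine /= subrr sub0mx.
  rewrite /leaf_set scale0r addr0 setUid => -[_ ph].
  have hh : affine B (p + harmonic k *: e) (p + harmonic k *: e).
    by rewrite /affine /= subrr sub0mx.
  by have /eqP := affine_disjoint BB eB e0 ph hh; apply/negP/h0.
have wW0 : w k @[k --> \oo] --> W0.
  move=> A nA; have nA' := leaf_cvg nA.
  exact: (cvg_harmonic nA').
exists (~` range w).
- move=> W nW; have [->|WW0] := pselect (W = W0).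
    (* This [K] excludes all [w k] at once, whatever the size bound; 1 is an arbitrary choice. *)
    exists (K, 1) => /=; first by split=> //; exact: closed_ball_compact.
    move=> W' W'gs [k _ wk]; move: W'gs; rewrite -wk.
    by apply: leaf_not_gs => //; exact/KU/Kh.
  apply: gs_nbhs_sheets => //; apply: (nbhs_sequence_setC oU wW0) => // k Wk.
  by apply: nW; exists k.
- move=> oA; have nW0 : nbhs W0 (~` range w).
    by apply: open_nbhs_nbhs; split=> // -[k _] /esym; exact: W0w.
  by have [N _ /(_ N (leqnn N))] := wW0 _ nW0; apply; exists N.
Qed.

End Strictness.

(** The conditions for strictness exclude the degenerate cases. If [U] is empty or [n < d], the
    empty set is the only submanifold. If [d = n], normal spaces vanish, both [ls] and [gs] say that
    [W] and [W'] agree on [K], and the two topologies coincide. *)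
Theorem theorem3 (R : realType) (n d : nat) (U : set 'rV[R]_n)
    (D : psi d U -> set ('rV[R]_n * 'rV[R]_n)) :
  open U -> (forall W : psi d U, exp_domain d U W (D W)) ->
  [/\ forall W : dfell d U, nbhs W = ls_nbhs D W,
      (open : set_system (dfell d U)) `<=` grw_open D &
      U !=set0 -> (d < n)%N ->
        (open : set_system (dfell d U)) `<` grw_open D].
Proof.
move=> oU eD.
have sub : (open : set_system (dfell d U)) `<=` grw_open D.
  by move=> A oA W AW; apply: gs_nbhs_sheets => //; exact: open_nbhs_nbhs.
split=> //; first exact: nbhs_dfell_ls.
move=> U0 dn; have [A grwA nA] := grw_open_not_dfell_open oU eD U0 dn.
by split=> // grwD; exact/nA/grwD.
Qed.
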